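(* Let $\Gamma$ be a finitely generated (discrete) group, let $G$ be a compact metrizable abelian group, and let $P:\Gamma\to G$ be a polynomial map. Then $P$ is uniquely ergodic.
   Context: Polynomial maps: for $f:\Gamma\to G$ ($G$ abelian, additive) and $\gamma\in\Gamma$, let $\Delta_\gamma f(x)=f(\gamma x)-f(x)$. A map $P:\Gamma\to G$ is a polynomial map of degree at most $d$ ($d\ge0$) if $\Delta_{\gamma_{d+1}}\cdots\Delta_{\gamma_1}P=0$ for all $\gamma_1,\dots,\gamma_{d+1}\in\Gamma$; it is a polynomial map if this holds for some $d$. The space $G^\Gamma$ of all functions $\Gamma\to G$ has the product topology, and $\Gamma$ acts on it by $(\gamma\cdot\phi)(x)=\phi(\gamma^{-1}x)$. For $\phi\in G^\Gamma$, $\overline{\Gamma\phi}$ denotes the closure of the orbit $\Gamma\phi=\{\gamma\cdot\phi:\gamma\in\Gamma\}$. The function $\phi$ is uniquely ergodic if there exists a unique $\Gamma$-invariant Borel probability measure on $G^\Gamma$ whose support is contained in $\overline{\Gamma\phi}$. *)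

(* Defs.v *)
From HB Require Import structures.
From mathcomp Require Import all_boot all_order all_algebra.
From mathcomp Require Import all_classical all_reals all_analysis.

Set Implicit Arguments.
Unset Strict Implicit.
Unset Printing Implicit Defensive.

Import Order.TTheory GRing.Theory Num.Theory.
Local Open Scope classical_set_scope.
Local Open Scope ring_scope.

Definition generated_subgroup (Gamma : groupType) (S : set Gamma) : set Gamma :=
  smallest (fun H : set Gamma => group_closed [in H]) S.

Definition finitely_generated (Gamma : groupType) : Prop :=
  exists S : set Gamma, finite_set S /\ generated_subgroup S = [set: Gamma].

(* Nonnegativity of [d] follows from the first three conditions. *)
Definition metrizable (R : realType) (T : topologicalType) : Prop :=
  exists d : T -> T -> R,
    [/\ forall x y, d x y = 0 <-> x = y,
        forall x y, d x y = d y x,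
        forall x y z, d x z <= d x y + d y z &
        forall x (A : set T),
          nbhs x A <-> exists2 e : R, 0 < e & [set y | d x y < e] `<=` A].

Section polynomial_maps.
Variables (Gamma : groupType) (G : zmodType).
Implicit Types (f P : Gamma -> G) (g : Gamma).

Definition Delta g f : Gamma -> G := fun x => f (g * x)%g - f x.

(* [foldl] applies the difference operator of the head of the tuple first. *)
Definition polynomial_of_degree_le (d : nat) P : Prop :=
  forall gs : d.+1.-tuple Gamma,
    foldl (fun f g => Delta g f) P gs = (fun=> 0).

Definition polynomial_map P : Prop := exists d, polynomial_of_degree_le d P.

End polynomial_maps.

(* An alias of [{ptws I -> V}] that is pointed when [V] is a topological
   abelian group: generated sigma-algebras are only equipped with a
   [measurableType] structure on pointed types, and [topologicalZmodType] does
   not inherit from [pointedType]. *)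
Definition fun_space (I V : Type) : Type := {ptws I -> V}.

HB.instance Definition _ (I : Type) (V : topologicalType) :=
  Topological.copy (fun_space I V) {ptws I -> V}.
HB.instance Definition _ (I : Type) (V : topologicalZmodType) :=
  isPointed.Build (fun_space I V) (fun=> 0).

Notation borel_type T := (g_sigma_algebraType (@open T)).

Definition measure_support (R : realType) (T : ptopologicalType)
    (mu : probability (borel_type T) R) : set T :=
  [set x | forall U : set T, open U -> U x -> (0 < mu U)%E].

Section unique_ergodicity.
Variables (R : realType) (Gamma : groupType) (G : topologicalZmodType).
Local Notation X := (fun_space Gamma G).
Implicit Types (phi : X) (mu nu : probability (borel_type X) R).

Definition translate (g : Gamma) phi : X := fun x => phi (g^-1 * x)%g.

Definition orbit_closure phi : set X := closure (range (translate^~ phi)).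

Definition invariant_measure mu : Prop :=
  forall (g : Gamma) (A : set (borel_type X)), measurable A ->
    pushforward mu (translate g : borel_type X -> borel_type X) A = mu A.

Definition invariant_on_orbit_closure phi mu : Prop :=
  invariant_measure mu /\ measure_support mu `<=` orbit_closure phi.

(* Measures are functions on all sets, constrained only on measurable ones, so
   uniqueness is agreement on Borel sets rather than Leibniz equality. *)
Definition uniquely_ergodic phi : Prop :=
  exists mu, invariant_on_orbit_closure phi mu /\
    forall nu, invariant_on_orbit_closure phi nu ->
      forall A : set (borel_type X), measurable A -> nu A = mu A.

End unique_ergodicity.

Arguments uniquely_ergodic R {Gamma G} phi.

(* Main.v *)
(* Existence: the maps of degree at most [d] carry a central filtration of
   [Gamma], and iterated Cesaro averages along it give a mean on [Gamma] that is
   translation invariant on functions of [g |-> translate g P].  This mean is an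
   invariant content on [G^Gamma], which compactness turns into a measure.

   Uniqueness: a character of [G^Gamma] along the orbit of [P] is a phase
   polynomial [u].  If a power of [u] is constant, then [u] has finitely many
   translates, because [Gamma] is finitely generated, and every invariant measure
   integrates [u] to their average.  Otherwise the integral vanishes, by van der
   Corput's inequality or because [u] is a coboundary.  Hence all invariant
   measures have the same Fourier coefficients, and by the Peter-Weyl theorem for
   compact abelian groups, proved with projections in the convolution algebra of
   real even functions, they agree on cylinders. *)
Require Import Defs.
From HB Require Import structures.
From mathcomp Require Import all_boot all_order all_algebra.
From mathcomp Require Import all_classical all_reals all_analysis.
From mathcomp Require Import measurable_realfun zify ring lra complex.

Set Implicit Arguments.
Unset Strict Implicit.
Unset Printing Implicit Defensive.

Import Order.TTheory GRing.Theory Num.Theory.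
Import numFieldNormedType.Exports.
Local Open Scope classical_set_scope.
Local Open Scope ring_scope.

(** * Phase polynomials *)

(** [Gamma] may be far from amenable. It can be averaged over because it acts on polynomial maps of
    bounded degree by unipotent operators: grading an element by the number of degrees that its
    difference operator removes gives a filtration in which every commutator goes one step further
    and whose last terms fix all translates of [P].

    For uniqueness, a measure is only seen through the functional that it induces on functions of
    [Gamma], read along the orbit; this loses nothing, since the orbit is dense in a set of full
    measure. The delicate phase polynomials are those that are not torsion although all their
    difference quotients are: their correlations need not vanish, so van der Corput's inequality is
    silent and a coboundary has to be exhibited.

    Peter-Weyl is run with even real kernels because convolution by them is self-adjoint. Spectral
    projections are then limits of convolution powers, and a projection that cannot be split further
    satisfies d'Alembert's functional equation, whose solutions are real parts of characters. *)

Section phase_polynomials.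
Variables (Gamma : groupType) (K : numClosedFieldType).
Implicit Types (u v f : Gamma -> K) (a g : Gamma).

Definition phase_diff g u : Gamma -> K := fun x => u (g * x)%g / u x.
Arguments phase_diff : simpl never.

(** Degree at most [n], whereas [vanishing n] below means degree less than [n]. *)
Fixpoint phase_poly n u : Prop :=
  if n is n'.+1 then forall g, phase_poly n' (phase_diff g u)
  else forall x y, u x = u y.

Definition torsion u : Prop :=
  exists2 M, (0 < M)%N & forall x y, u x ^+ M = u y ^+ M.

Lemma phase_diff_neq0 g u : (forall x, u x != 0) ->
  forall x, phase_diff g u x != 0.
Proof. by move=> u0 x; rewrite mulf_neq0 ?invr_neq0. Qed.

Lemma phase_poly_mul n u v :
  phase_poly n u -> phase_poly n v -> phase_poly n (fun x => u x * v x).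
Proof.
elim: n u v => /= [u v cu cv x y|n IHn u v pu pv g]; first by rewrite (cu x y) (cv x y).
have -> : phase_diff g (fun x => u x * v x) =
    (fun x => phase_diff g u x * phase_diff g v x).
  by apply/funext => x; rewrite /phase_diff invfM mulrACA.
exact: IHn.
Qed.

Lemma phase_poly_cst n (c : K) : phase_poly n (fun=> c).
Proof. by elim: n c => [|n IHn] c //= g; exact: IHn. Qed.

Lemma phase_poly_trans n u g :
  phase_poly n u -> phase_poly n (fun x => u (g * x)%g).
Proof.
elim: n u => /= [u cu x y|n IHn u pu h]; first exact: cu.
have -> : phase_diff h (fun x => u (g * x)%g) =
    (fun x => phase_diff (g * h * g^-1)%g u (g * x)%g).
  by apply/funext => x; rewrite /phase_diff !mulgA mulgVK.
exact: IHn.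
Qed.

Lemma torsion_mul u v : torsion u -> torsion v -> torsion (fun x => u x * v x).
Proof.
move=> [M M0 uM] [N N0 vN]; exists (M * N)%N; first by rewrite muln_gt0 M0.
by move=> x y; rewrite !exprMn !exprM (uM x y) ![v _ ^+ M ^+ N]exprAC (vN x y).
Qed.

Lemma torsion_inv u : torsion u -> torsion (fun x => (u x)^-1).
Proof.
by move=> [M M0 uM]; exists M => // x y; rewrite !exprVn (uM x y).
Qed.

Lemma torsion_trans g u : torsion u -> torsion (fun x => u (g * x)%g).
Proof. by move=> [M M0 uM]; exists M => // x y; rewrite (uM _ (g * y)%g). Qed.

Lemma torsion_root k u : (0 < k)%N -> torsion (fun x => u x ^+ k) -> torsion u.
Proof.
move=> k0 [M M0 uM]; exists (k * M)%N; first by rewrite muln_gt0 k0.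
by move=> x y; rewrite !exprM.
Qed.

Lemma torsion_prod k (w : 'I_k -> Gamma -> K) : (forall i, torsion (w i)) ->
  torsion (fun x => \prod_(i < k) w i x).
Proof.
elim: k w => [|k IHk] w tw.
  by exists 1%N => // x y; rewrite !big_ord0.
have -> : (fun x => \prod_(i < k.+1) w i x) =
    (fun x => (\prod_(i < k) w (widen_ord (leqnSn k) i) x) * w ord_max x).
  by apply/funext => x; rewrite big_ord_recr.
by apply: torsion_mul => //; exact: IHk.
Qed.

Lemma trans_expg u a k x : (forall x, u x != 0) ->
  u (a ^+ k * x)%g = u x * \prod_(i < k) phase_diff a u (a ^+ i * x)%g.
Proof.
move=> u0; elim: k => [|k IHk]; first by rewrite mul1g big_ord0 mulr1.
rewrite big_ord_recr /= mulrA -IHk /phase_diff mulgA -expgS mulrC.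
by rewrite -mulrA mulVf ?mulr1.
Qed.

Lemma phase_diff_expg u a k : (forall x, u x != 0) ->
  phase_diff (a ^+ k)%g u = (fun x => \prod_(i < k) phase_diff a u (a ^+ i * x)%g).
Proof.
by move=> u0; apply/funext=> x; rewrite {1}/phase_diff trans_expg // mulrC mulKf.
Qed.

(* Additively, [(L^k - 1) / (L - 1) = k + nilpotent] is invertible over Q, where
   [L] is translation by [a] acting on polynomials. *)
Lemma torsion_of_norm a k n v : (0 < k)%N -> (forall x, v x != 0) ->
  phase_poly n v -> torsion (fun x => \prod_(i < k) v (a ^+ i * x)%g) -> torsion v.
Proof.
move=> k0; elim: n v => [|n IHn] v v0 pv tV.
  by exists 1%N => // x y; rewrite (pv x y).
(* The norm of [phase_diff a v] is the quotient of two translates of the norm of [v], hence torsion,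
   so the induction hypothesis applies. *)
have tdv : torsion (phase_diff a v).
  apply: IHn; [exact: phase_diff_neq0|exact: pv|].
  have -> : (fun x => \prod_(i < k) phase_diff a v (a ^+ i * x)%g) =
     (fun x => (\prod_(i < k) v (a ^+ i * (a * x))%g) *
               (\prod_(i < k) v (a ^+ i * x)%g)^-1).
    apply/funext => x; rewrite -prodf_div; apply: eq_bigr => i _.
    by rewrite /phase_diff !mulgA -expgS -expgSr.
  by apply: torsion_mul; [exact: (torsion_trans a tV)|exact: torsion_inv].
apply: (@torsion_root k) => //.
(* [v (a ^+ i * x) = v x * w i x], so the norm of [v] is [v ^+ k] times the product of the [w i],
   which are torsion because [phase_diff a v] is. *)
pose w i x := \prod_(j < i) phase_diff a v (a ^+ j * x)%g.
have -> : (fun x => v x ^+ k) =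
    (fun x => (\prod_(i < k) v (a ^+ i * x)%g) * (\prod_(i < k) w i x)^-1).
  apply/funext => x; rewrite -prodf_div -[in LHS](card_ord k) -prodr_const.
  apply: eq_bigr => i _; rewrite trans_expg // mulfK //.
  by apply/prodf_neq0 => j _; exact: phase_diff_neq0.
apply: torsion_mul => //; apply: torsion_inv; apply: torsion_prod => i.
by apply: torsion_prod => j; exact: torsion_trans.
Qed.

(** By induction [phase_diff a f] has a period [k] along the powers of [a]. Its product [h] over one
    period satisfies [f (a ^+ (k * j) * x) = f x * h x ^+ j] and [h x ^+ M = 1], so [k * M] is a
    period of [f]. *)
Lemma torsion_period a n f : (forall x, f x != 0) -> phase_poly n f -> torsion f ->
  exists2 k, (0 < k)%N & forall x, f (a ^+ k * x)%g = f x.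
Proof.
elim: n f => [|n IHn] f f0 pf [M M0 fM]; first by exists 1%N.
have df1 x : phase_diff a f x ^+ M = 1.
  by rewrite /phase_diff expr_div_n (fM _ x) divff // expf_neq0.
have [k k0 dfk] : exists2 k, (0 < k)%N &
    forall x, phase_diff a f (a ^+ k * x)%g = phase_diff a f x.
  apply: IHn => //; first exact: phase_diff_neq0.
  by exists M => // x y; rewrite !df1.
pose h x := \prod_(i < k) phase_diff a f (a ^+ i * x)%g.
have hk x : h (a ^+ k * x)%g = h x.
  by apply: eq_bigr => i _; rewrite mulgA -expgnDr addnC expgnDr -mulgA dfk.
have fh j x : f (a ^+ (k * j) * x)%g = f x * h x ^+ j.
  elim: j x => [|j IHj] x; first by rewrite muln0 mul1g expr0 mulr1.
  by rewrite mulnS addnC expgnDr -mulgA IHj hk trans_expg // -mulrA -exprS.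
exists (k * M)%N; first by rewrite muln_gt0 k0.
move=> x; rewrite fh -prodrXl big1 ?mulr1 // => i _; exact: df1.
Qed.

End phase_polynomials.

Lemma finitely_generated_ind (Gamma : groupType) : finitely_generated Gamma ->
  exists S : seq Gamma, forall H : Gamma -> Prop, H 1%g ->
    (forall x y, H x -> H y -> H (x / y)%g) ->
    (forall s, s \in S -> H s) -> forall g, H g.
Proof.
move=> [S [/finite_seqP [s ->]] gS]; exists s => H H1 HB Hs g.
have : generated_subgroup [set` s] g by rewrite gS.
apply: (@smallest_sub _ (fun H : set Gamma => group_closed [in H])).
  by split=> [|x y]; rewrite !inE //; exact: HB.
by move=> x /= /Hs.
Qed.

(** * Invariant states and van der Corput's inequality *)

Section states.
Variables (R : realType) (Gamma : groupType).
Local Notation C := R[i].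
Implicit Types (f u v : Gamma -> C) (a g : Gamma).

Lemma complex_archi0 (t : C) : 0 <= t -> (forall N : nat, N%:R * t <= 1) -> t = 0.
Proof.
move=> t0 Nt; have tE : t = (complex.Re t)%:C%C by rewrite RRe_real // ger0_real.
move: t0 Nt; rewrite tE; move: (complex.Re t) => r; rewrite lecR => r0 Nr.
congr (_%:C)%C; apply/eqP; rewrite eq_le r0 andbT leNgt; apply/negP => r_gt0.
have := Nr (Num.bound r^-1); rewrite -(rmorph_nat (real_complex R)) -rmorphM /=.
have -> : (1 : C) = (1%:C)%C by [].
rewrite lecR leNgt => /negP; apply.
by rewrite -ltr_pdivrMr // div1r archi_boundP // invr_ge0.
Qed.

(** A translation-invariant state on a unital star-algebra [D] of functions on [Gamma]. The example
    in view is integration over [G^Gamma] of continuous functions, read along the orbit of [P]. *)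
Record invariant_state (D : set (Gamma -> C)) (m : (Gamma -> C) -> C) : Prop := {
  state_cst : forall c, D (fun=> c);
  state_add : forall f f', D f -> D f' -> D (fun x => f x + f' x);
  state_mul : forall f f', D f -> D f' -> D (fun x => f x * f' x);
  state_conj : forall f, D f -> D (fun x => (f x)^*);
  state_trans : forall g f, D f -> D (fun x => f (g * x)%g);
  stateD : forall f f', D f -> D f' -> m (fun x => f x + f' x) = m f + m f';
  stateZ : forall c f, D f -> m (fun x => c * f x) = c * m f;
  state1 : m (fun=> 1) = 1;
  stateC : forall f, D f -> m (fun x => (f x)^*) = (m f)^*;
  state_ge0 : forall f, D f -> (forall x, 0 <= f x) -> 0 <= m f;
  stateT : forall g f, D f -> m (fun x => f (g * x)%g) = m f }.

Section state_theory.
Variables (D : set (Gamma -> C)) (m : (Gamma -> C) -> C).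
Hypothesis st : invariant_state D m.

Lemma state_constant c : m (fun=> c) = c.
Proof.
rewrite -[RHS]mulr1 -[in RHS](state1 st) -(stateZ st) ?mulr1; last exact: state_cst st _.
by congr m; apply/funext => x; rewrite mulr1.
Qed.

Lemma state_scale c f : D f -> D (fun x => c * f x).
Proof. by move=> Df; apply: (state_mul st) Df; exact: state_cst st _. Qed.

Lemma state_sum n (f : nat -> Gamma -> C) : (forall i, D (f i)) ->
  D (fun x => \sum_(i < n) f i x).
Proof.
move=> Df; elim: n => [|n IHn].
  have -> : (fun x => \sum_(i < 0) f i x) = (fun=> 0).
    by apply/funext => x; rewrite big_ord0.
  exact: state_cst st _.
have -> : (fun x => \sum_(i < n.+1) f i x) = (fun x => \sum_(i < n) f i x + f n x).
  by apply/funext => x; rewrite big_ord_recr.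
exact: (state_add st).
Qed.

Lemma stateS n (f : nat -> Gamma -> C) : (forall i, D (f i)) ->
  m (fun x => \sum_(i < n) f i x) = \sum_(i < n) m (f i).
Proof.
move=> Df; elim: n => [|n IHn].
  rewrite big_ord0 -[RHS]state_constant; congr m.
  by apply/funext => x; rewrite big_ord0.
rewrite big_ord_recr /= -IHn -(stateD st) ?Df //; last exact: state_sum.
by congr m; apply/funext => x; rewrite big_ord_recr.
Qed.

(** The difference of the two sides is a variance: [m] of the squared modulus of [f - m f]. *)
Lemma state_cauchy_schwarz f : D f -> `|m f| ^+ 2 <= m (fun x => f x * (f x)^*).
Proof.
move=> Df; set s := m f.
have Dfc := state_conj st Df; have Dff := state_mul st Df Dfc.
have Dc := state_cst st.
rewrite -subr_ge0.
have -> : m (fun x => f x * (f x)^*) - `|s| ^+ 2 =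
    m (fun x => (f x - s) * (f x - s)^*).
  have -> : (fun x => (f x - s) * (f x - s)^*) =
    (fun x => f x * (f x)^* + ((- s^* * f x) + (- s * (f x)^* + s * s^*))).
    by apply/funext => x; rewrite rmorphB /=; ring.
  rewrite !(stateD st) ?(stateZ st) ?(stateC st) ?state_constant -/s //;
    do ?[exact: state_scale|apply: (state_add st)|exact: Dc].
  by rewrite normCK; ring.
apply: (state_ge0 st) => [|x]; last by rewrite -normCK exprn_ge0.
have DB : D (fun x => f x - s) by apply: (state_add st) Df _; exact: Dc.
exact: (state_mul st) DB (state_conj st DB).
Qed.

(** The translates of [u] by powers of [a] are orthonormal for [m]. Cauchy-Schwarz for the sum of
    [N] of them bounds [N ^+ 2] times the squared modulus of [m u] by [N], for every [N]. *)
Lemma van_der_corput u a : D u -> (forall x, `|u x| = 1) ->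
  (forall k, (0 < k)%N -> m (phase_diff (a ^+ k)%g u) = 0) -> m u = 0.
Proof.
move=> Du u1 mdu.
pose t i x := u (a ^+ i * x)%g.
have Dt i : D (t i) by exact: (state_trans st).
have Dtt i j : D (fun x => t i x * (t j x)^*).
  exact: (state_mul st) (Dt i) (state_conj st (Dt j)).
have tt0 i j : (j < i)%N -> m (fun x => t i x * (t j x)^*) = 0.
  move=> ji; rewrite -[RHS](mdu (i - j)%N) ?subn_gt0 //.
  have Ddu : D (phase_diff (a ^+ (i - j))%g u).
    have -> : phase_diff (a ^+ (i - j))%g u = (fun x => t (i - j)%N x * (t 0%N x)^*).
      by apply/funext => x; rewrite /phase_diff /t expg0 mul1g invC_norm u1 expr1n invr1 mul1r.
    exact: Dtt.
  rewrite -(stateT st (a ^+ j)%g Ddu); congr m; apply/funext => x.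
  rewrite /phase_diff /t mulgA -expgnDr subnK ?(ltnW ji) //.
  by rewrite invC_norm u1 expr1n invr1 mul1r.
suff : `|m u| ^+ 2 = 0 by move/eqP; rewrite expf_eq0 /= normr_eq0 => /eqP.
apply: complex_archi0 => [|N]; first by rewrite exprn_ge0.
case: N => [|N]; first by rewrite mul0r.
have DF := state_sum N.+1 Dt.
have := state_cauchy_schwarz DF.
rewrite stateS //.
have -> : \sum_(i < N.+1) m (t i) = N.+1%:R * m u.
  rewrite (eq_bigr (fun=> m u)) => [|i _]; last by rewrite (stateT st).
  by rewrite sumr_const card_ord mulr_natl.
have -> : m (fun x => (\sum_(i < N.+1) t i x) * (\sum_(i < N.+1) t i x)^*) = N.+1%:R.
  have -> : (fun x => (\sum_(i < N.+1) t i x) * (\sum_(i < N.+1) t i x)^*) =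
     (fun x => \sum_(i < N.+1) \sum_(j < N.+1) t i x * (t j x)^*).
    apply/funext => x; rewrite rmorph_sum mulr_suml; apply: eq_bigr => i _.
    by rewrite mulr_sumr.
  rewrite (@stateS _ (fun i x => \sum_(j < N.+1) t i x * (t j x)^*)); last first.
    by move=> i; exact: (@state_sum _ (fun j x => t i x * (t j x)^*)).
  rewrite (eq_bigr (fun=> 1)) ?sumr_const ?card_ord // => i _.
  rewrite (@stateS _ (fun j x => t i x * (t j x)^*)) //.
  rewrite (bigD1 i) //= big1 ?addr0 => [|j ji].
    rewrite -(state1 st); congr m; apply/funext => x.
    by rewrite -normCK u1 expr1n.
  case: (ltngtP i j) => [ij|/tt0 //|/val_inj ij].
    rewrite -[RHS]conjC0 -(tt0 j i ij) -(stateC st) //.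
    by congr m; apply/funext => x; rewrite rmorphM /= conjCK mulrC.
  by rewrite ij eqxx in ji.
rewrite normrM normr_nat exprMn expr2 -mulrA -[X in _ <= X]mulr1 ler_pM2l //.
Qed.

End state_theory.
End states.

(** * Phase polynomials are torsion or have integral zero *)

Section dichotomy.
Variables (R : realType) (Gamma : groupType).
Hypothesis Gamma_fg : finitely_generated Gamma.
Local Notation C := R[i].
Implicit Types (f u v : Gamma -> C) (a g : Gamma).

Lemma phase_diffM g h u : (forall x, u x != 0) ->
  phase_diff (g * h)%g u = (fun x => phase_diff g u (h * x)%g * phase_diff h u x).
Proof.
move=> u0; apply/funext => x; rewrite /phase_diff mulgA mulrA.
by rewrite -[_ / _ * _ in RHS]mulrA mulVf ?mulr1.
Qed.

Lemma phase_diffV g u : phase_diff g^-1%g u = (fun x => (phase_diff g u (g^-1 * x)%g)^-1).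
Proof. by apply/funext => x; rewrite /phase_diff mulVKg invf_div. Qed.

(** Finite generation turns one exponent per element into a single one: multiply those of the
    generators, then extend to products and inverses by the cocycle identity [phase_diffM]. *)
Lemma common_exponent u : (forall x, u x != 0) ->
  (forall g, torsion (phase_diff g u)) ->
  exists2 M, (0 < M)%N &
    forall g x y, phase_diff g u x ^+ M = phase_diff g u y ^+ M.
Proof.
move=> u0 tu; have [S indS] := finitely_generated_ind Gamma_fg.
have [M M0 SM] : exists2 M, (0 < M)%N & forall s, s \in S ->
    forall x y, phase_diff s u x ^+ M = phase_diff s u y ^+ M.
  elim: S {indS} => [|s S [M M0 SM]]; first by exists 1%N.
  have [N N0 sN] := tu s; exists (M * N)%N; first by rewrite muln_gt0 M0.
  move=> s'; rewrite inE => /predU1P[->|/SM s'M] x y.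
    by rewrite mulnC !exprM (sN x y).
  by rewrite !exprM (s'M x y).
exists M => //; apply: indS => [x y|g h gM hM x y|//].
  by rewrite /phase_diff !mul1g !divff.
rewrite phase_diffM // phase_diffV /= [LHS]exprMn [RHS]exprMn.
congr (_ * _); first exact: gM.
by rewrite [LHS]exprVn [RHS]exprVn (hM _ (h^-1 * y)%g).
Qed.

(** [c] is a homomorphism to the roots of unity, so a common exponent [N] for the generators serves
    all of [Gamma]; and [u x / u y] is a value of [phase_diff (x * y^-1) u]. *)
Lemma torsion_of_root_diff u (c : Gamma -> C) M : (0 < M)%N ->
  (forall x, u x != 0) ->
  (forall g x, phase_diff g u x ^+ M = c g) ->
  (forall g, exists2 k, (0 < k)%N & c g ^+ k = 1) -> torsion u.
Proof.
move=> M0 u0 uM tc; have [S indS] := finitely_generated_ind Gamma_fg.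
have [N N0 SN] : exists2 N, (0 < N)%N & forall s, s \in S -> c s ^+ N = 1.
  elim: S {indS} => [|s S [N N0 SN]]; first by exists 1%N.
  have [k k0 sk] := tc s; exists (N * k)%N; first by rewrite muln_gt0 N0.
  move=> s'; rewrite inE => /predU1P[->|/SN s'N].
    by rewrite mulnC exprM sk expr1n.
  by rewrite exprM s'N expr1n.
exists (M * N)%N; first by rewrite muln_gt0 M0.
have cN g : c g ^+ N = 1.
  move: g; apply: indS => [|g h gN hN|//].
    by rewrite -(uM _ 1%g) /phase_diff !mul1g divff // !expr1n.
  rewrite -(uM _ 1%g) phase_diffM // phase_diffV /= exprMn exprVn !uM.
  by rewrite exprMn exprVn gN hN invr1 mulr1.
move=> x y; have := cN (x * y^-1)%g; rewrite -(uM _ y) /phase_diff mulgVK.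
rewrite -exprM expr_div_n => /(congr1 ( *%R^~ (u y ^+ (M * N)))).
by rewrite divfK ?mul1r // expf_neq0.
Qed.

Lemma norm_phase_diff g u : (forall x, `|u x| = 1) ->
  forall x, `|phase_diff g u x| = 1.
Proof. by move=> u1 x; rewrite normf_div !u1 divr1. Qed.

Lemma norm1_neq0 u : (forall x, `|u x| = 1) -> forall x, u x != 0.
Proof. by move=> u1 x; rewrite -normr_gt0 u1. Qed.

Lemma state_phase_diff (D : set (Gamma -> C)) m g u : invariant_state D m ->
  D u -> (forall x, `|u x| = 1) -> D (phase_diff g u).
Proof.
move=> st Du u1; have -> : phase_diff g u = (fun x => u (g * x)%g * (u x)^*).
  by apply/funext => x; rewrite /phase_diff invC_norm u1 expr1n invr1 mul1r.
exact: (state_mul st) (state_trans st g Du) (state_conj st Du).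
Qed.

Lemma torsion_or_null n u : (forall x, `|u x| = 1) -> phase_poly n u ->
  torsion u \/ forall D m, @invariant_state R Gamma D m -> D u -> m u = 0.
Proof.
elim: n u => [|n IHn] u u1 pu.
  by left; exists 1%N => // x y; rewrite (pu x y).
have u0 := norm1_neq0 u1.
(* Either no power of some [a] has a torsion difference quotient, and van der
   Corput applies, or every difference quotient is torsion. *)
have [[a aN]|nex] := pselect
    (exists a, forall k, (0 < k)%N -> ~ torsion (phase_diff (a ^+ k)%g u)).
  right=> D m st Du; apply: (van_der_corput st (a := a) Du u1) => k k0.
  have [/aN //|] := IHn _ (norm_phase_diff (a ^+ k)%g u1) (pu _).
  by move/(_ _ _ st); apply; exact: state_phase_diff st Du u1.
(* [phase_diff (a ^+ k) u] is the norm of [phase_diff a u] along [a], so [torsion_of_norm] passes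
   from a power of [a] to [a] itself. *)
have tdu a : torsion (phase_diff a u).
  have [k k0 tk] : exists2 k, (0 < k)%N & torsion (phase_diff (a ^+ k)%g u).
    apply: contrapT => nk; apply: nex; exists a => k k0 tk.
    by apply: nk; exists k.
  apply: (@torsion_of_norm _ _ a k n) => //; first exact: phase_diff_neq0.
  by rewrite -phase_diff_expg.
have [M M0 uM] := common_exponent u0 tdu.
pose c g := phase_diff g u 1%g ^+ M.
(* If each [c g] is a root of unity then so is [u], up to a constant; otherwise
   [u] is a coboundary. *)
have [tc|] := pselect (forall g, exists2 k, (0 < k)%N & c g ^+ k = 1).
  by left; apply: (@torsion_of_root_diff u c M) => // g x; exact: uM.
move=> /existsNP[a nc]; right=> D m st Du.
have [k k0 vk] := torsion_period a (phase_diff_neq0 a u0) (pu a) (tdu a).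
pose v := phase_diff (a ^+ k)%g u.
have vE : v = (fun x => \prod_(i < k) phase_diff a u (a ^+ i * x)%g).
  exact: phase_diff_expg.
have vak x : v (a ^+ k * x)%g = v x.
  rewrite vE; apply: eq_bigr => i _.
  by rewrite mulgA -expgnDr addnC expgnDr -mulgA vk.
pose z := v 1%g ^+ M.
have vz x : v x ^+ M = z by exact: uM.
(* [v] is a product of [k] translates of [phase_diff a u], whose [M]-th power is constantly [c a].
   Hence [z = c a ^+ k], and [nc] says that no positive power of [c a] is [1]. *)
have z1 : z != 1.
  apply/eqP => z1; apply: nc; exists k => //.
  rewrite -z1 /z vE -prodrXl.
  under eq_bigr do rewrite (uM _ _ 1%g).
  by rewrite prodr_const card_ord.
have v1 x : 1 - v x != 0.
  by rewrite subr_eq0 eq_sym; apply: contra_neq z1 => vx; rewrite -(vz x) vx expr1n.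
(* [F = u / (1 - v)], made polynomial in [v] through [v ^+ M = z]. *)
pose F x := (1 - z)^-1 * (u x * \sum_(i < M) v x ^+ i).
have Dv : D v by exact: state_phase_diff st Du u1.
have DF : D F.
  apply: (state_scale st); apply: (state_mul st) Du _.
  apply: (@state_sum _ _ _ _ st M (fun i x => v x ^+ i)) => i.
  elim: i => [|i IHi]; first exact: (state_cst st).
  have -> : (fun x => v x ^+ i.+1) = (fun x => v x * v x ^+ i).
    by apply/funext => x; rewrite exprS.
  exact: (state_mul st).
(* Translation by [a ^+ k] multiplies [u] by [v] and fixes [v], so [F x - F (a ^+ k * x) = (1 - v x)
   * F x = u x]. *)
have Fu x : F x = u x + F (a ^+ k * x)%g.
  have uv : u (a ^+ k * x)%g = v x * u x by rewrite /v /phase_diff divfK.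
  apply/eqP; rewrite -subr_eq; apply/eqP.
  rewrite /F vak uv; set s := \sum_(i < M) _.
  have sE : (1 - v x) * s = 1 - z.
    by rewrite -(vz x) -[1 - v x]opprB -[RHS]opprB subrX1 mulNr.
  transitivity ((1 - z)^-1 * (u x * ((1 - v x) * s))); first by ring.
  by rewrite sE mulrCA mulVf ?mulr1 // subr_eq0 eq_sym.
suff : m F = m u + m F by move/eqP; rewrite -subr_eq subrr eq_sym => /eqP.
rewrite -{2}(stateT st (a ^+ k)%g DF) -(stateD st) //; last exact: (state_trans st).
by congr m; apply/funext.
Qed.

End dichotomy.

(** * States of torsion phase polynomials *)

Section torsion_states.
Variables (R : realType) (Gamma : groupType).
Hypothesis Gamma_fg : finitely_generated Gamma.
Local Notation C := R[i].
Implicit Types (f u v : Gamma -> C) (a g : Gamma).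

Lemma finite_unity_roots M : (0 < M)%N -> finite_set [set z : C | z ^+ M = 1].
Proof.
move=> M0; have [r rE] := closed_field_poly_normal ('X^M - 1 : {poly C}).
apply: (@sub_finite_set _ _ [set` r]); last exact: finite_seq.
move=> z zM /=.
have : root ('X^M - 1 : {poly C}) z by rewrite rootE !hornerE zM subrr.
rewrite rE rootZ ?root_prod_XsubC //.
by rewrite lead_coef_eq0 -size_poly_eq0 size_XnsubC.
Qed.

Definition torsion_polys n M : set (Gamma -> C) :=
  [set f | phase_poly n f /\ forall x, f x ^+ M = 1].

Fixpoint lists_in (T : Type) (A : set T) k : set (seq T) :=
  if k is k'.+1 then [set x :: l | x in A & l in lists_in A k'] else [set [::]].

Lemma finite_lists_in (T : Type) (A : set T) k :
  finite_set A -> finite_set (lists_in A k).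
Proof.
by move=> fA; elim: k => [|k IHk] /=; [exact: finite_set1|exact: finite_image2].
Qed.

(** Such an [f] is determined by its value at [1], an [M]-th root of unity, and by its differences
    along the finitely many generators, which range over a finite set by induction. *)
Lemma finite_torsion_polys n M : (0 < M)%N -> finite_set (torsion_polys n M).
Proof.
move=> M0; have [S indS] := finitely_generated_ind Gamma_fg.
elim: n => [|n IHn].
  apply: (@sub_finite_set _ _ ((fun z _ => z) @` [set z : C | z ^+ M = 1])).
    move=> f [/= cf fM]; exists (f 1%g) => //=.
    by apply/funext => x; exact: cf.
  exact/finite_image/finite_unity_roots.
pose B := [set z : C | z ^+ M = 1] `*` lists_in (torsion_polys n M) (size S).
pose F f := (f 1%g, [seq phase_diff s f | s <- S]).
have subB : F @` torsion_polys n.+1 M `<=` B.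
  move=> _ [f [pf fM] <-]; split => /=; first exact: fM.
  elim: S {F indS B} => [//|s S IHS] /=.
  exists (phase_diff s f); last by exists [seq phase_diff s f | s <- S].
  by split=> [|x]; [exact: pf|rewrite /phase_diff expr_div_n !fM divr1].
have F_inj : {in torsion_polys n.+1 M &, injective F}.
  move=> f f'; rewrite !inE => -[_ fM] [_ f'M] [ff1 /eq_in_map ff].
  have nz (h : Gamma -> C) : (forall x, h x ^+ M = 1) -> forall x, h x != 0.
    move=> hM x; apply/eqP => hx0; have /eqP := hM x.
    by rewrite hx0 expr0n gtn_eqF // eq_sym oner_eq0.
  have f0 := nz f fM; have f'0 := nz f' f'M.
  have diff g : phase_diff g f = phase_diff g f'.
    move: g; apply: indS => [|g h fg fh|s /ff //].
      by apply/funext => x; rewrite /phase_diff !mul1g !divff.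
    by rewrite !phase_diffM // !phase_diffV fg fh.
  apply/funext => x; have := congr1 (fun h => h 1%g) (diff x).
  rewrite /phase_diff mulg1 ff1 => /(congr1 ( *%R^~ (f' 1%g))).
  by rewrite !divfK.
rewrite -(eq_finite_set (inj_card_eq F_inj)); apply: sub_finite_set subB _.
by apply: finite_setX; [exact: finite_unity_roots|exact: finite_lists_in].
Qed.

(* A translate of [u] is [u 1] times a phase polynomial with [f ^+ M = 1], of
   which there are finitely many; the sum of the translates is constant. *)
Lemma torsion_state n u : (forall x, `|u x| = 1) -> phase_poly n u -> torsion u ->
  exists c, forall D m, @invariant_state R Gamma D m -> D u -> m u = c.
Proof.
move=> u1 pu [M M0 uM]; have u0 := norm1_neq0 u1.
pose orbit := range (fun g x => u (g * x)%g).
have /finite_seqP [L0 L0E] : finite_set orbit.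
  apply: (@sub_finite_set _ _
      ((fun f x => u 1%g * f x) @` torsion_polys n M)); last first.
    exact/finite_image/finite_torsion_polys.
  move=> _ [g _ <-]; exists (fun x => (u 1%g)^-1 * u (g * x)%g); last first.
    by apply/funext => x; rewrite mulVKf.
  split=> [|x]; last by rewrite exprMn exprVn (uM (g * x)%g 1%g) mulVf // expf_neq0.
  by apply: phase_poly_mul; [exact: phase_poly_cst|exact: phase_poly_trans].
pose L := undup L0.
have LE f : (f \in L) <-> orbit f by rewrite mem_undup L0E /=.
have L_nil : (0 < size L)%N.
  rewrite lt0n; apply/eqP => /size0nil Lnil.
  have /LE : orbit (fun x => u (1 * x)%g) by exists 1%g.
  by rewrite Lnil.
pose sigma x := \sum_(f <- L) f x.
have sigma_cst x : sigma x = sigma 1%g.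
  (* Precomposition with left multiplication by [x] permutes the translates of [u]; evaluating the
     permuted sum at [1] gives [sigma x]. *)
  pose T f y : C := f (x * y)%g.
  have : perm_eq (map T L) L.
    have T_inj : injective T.
      move=> f f' ff; apply/funext => y.
      by have := congr1 (fun h => h (x^-1 * y)%g) ff; rewrite /T mulVKg.
    apply: uniq_perm; rewrite ?map_inj_uniq ?undup_uniq // => f.
    apply/idP/idP => [/mapP[_ /LE[g _ <-] ->]|/LE[g _ <-]].
      by apply/LE; exists (g * x)%g => //; apply/funext => y; rewrite /T mulgA.
    apply/mapP; exists (fun y => u (g * x^-1 * y)%g).
      by apply/LE; exists (g * x^-1)%g.
    by apply/funext => y; rewrite /T mulgA mulgVK.
  move=> pL; rewrite /sigma -[in RHS](perm_big _ pL) /= big_map /=.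
  by rewrite /T mulg1.
exists (sigma 1%g / (size L)%:R) => D m st Du.
apply: (canRL (mulfK _)); first by rewrite pnatr_eq0 -lt0n.
have fL f : f \in L -> D f /\ m f = m u.
  move=> /LE[g _ <-]; split; first exact: (state_trans st).
  exact: (stateT st).
have msum l : {subset l <= L} ->
    D (fun x => \sum_(f <- l) f x) /\ m (fun x => \sum_(f <- l) f x) = m u * (size l)%:R.
  elim: l => [|f l IHl] lL.
    rewrite (_ : (fun x => _) = fun=> 0); last by apply/funext => x; rewrite big_nil.
    by rewrite (state_constant st) mulr0; split=> //; exact: (state_cst st).
  rewrite (_ : (fun x => _) = fun x => f x + \sum_(f <- l) f x); last first.
    by apply/funext => x; rewrite big_cons.
  have [Df mf] := fL f (lL f (mem_head _ _)).
  have [|Dl ml] := IHl; first by move=> h hl; apply: lL; rewrite inE hl orbT.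
  split; first exact: (state_add st).
  by rewrite (stateD st) // mf ml /= -natr1 mulrDr mulr1 addrC.
have [_ <-] := msum L (fun=> id).
rewrite -[RHS](state_constant st); congr m; apply/funext => x; exact: sigma_cst.
Qed.

(** The constant is chosen before the state: this order of quantifiers is what makes two invariant
    measures comparable. *)
Theorem phase_poly_state n u : (forall x, `|u x| = 1) -> phase_poly n u ->
  exists c, forall D m, @invariant_state R Gamma D m -> D u -> m u = c.
Proof.
move=> u1 pu; have [tu|u0] := torsion_or_null Gamma_fg u1 pu.
  exact: torsion_state u1 pu tu.
by exists 0.
Qed.

End torsion_states.

(** * Invariant means *)

Section means.
Variables (R : realType).

Definition bfun (X : Type) (f : X -> R) := exists B, forall x, `|f x| <= B.

Record mean (X : Type) (M : (X -> R) -> R) : Prop := {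
  meanD : forall f g, bfun f -> bfun g -> M (fun x => f x + g x) = M f + M g;
  meanZ : forall c f, bfun f -> M (fun x => c * f x) = c * M f;
  mean_ge0 : forall f, bfun f -> (forall x, 0 <= f x) -> 0 <= M f;
  mean1 : M (fun=> 1) = 1 }.

Section bounded_functions.
Variable X : Type.
Implicit Types f g : X -> R.

Lemma bfun_cst (c : R) : bfun (fun _ : X => c).
Proof. by exists `|c|. Qed.

Lemma bfunD f g : bfun f -> bfun g -> bfun (fun x => f x + g x).
Proof.
move=> [A fA] [B gB]; exists (A + B) => x.
exact: le_trans (ler_normD _ _) (lerD (fA x) (gB x)).
Qed.

Lemma bfunM f g : bfun f -> bfun g -> bfun (fun x => f x * g x).
Proof.
move=> [A fA] [B gB]; exists (A * B) => x.
by rewrite normrM ler_pM.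
Qed.

Lemma bfunZ c f : bfun f -> bfun (fun x => c * f x).
Proof. by move=> bf; apply: bfunM => //; exact: bfun_cst. Qed.

Lemma bfun_comp (Y : Type) (S : Y -> X) f : bfun f -> bfun (f \o S).
Proof. by move=> [B fB]; exists B => x /=. Qed.

Variable M : (X -> R) -> R.
Hypothesis mM : mean M.

Lemma mean_cst c : M (fun=> c) = c.
Proof.
rewrite -[RHS]mulr1 -[in RHS](mean1 mM) -(meanZ mM) ?mulr1; last exact: bfun_cst.
by congr M; apply/funext => x; rewrite mulr1.
Qed.

Lemma meanN f : bfun f -> M (fun x => - f x) = - M f.
Proof.
move=> bf; rewrite -[RHS]mulN1r -(meanZ mM) //.
by congr M; apply/funext => x; rewrite mulN1r.
Qed.

Lemma meanB f g : bfun f -> bfun g -> M (fun x => f x - g x) = M f - M g.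
Proof.
move=> bf bg; rewrite -(meanN bg) -(meanD mM) //.
by have := bfunZ (-1) bg; congr bfun; apply/funext => x; rewrite mulN1r.
Qed.

Lemma le_mean f g : bfun f -> bfun g -> (forall x, f x <= g x) -> M f <= M g.
Proof.
move=> bf bg fg; rewrite -subr_ge0 -meanB //; apply: (mean_ge0 mM).
  have := bfunD bg (bfunZ (-1) bf); congr bfun; apply/funext => x.
  by rewrite mulN1r.
by move=> x; rewrite subr_ge0.
Qed.

Lemma norm_mean_le f B : (forall x, `|f x| <= B) -> `|M f| <= B.
Proof.
move=> fB; have bf : bfun f by exists B.
rewrite ler_norml; apply/andP; split.
  rewrite -[- B]mean_cst; apply: le_mean => //; first exact: bfun_cst.
  by move=> x; have := fB x; rewrite ler_norml => /andP[].
rewrite -[leRHS]mean_cst; apply: le_mean => //; first exact: bfun_cst.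
by move=> x; have := fB x; rewrite ler_norml => /andP[].
Qed.

End bounded_functions.

(** * Ultralimits and Banach limits *)

Section ultralimits.
Variables (U : set_system nat).
Hypotheses (UU : UltraFilter U) (ooU : \oo `<=` U).
Let UP : ProperFilter U := @ultra_proper _ _ UU.
Let UF : Filter U := @filter_filter _ _ UP.

Definition ulim (u : nat -> R) : R := lim (u @ U).

(** The image ultrafilter contains the compact interval from [- B] to [B], so it converges. *)
Lemma ulim_cvg u : bfun u -> u @ U --> ulim u.
Proof.
move=> [B uB]; apply/cvg_ex => /=.
have uUB : (u @ U) `[- B, B]%classic.
  rewrite (_ : (u @ U) `[- B, B]%classic = U setT); first exact: filterT.
  rewrite /fmap /=; congr U; apply/seteqP; split=> n _ //=.
  by rewrite in_itv /= -ler_norml.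
have := @segment_compact R (- B) B; rewrite compact_ultra => cpt.
have UuU : UltraFilter (u @ U).
  split=> [|G PG uUG]; first exact: fmap_proper_filter.
  apply/seteqP; split=> [A GA|]; last exact: uUG.
  have [//|UA] := in_ultra_setVsetC (u @^-1` A) UU.
  have /(filterI GA) : G (~` A) by apply: uUG.
  by rewrite setICr => /filter_not_empty.
have [l [_ ul]] := cpt (u @ U) UuU uUB.
by exists l.
Qed.

Lemma ulim_eq u v : bfun u -> u @ \oo --> v -> ulim u = v.
Proof.
move=> bu uv; apply: cvg_lim => //; apply: cvg_trans uv => A /= uA.
exact: ooU.
Qed.

Lemma ulim_near u v : (\forall n \near \oo, u n = v n) -> ulim u = ulim v.
Proof.
move=> uv; rewrite /ulim; congr lim; apply/funext => A; apply/propext.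
rewrite /fmap /=; split=> H; have := ooU uv => Uuv.
  by apply: filterS2 H Uuv => n /= + <-.
by apply: filterS2 H Uuv => n /= + ->.
Qed.

Lemma mean_ulim (X : Type) (M : nat -> (X -> R) -> R) : (forall n, mean (M n)) ->
  mean (fun f => ulim (fun n => M n f)).
Proof.
move=> mM; have bM f : bfun f -> bfun (fun n => M n f).
  by move=> [B fB]; exists B => n; exact: norm_mean_le.
split.
- move=> f g bf bg; apply: cvg_lim => //.
  under eq_fun do rewrite (meanD (mM _)) //.
  by apply: cvgD; apply: ulim_cvg; exact: bM.
- move=> c f bf; apply: cvg_lim => //.
  under eq_fun do rewrite (meanZ (mM _)) //.
  by apply: cvgM; [exact: cvg_cst|apply: ulim_cvg; exact: bM].
- move=> f bf f0; apply: (closed_cvg (fun x : R => 0 <= x)) (ulim_cvg (bM _ bf)).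
    exact: closed_ge.
  by apply: (@filterS _ U UF setT) filterT => n _; exact: (mean_ge0 (mM n)).
- under eq_fun do rewrite (mean1 (mM _)).
  by apply: cvg_lim => //; exact: cvg_cst.
Qed.

Lemma mean_cesaro (X : Type) (T : X -> X) n x :
  mean (fun f => n.+1%:R^-1 * \sum_(i < n.+1) f (iter i T x)).
Proof.
split.
- by move=> f g _ _; rewrite big_split mulrDr.
- by move=> c f _; rewrite -mulr_sumr mulrCA.
- by move=> f _ f0; rewrite mulr_ge0 // sumr_ge0.
- by rewrite sumr_const card_ord mulVf.
Qed.

(** A Banach limit along the forward orbit of [x]; the ultralimit makes it exist for every bounded
    [f]. *)
Definition cesaro (X : Type) (T : X -> X) (f : X -> R) (x : X) : R :=
  ulim (fun n => n.+1%:R^-1 * \sum_(i < n.+1) f (iter i T x)).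

Lemma cesaro_mean (X : Type) (T : X -> X) x : mean ((cesaro T)^~ x).
Proof. by apply: mean_ulim => n; exact: mean_cesaro. Qed.

(** The averages at [T x] and at [x] differ by two end terms divided by [n.+1]. *)
Lemma cesaro_invariant (X : Type) (T : X -> X) f x :
  bfun f -> cesaro T f (T x) = cesaro T f x.
Proof.
move=> bf; have bS y : bfun (fun n => n.+1%:R^-1 * \sum_(i < n.+1) f (iter i T y)).
  by case: bf => B fB; exists B => n; exact: (norm_mean_le (mean_cesaro T n y)).
apply/eqP; rewrite -subr_eq0; apply/eqP.
pose v n : R := n.+1%:R^-1 * (f (iter n.+1 T x) - f x).
transitivity (ulim v).
  symmetry; apply: cvg_lim => //.
  rewrite (_ : v = fun n => n.+1%:R^-1 * (\sum_(i < n.+1) f (iter i T (T x))) -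
     n.+1%:R^-1 * (\sum_(i < n.+1) f (iter i T x))).
    by apply: cvgB; exact: ulim_cvg.
  apply/funext => n; rewrite -mulrBr /v; congr (_ * _).
  rewrite big_ord_recr [X in _ = _ - X]big_ord_recl /=.
  rewrite -!iterSr -[iter n.+1 T x]/(iter n.+1 T x).
  under eq_bigr do rewrite -iterSr.
  by rewrite /=; ring.
case: bf => B fB.
have vB n : `|v n| <= (B + B) * n.+1%:R^-1.
  rewrite normrM ger0_norm // mulrC ler_wpM2r //.
  by apply: le_trans (ler_normB _ _) _; exact: lerD.
have B0 : 0 <= B by exact: le_trans (fB x).
apply: ulim_eq.
  exists (B + B) => n; apply: le_trans (vB n) _.
  by rewrite ler_piMr ?addr_ge0 // invf_le1 ?ler1n // ltr0n.
apply/cvgr0Pnorm_le => e e0.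
have h : (fun n : nat => (B + B) * n.+1%:R^-1) @ \oo --> (0 : R).
  rewrite -(mulr0 (B + B)); apply: cvgM; first exact: cvg_cst.
  exact: cvg_harmonic.
move/cvgr0Pnorm_le : h => /(_ e e0); apply: filterS => n.
by rewrite ger0_norm ?mulr_ge0 ?addr_ge0 //; exact: le_trans.
Qed.

End ultralimits.
End means.

(** * Means invariant under commuting maps and under nilpotent actions *)

Section invariant_means.
Variables (R : realType).

Lemma ultra_nat : exists U : set_system nat, UltraFilter U /\ \oo `<=` U.
Proof. exact: ultraFilterLemma. Qed.

Definition markov (X : Type) (E : (X -> R) -> X -> R) := forall x, mean (E^~ x).

Lemma markov_id (X : Type) : @markov X id.
Proof. by []. Qed.

Lemma markov_bfun (X : Type) (E : (X -> R) -> X -> R) f :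
  markov E -> bfun f -> bfun (E f).
Proof. by move=> mE [B fB]; exists B => x; exact: (norm_mean_le (mE x)). Qed.

Lemma markov_comp (X : Type) (M : (X -> R) -> R) E :
  mean M -> @markov X E -> mean (M \o E).
Proof.
move=> mM mE; split=> [f g bf bg|c f bf|f bf f0|] /=.
- rewrite -(meanD mM); do ?exact: markov_bfun.
  by congr M; apply/funext => x; rewrite (meanD (mE x)).
- rewrite -(meanZ mM); do ?exact: markov_bfun.
  by congr M; apply/funext => x; rewrite (meanZ (mE x)).
- apply: (mean_ge0 mM) => [|x]; first exact: markov_bfun.
  exact: (mean_ge0 (mE x)).
- rewrite -[RHS](mean1 mM); congr M; apply/funext => x; exact: (mean1 (mE x)).
Qed.

Section commuting_maps.
Variables (X : Type) (e : X -> X -> Prop) (T : nat -> X -> X).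
Hypothesis eT : forall i x y, e x y -> e (T i x) (T i y).
Hypothesis TC : forall i j x, e (T i (T j x)) (T j (T i x)).

Definition compatible (f : X -> R) := forall x y, e x y -> f x = f y.

(** Commutation is asked modulo [e] only, so it becomes an equality after a [compatible] function is
    applied. *)
Definition central_map (S : X -> X) :=
  (forall x y, e x y -> e (S x) (S y)) /\ (forall i x, e (T i (S x)) (S (T i x))).

(* Compose the Cesaro averages along the first [N] maps, then let [N] grow. *)
Lemma invariant_markov : exists E : (X -> R) -> X -> R, markov E /\
  forall f, bfun f -> compatible f ->
    [/\ compatible (E f), forall i x, E f (T i x) = E f x &
        forall S, central_map S -> forall x, E (f \o S) x = E f (S x)].
Proof.
have [U [UU ooU]] := ultra_nat.
have iterC i S : central_map S -> forall k f, compatible f ->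
    forall x, f (iter k (T i) (S x)) = f (S (iter k (T i) x)).
  move=> [eS TS] k f cf; elim: k => // k IHk x.
  rewrite !iterSr -(IHk (T i x)).
  have: e (iter k (T i) (T i (S x))) (iter k (T i) (S (T i x))).
    by elim: k {IHk} => [|k] /=; [exact: TS|exact: eT].
  exact: cf.
have eiter i k x y : e x y -> e (iter k (T i) x) (iter k (T i) y).
  by move=> exy; elim: k => //= k; exact: eT.
pose Ei i := cesaro (R := R) U (X := X) (T i).
have mEi i : markov (Ei i) by move=> x; exact: cesaro_mean.
have Ei_comp i f : compatible f -> compatible (Ei i f).
  move=> cf x y exy; congr ulim; apply/funext => n; congr (_ * _).
  by apply: eq_bigr => j _; apply/cf/eiter.
have Ei_cent i S f : central_map S -> compatible f ->
    forall x, Ei i (f \o S) x = Ei i f (S x).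
  move=> cS cf x; congr ulim; apply/funext => n; congr (_ * _).
  by apply: eq_bigr => j _ /=; rewrite iterC.
have T_cent i : central_map (T i) by split=> *; [exact: eT|exact: TC].
pose F := fix F N : (X -> R) -> X -> R :=
  if N is N'.+1 then fun f => Ei N' (F N' f) else id.
have mF N : markov (F N).
  elim: N => [|N IHN]; first exact: markov_id.
  by move=> x /=; exact: (markov_comp (mEi N x) IHN).
have F_comp N f : compatible f -> compatible (F N f).
  by move=> cf; elim: N => [//|N IHN] /=; exact: Ei_comp.
have F_cent N S f : central_map S -> compatible f ->
    forall x, F N (f \o S) x = F N f (S x).
  move=> cS cf; elim: N => [//|N IHN] x /=.
  rewrite (_ : F N (f \o S) = F N f \o S); last exact/funext.
  exact/Ei_cent/F_comp.
(* The outermost average is invariant under its own map; invariance under earlier maps survives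
   because each [T i] is central, hence commutes with the later averages. *)
have F_inv N i f : bfun f -> compatible f -> (i < N)%N ->
    forall x, F N f (T i x) = F N f x.
  move=> bf cf; elim: N => // N IHN; rewrite ltnS leq_eqVlt => /predU1P[->|iN] x /=.
    by apply: cesaro_invariant => //; exact: markov_bfun.
  rewrite -Ei_cent //; last exact: F_comp.
  by congr (Ei N _ x); apply/funext => y /=; rewrite IHN.
exists (fun f x => ulim U (fun N => F N f x)).
split=> [x|f bf cf]; first by apply: mean_ulim => // N; exact: mF.
split=> [x y exy|i x|S cS x].
- by congr ulim; apply/funext => N; exact: F_comp.
- by apply: ulim_near => //; exists i.+1 => // N /= iN; exact: F_inv.
- by congr ulim; apply/funext => N; exact: F_cent.
Qed.

End commuting_maps.

(* Modulo [D n.+1] the subgroup [D n] is central, so averaging over it commutes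
   with all translations. *)
Lemma invariant_mean_nilpotent (Gamma : groupType) (en : nat -> Gamma)
    (D : nat -> Gamma -> Prop) n :
  (forall g, exists i, en i = g) -> (forall g, D 0%N g) ->
  (forall k g c, D k c -> D k (g * c * g^-1)%g) ->
  (forall k g c, D k c -> D k.+1 (c * g * c^-1 * g^-1)%g) ->
  exists M : (Gamma -> R) -> R, mean M /\
    forall f, bfun f -> (forall c x, D n c -> f (c * x)%g = f x) ->
      forall g, M (fun x => f (g * x)%g) = M f.
Proof.
move=> en_surj D0 Dnorm Dcomm.
(* The induction needs an operator, not just a mean: its output is constant on [Gamma] and it
   commutes with left translations. At level [0] the hypothesis already makes [f] constant, so [id]
   works. *)
suff [E [mE HE]] : exists E : (Gamma -> R) -> Gamma -> R, markov E /\
    forall f, bfun f -> (forall c x, D n c -> f (c * x)%g = f x) ->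
    (forall c x, E f (c * x)%g = E f x) /\
    (forall g x, E (fun y => f (g * y)%g) x = E f (g * x)%g).
  exists (E^~ 1%g); split=> // f bf inv g.
  by have [Einv Etr] := HE f bf inv; rewrite Etr Einv.
elim: n => [|n [E [mE HE]]].
  exists id; split; first exact: markov_id.
  by move=> f bf inv; split=> // c x; exact: inv.
pose e x y : Prop := exists2 c, D n.+1 c & x = (c * y)%g.
(* Left multiplications by the elements of [D n], with the identity map at indices whose element
   lies outside. *)
pose T i x : Gamma := if pselect (D n (en i)) then (en i * x)%g else x.
have eS g x y : e x y -> e (g * x)%g (g * y)%g.
  move=> [c Dc ->]; exists (g * c * g^-1)%g; first exact: Dnorm.
  by rewrite !mulgA mulgVK.
have D1 k : D k 1%g.
  elim: k => [|k /Dcomm-/(_ 1%g)]; first exact: D0.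
  by rewrite !(mulg1, mul1g, invg1).
have eR x : e x x by exists 1%g; rewrite ?mul1g.
have comm_e a g x : D n a -> e (a * (g * x))%g (g * (a * x))%g.
  move=> Da; exists (a * g * a^-1 * g^-1)%g; first exact: Dcomm.
  by rewrite !mulgA !mulgVK.
have eT i x y : e x y -> e (T i x) (T i y).
  by rewrite /T; case: (pselect (D n (en i))) => [Da|nDa] //; exact: eS.
have TC i j x : e (T i (T j x)) (T j (T i x)).
  rewrite /T; case: (pselect (D n (en i))) => Da; case: (pselect (D n (en j))) => Db //.
  exact: comm_e.
have centT g : central_map e T (fun x => g * x)%g.
  split=> [x y|i x]; first exact: eS.
  by rewrite /T; case: (pselect (D n (en i))) => // Da; exact: comm_e.
have [E' [mE' HE']] := invariant_markov eT TC.
exists (fun f => E (E' f)); split=> [x|f bf inv].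
  exact: (markov_comp (mE x) mE').
have cf : compatible e f by move=> _ y [c Dc ->]; exact: inv.
have [cE' E'T E'S] := HE' f bf cf.
have inv' c x : D n c -> E' f (c * x)%g = E' f x.
  move=> Dc; have [i ic] := en_surj c.
  by rewrite -(E'T i x) /T ic; case: pselect.
have [Einv Etr] := HE _ (markov_bfun mE' bf) inv'.
split=> // g x; rewrite -Etr; congr (E _ x); apply/funext => y.
exact: (E'S _ (centT g)).
Qed.

End invariant_means.

(** * Topology of function spaces *)

Section metric_topology.
Variables (R : realType) (G : topologicalType) (d : G -> G -> R).
Hypotheses (d0 : forall x y, d x y = 0 <-> x = y)
  (dC : forall x y, d x y = d y x)
  (dT : forall x y z, d x z <= d x y + d y z)
  (dN : forall x (A : set G),
     nbhs x A <-> exists2 e : R, 0 < e & [set y | d x y < e] `<=` A).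

Lemma dist_ge0 x y : 0 <= d x y.
Proof.
have := dT x y x; rewrite (dC y x) (proj2 (d0 x x) erefl).
by rewrite -mulr2n; lra.
Qed.

Lemma distxx x : d x x = 0. Proof. by apply/d0. Qed.

Lemma dist_gt0 x y : x <> y -> 0 < d x y.
Proof. by move=> xy; rewrite lt0r dist_ge0 andbT; apply/eqP => /d0. Qed.

Lemma continuousPdist (f : G -> R) : continuous f <->
  forall x (e : R), 0 < e -> exists2 e', 0 < e' & forall y, d x y < e' -> `|f x - f y| < e.
Proof.
split=> [cf x e e0|cf x].
  have /cvgrPdist_lt/(_ e e0)/dN[e' e'0 H] := cf x.
  by exists e' => // y /H.
apply/cvgrPdist_lt => e e0; apply/dN.
by have [e' e'0 H] := cf x e e0; exists e'.
Qed.

Lemma dist_lipschitz x y q : `|d x q - d y q| <= d x y.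
Proof.
have := dT x y q; have := dT y x q; rewrite (dC y x) => h1 h2.
by rewrite ler_norml; apply/andP; split; lra.
Qed.

Lemma dist_continuous q : continuous (fun x => d x q).
Proof.
apply/continuousPdist => x e e0; exists e => // y xy.
exact: le_lt_trans (dist_lipschitz _ _ _) _.
Qed.

Lemma dist_net : compact [set: G] -> forall r : G -> R, (forall y, 0 < r y) ->
  exists s : seq G, forall x, exists2 y, y \in s & d x y < r y.
Proof.
move=> /compact_near_coveringP cG r r0.
(* Lists ordered by inclusion: a property holds eventually in [F] when it holds for all lists
   containing some fixed one. *)
pose F : set_system (seq G) :=
  filter_from [set: seq G] (fun s => [set s' : seq G | {subset s <= s'}]).
have FF : Filter F.
  apply: filter_from_filter; first by exists [::].
  move=> s t _ _; exists (s ++ t) => // u sub.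
  by split=> x xs; apply: sub; rewrite mem_cat xs ?orbT.
have [x _|s _ Hs] := cG (seq G) F (fun s x => exists2 y, y \in s & d x y < r y) FF.
  exists ([set x' | d x x' < r x], [set s' : seq G | {subset [:: x] <= s'}]).
    by split; [apply/dN; exists (r x)|exists [:: x]].
  move=> [x' s] /= [xx' xs]; exists x; last by rewrite dC.
  by apply: xs; rewrite mem_head.
by exists s => x; exact: (Hs s (fun=> id) x I).
Qed.

Lemma dist_dense (x0 : G) : compact [set: G] ->
  exists q : nat -> G, forall x (e : R), 0 < e -> exists n, d x (q n) < e.
Proof.
move=> cG; have e0 n : 0 < n.+1%:R^-1 :> R by rewrite invr_gt0.
have /choice[s sP] : forall n : nat, exists s : seq G,
    forall x, exists2 y, y \in s & d x y < n.+1%:R^-1.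
  by move=> n; exact: (dist_net cG (r := fun=> n.+1%:R^-1)).
pose q m := if unpickle m is Some (n, i) then nth x0 (s n) i else x0.
exists q => x e ep; have [N _ /(_ N (leqnn N)) Ne] := near_infty_natSinv_lt (PosNum ep).
have [y ys xy] := sP N x.
exists (pickle (N, index y (s N))); rewrite /q pickleK nth_index //.
exact: lt_trans xy Ne.
Qed.
End metric_topology.

Lemma setI_closed_forall_le (T : Type) (S : set (set T)) (A : nat -> set T) n :
  setI_closed S -> (forall i, (i <= n)%N -> S (A i)) ->
  S [set x | forall i, (i <= n)%N -> A i x].
Proof.
move=> SI; elim: n => [|n IHn] SA.
  rewrite (_ : mkset _ = A 0%N); first exact: SA.
  by apply/seteqP; split=> x /= Ax; [exact: Ax|case].
rewrite (_ : mkset _ = [set x | forall i, (i <= n)%N -> A i x] `&` A n.+1).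
  apply: SI; last exact: SA.
  by apply: IHn => i /leqW; exact: SA.
apply/seteqP; split=> x /= => [Ax|[Ax An] i].
  by split=> [i /leqW|]; exact: Ax.
by rewrite leq_eqVlt => /predU1P[->|/Ax].
Qed.

Section fun_space_topology.
Variables (I : Type) (G : topologicalZmodType).
Local Notation X := (fun_space I G).

Lemma eval_continuous (i : I) : continuous (fun x : X => x i).
Proof. exact: (@proj_continuous {classic I} (fun _ => G) i). Qed.

Lemma compact_fun_space : compact [set: G] -> compact [set: X].
Proof.
move=> cG; have := @tychonoff {classic I} (fun _ => G) (fun _ => setT) (fun _ => cG).
by congr compact; apply/seteqP; split.
Qed.

Variables (R : realType) (d : G -> G -> R).
Hypotheses (d0 : forall x y, d x y = 0 <-> x = y)
  (dC : forall x y, d x y = d y x)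
  (dT : forall x y z, d x z <= d x y + d y z)
  (dN : forall x (A : set G),
     nbhs x A <-> exists2 e : R, 0 < e & [set y | d x y < e] `<=` A).
Hypothesis (cG : compact [set: G]).
Variable (en : nat -> I).
Hypothesis en_surj : forall i, exists n, en n = i.

(** One [N] controls both the number of coordinates and the radius. It comes from compactness of the
    complement of [U]: each of its points differs from [x] in some coordinate [en i], and this
    persists nearby with a positive margin. *)
Lemma fun_space_ball (U : set X) x : open U -> U x ->
  exists N, forall y : X, (forall i, (i <= N)%N -> d (x (en i)) (y (en i)) < N.+1%:R^-1) -> U y.
Proof.
move=> oU Ux; have cU : compact (~` U).
  apply: subclosed_compact (compact_fun_space cG) _ => //.
  by rewrite closedC.
move/compact_near_coveringP : cU => cU.
pose P (N : nat) (y : X) := exists2 i, (i <= N)%N & N.+1%:R^-1 < d (x (en i)) (y (en i)).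
have [y nUy|N _ HN] := cU nat \oo P _.
  have [i xy] : exists i, x (en i) <> y (en i).
    apply: contrapT => /forallNP exy; apply: nUy.
    rewrite (_ : y = x) //; apply/funext => g; have [n <-] := en_surj g.
    by apply: esym; apply: contrapT; exact: exy.
  have dxy := dist_gt0 d0 dC dT xy; set r := d _ _ in dxy.
  have r2 : 0 < r / 2 by lra.
  exists ([set y' : X | r / 2 < d (y' (en i)) (x (en i))],
          [set N | (i <= N)%N /\ N.+1%:R^-1 < r / 2]).
    split; last first.
      by apply: filterI; [exact: nbhs_infty_ge|exact: (near_infty_natSinv_lt (PosNum r2))].
    apply: (open_nbhs_nbhs (A := [set y' : X | r / 2 < d (y' (en i)) (x (en i))])).
    split; last by rewrite /= dC -/r; lra.
    rewrite (_ : mkset _ = (fun y' : X => d (y' (en i)) (x (en i))) @^-1` [set t | r / 2 < t]) //.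
    apply: open_comp => [y' _|]; last exact: open_gt.
    apply: (continuous_comp (f := fun y' : X => y' (en i)) (g := fun t => d t (x (en i)))).
      exact: eval_continuous.
    exact: dist_continuous.
  by move=> [y' N] /= [ry' [iN Nr]]; exists i => //; rewrite dC; apply: lt_trans ry'.
exists N => y xy; apply: contrapT => /(HN N (leqnn N) y)[i iN].
by rewrite ltNge => /negP; apply; apply/ltW/xy.
Qed.

(* A countable base made of cylinders: the code [(N, l)] stands for the points
   close to [q (nth l i)] in each coordinate [en i], [i <= N]. *)
Variable q : nat -> G.
Hypothesis q_dense : forall x (e : R), 0 < e -> exists n, d x (q n) < e.

Definition basic_cylinder (c : nat * seq nat) : set X :=
  [set y | forall i, (i <= c.1)%N -> d (y (en i)) (q (nth 0%N c.2 i)) < (2 * c.1.+1%:R)^-1].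

Lemma open_basic_cylinder c : open (basic_cylinder c).
Proof.
apply: (@setI_closed_forall_le _ open (fun i => (fun y : X => d (y (en i)) (q (nth 0%N c.2 i))) @^-1`
   [set t | t < (2 * c.1.+1%:R)^-1])) => [|i _]; first exact: openI.
apply: open_comp => [y' _|]; last exact: open_lt.
apply: (continuous_comp (f := fun y' : X => y' (en i)) (g := fun t => d t _)).
  exact: eval_continuous.
exact: dist_continuous.
Qed.

Lemma basic_cylinderP (U : set X) x : open U -> U x ->
  exists2 c, basic_cylinder c x & basic_cylinder c `<=` U.
Proof.
move=> oU /(fun_space_ball oU)[N HN].
(* Half the radius of [fun_space_ball], since [x] and [y] are compared through the centre. *)
have e0 : 0 < (2 * N.+1%:R)^-1 :> R by rewrite invr_gt0 mulr_gt0.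
have /choice[k kP] : forall i, exists n, d (x (en i)) (q n) < (2 * N.+1%:R)^-1.
  by move=> i; exact: q_dense.
exists (N, mkseq k N.+1) => [i /= iN|y /= xy]; first by rewrite nth_mkseq.
apply: HN => i iN; have := xy i iN; rewrite nth_mkseq // => yq.
apply: le_lt_trans (dT _ (q (k i)) _) _; rewrite (dC (q _)).
have -> : N.+1%:R^-1 = (2 * N.+1%:R)^-1 + (2 * N.+1%:R)^-1 :> R by field.
exact: ltrD.
Qed.

Lemma open_bigcup_cylinders (U : set X) : open U ->
  exists C : nat -> set X, U = \bigcup_n C n /\
    forall n, C n = set0 \/ exists c, C n = basic_cylinder c.
Proof.
move=> oU; pose C n := if unpickle n is Some c then
   (if pselect (basic_cylinder c `<=` U) then basic_cylinder c else set0) else set0.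
exists C; split=> [|n]; last first.
  rewrite /C; case: unpickle => [c|]; last by left.
  by case: pselect => ? /=; [right; exists c|left].
apply/seteqP; split=> [x /(basic_cylinderP oU)[c cx cU]|x [n _]].
  by exists (pickle c) => //; rewrite /C pickleK; case: pselect.
by rewrite /C; case: unpickle => [c|//]; case: pselect => // cU /cU.
Qed.

End fun_space_topology.

(** * Measures from contents *)

Section measure_of_content.
Local Open Scope ereal_scope.
Variables (R : realType) (X : ptopologicalType) (lam : set X -> R).
Hypotheses (lam0 : lam set0 = 0%R) (lam_ge0 : forall A, (0 <= lam A)%R)
  (lamU : forall A B, A `&` B = set0 -> lam (A `|` B) = (lam A + lam B)%R)
  (lamT : lam setT = 1%R).

Lemma le_content A B : A `<=` B -> (lam A <= lam B)%R.
Proof.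
move=> AB; have -> : B = A `|` (B `\` A) by rewrite setDUK.
by rewrite lamU ?lerDl // setDE setICA setICr setI0.
Qed.

Definition open_content (A : set X) : \bar R :=
  if pselect (open A) then (lam A)%:E else +oo.

Lemma open_contentE A : open A -> open_content A = (lam A)%:E.
Proof.
by rewrite /open_content => oA; case: pselect => H //=; exfalso; exact: H oA.
Qed.

Lemma open_content0 : open_content set0 = 0.
Proof. by rewrite open_contentE ?lam0 //; exact: open0. Qed.

Lemma open_content_ge0 A : 0 <= open_content A.
Proof. by rewrite /open_content; case: pselect => ? //=; rewrite lee_fin. Qed.

(* On the discrete sigma-algebra the outer measure [mu_ext] ranges over all
   countable covers; [open_content] makes only the open ones count. *)
Definition outer_content : set X -> \bar R :=
  @mu_ext _ (g_sigma_algebraType [set: set X]) R open_content.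

HB.instance Definition _ := isOuterMeasure.Build R X outer_content
  (@mu_ext0 _ (g_sigma_algebraType [set: set X]) R _ open_content0 open_content_ge0)
  (@mu_ext_ge0 _ (g_sigma_algebraType [set: set X]) R _ open_content_ge0)
  (@le_mu_ext _ (g_sigma_algebraType [set: set X]) R _)
  (@mu_ext_sigma_subadditive _ (g_sigma_algebraType [set: set X]) R _ open_content_ge0).

Let om : {outer_measure set X -> \bar R} := outer_content.

Lemma open_cover_le S (F : nat -> set X) : (forall n, open (F n)) ->
  S `<=` \bigcup_n F n -> om S <= \sum_(n <oo) (lam (F n))%:E.
Proof.
move=> oF SF; apply: ereal_inf_lbound; exists F.
  by split=> // i; exact: sub_gen_smallest.
by apply: eq_eseriesr => n _; rewrite open_contentE.
Qed.

Lemma le_open_cover S a : (forall F : nat -> set X, (forall n, open (F n)) ->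
  S `<=` \bigcup_n F n -> a <= \sum_(n <oo) (lam (F n))%:E) -> a <= om S.
Proof.
move=> H; apply: le_ereal_inf_tmp => _ [F [_ SF] <-].
have [oF|] := pselect (forall n, open (F n)).
  apply: le_trans (H F oF SF) _; apply: lee_nneseries => [n _ _|n _]; first by rewrite lee_fin.
  by rewrite open_contentE.
move=> /existsNP[n nF]; rewrite (@eseries_pinfty _ _ _ n) ?leey //.
  by move=> i _; rewrite -ltNye; apply: lt_le_trans (open_content_ge0 _).
by rewrite /open_content; case: pselect => oF //=; exfalso; exact: nF oF.
Qed.

Lemma outer_content_open U : open U -> om U <= (lam U)%:E.
Proof.
move=> oU; pose F n := if n is 0%N then U else set0.
have -> : (lam U)%:E = \sum_(n <oo) (lam (F n))%:E.
  rewrite nneseries_recl => [|n _|] //; last by rewrite lee_fin.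
  by rewrite eseries0 ?adde0 // => -[|n] // _ _ /=; rewrite lam0.
apply: open_cover_le => [[|n] /=|x Ux]; [exact: oU|exact: open0|by exists 0%N].
Qed.

(** Compactness reduces an open cover to a finite one, for which finite additivity of [lam] is
    enough. *)
Lemma outer_contentT : compact [set: X] -> om setT = 1.
Proof.
move=> cX; apply/eqP; rewrite eq_le; apply/andP; split.
  by rewrite -lamT; apply: outer_content_open; exact: openT.
apply: le_open_cover => F oF cF.
have {}cX : cover_compact [set: X] by rewrite -compact_cover.
have [D' _ cD'] := cX nat setT F (fun i _ => oF i) cF.
pose N := (\max_(i <- finmap.enum_fset D') i).+1.
have subN : setT `<=` \big[setU/set0]_(i < N) F i.
  move=> x /cD'[i iD Fix]; rewrite -bigcup_mkord; exists i => //=.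
  by rewrite ltnS; apply: leq_bigmax_seq.
have finU n : (lam (\big[setU/set0]_(i < n) F i) <= \sum_(i < n) lam (F i))%R.
  elim: n => [|n IHn]; first by rewrite !big_ord0 lam0.
  rewrite !big_ord_recr /=; set B := \big[setU/set0]_(i < n) _.
  have -> : B `|` F n = B `|` (F n `\` B).
    by apply/seteqP; split=> x [Bx|Fx]; [left|have [?|?] := pselect (B x); [left|right]|left|right; case: Fx].
  rewrite lamU; last by rewrite setDE setICA setICr setI0.
  apply: lerD IHn _; apply: le_content; exact: subDsetl.
apply: (@le_trans _ _ (\sum_(i < N) lam (F i))%:E).
  by rewrite lee_fin -lamT; apply: le_trans (le_content subN) (finU N).
rewrite -sumEFin -(big_mkord xpredT (fun i => (lam (F i))%:E)).
by apply: nneseries_lim_ge => n _ _; rewrite lee_fin.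
Qed.

(** The disjoint open sets where [h] is above and below [t] split every open cover of the union into
    a cover of [A] and a cover of [B]. *)
Lemma outer_content_separated (h : X -> R) (t : R) A B : continuous h ->
  (forall x, A x -> (t < h x)%R) -> (forall x, B x -> (h x < t)%R) ->
  om A + om B <= om (A `|` B).
Proof.
move=> ch At Bt; apply: le_open_cover => F oF ABF.
have oP : open [set x | (t < h x)%R].
  by apply: (@open_comp _ _ h [set s | (t < s)%R]) => [? _|]; [exact: ch|exact: open_gt].
have oQ : open [set x | (h x < t)%R].
  by apply: (@open_comp _ _ h [set s | (s < t)%R]) => [? _|]; [exact: ch|exact: open_lt].
apply: (@le_trans _ _ (\sum_(n <oo) ((lam (F n `&` [set x | (t < h x)%R]))%:E +
    (lam (F n `&` [set x | (h x < t)%R]))%:E))).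
  rewrite nneseriesD; do ?[by move=> n _ _; rewrite lee_fin].
  apply: leeD; apply: open_cover_le => [n|x Hx].
  - exact: openI.
  - by have [n _ Fx] := ABF x (or_introl Hx); exists n => //; split => //; exact: At.
  - exact: openI.
  - by have [n _ Fx] := ABF x (or_intror Hx); exists n => //; split => //; exact: Bt.
apply: lee_nneseries => [n _ _|n _]; first by rewrite adde_ge0 ?lee_fin.
rewrite -EFinD lee_fin -lamU; last first.
  by apply/seteqP; split=> // x [[_ /= h1] [_ /= h2]]; have := lt_trans h1 h2; rewrite ltxx.
by apply: le_content => x [[]|[]].
Qed.

Lemma outer_content_le1 S : om S <= 1.
Proof.
apply: (@le_trans _ _ (om setT)); first exact: le_outer_measure.
by rewrite -lamT; apply: outer_content_open; exact: openT.
Qed.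

Lemma outer_content_sum_separated (h : X -> R) (Q : nat -> set X) (a b : nat -> R) :
  continuous h -> (forall k x, Q k x -> (a k < h x <= b k)%R) ->
  (forall k, (b k.+1 < a k)%R) -> (forall k, (a k.+1 <= a k)%R) ->
  forall N, \sum_(k < N) om (Q k) <= om (\big[setU/set0]_(k < N) Q k).
Proof.
move=> ch Qab ba aa; have a_le i j : (i <= j)%N -> (a j <= a i)%R.
  by elim: j => [|j IHj]; [case: i|rewrite leq_eqVlt => /predU1P[->//|/IHj]; exact: le_trans].
case=> [|N]; first by rewrite !big_ord0 outer_measure0.
elim: N => [|N IHN]; first by rewrite !big_ord1.
rewrite big_ord_recr [X in _ <= om X]big_ord_recr /=.
apply: le_trans (leeD2r _ IHN) _.
(* The midpoint of the gap between [b N.+1] and [a N] separates the new piece from all earlier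
   ones. *)
apply: (@outer_content_separated h ((b N.+1 + a N) / 2)) => // x.
  rewrite -bigcup_mkord => -[k /=]; rewrite ltnS => kN /Qab/andP[+ _].
  by have := a_le _ _ kN; have := ba N; lra.
by move=> /Qab/andP[_]; have := ba N; lra.
Qed.

(* The shells [Q k] with [k] of a given parity are mutually separated, so their
   outer measures are summable and [om (S_ n)] tends to [om A]. *)
Lemma caratheodory_outer_content (h : X -> R) : continuous h ->
  om.-caratheodory [set x | (0 < h x)%R].
Proof.
move=> ch; apply: le_caratheodory_measurable => S.
set A := S `&` _; set B := S `&` _.
pose S_ n := S `&` [set x | (n.+1%:R^-1 < h x)%R].
pose Q k := S `&` [set x | (k.+2%:R^-1 < h x <= k.+1%:R^-1)%R].
have SB n : om (S_ n) + om B <= om S.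
  apply: (@le_trans _ _ (om (S_ n `|` B))); last first.
    by apply: le_outer_measure => x [[]|[]].
  apply: (@outer_content_separated h (n.+1%:R^-1)) => // x [_] //=.
  by move/negP; rewrite -leNgt => /le_lt_trans; apply; rewrite invr_gt0.
have QN (j N : nat) : \sum_(k < N) om (Q (2 * k + j)%N) <= 1.
  apply: le_trans (outer_content_le1 (\big[setU/set0]_(k < N) Q (2 * k + j)%N)).
  apply: (@outer_content_sum_separated h (fun k => Q (2 * k + j)%N)
    (fun k => (2 * k + j)%N.+2%:R^-1)%R (fun k => (2 * k + j)%N.+1%:R^-1)%R) => //.
  - by move=> k x [].
  - by move=> k; rewrite ltf_pV2 ?posrE ?ltr0n // ltr_nat mulnS; lia.
  - by move=> k; rewrite lef_pV2 ?posrE ?ltr0n // ler_nat mulnS; lia.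
have sumQ : \sum_(0 <= k <oo) om (Q k) < +oo.
  apply: (@le_lt_trans _ _ (1 + 1)); last by rewrite -EFinD ltry.
  apply: lime_le; first by apply: is_cvg_nneseries => n _ _; exact: outer_measure_ge0.
  apply: nearW => N.
  have Q2 : \sum_(0 <= k < N) om (Q k) <= \sum_(k < 2 * N) om (Q k).
    rewrite -[leRHS](big_mkord xpredT (fun k => om (Q k))).
    apply: lee_sum_nneg_natr => [n _ _|]; [exact: outer_measure_ge0|lia].
  apply: le_trans Q2 _.
  have -> : \sum_(k < 2 * N) om (Q k) =
      \sum_(k < N) om (Q (2 * k + 0)%N) + \sum_(k < N) om (Q (2 * k + 1)%N).
    elim: N => [|N IHN]; first by rewrite muln0 !big_ord0 adde0.
    rewrite mulnS !addSn add0n !big_ord_recr /= IHN addn0 addn1.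
    by rewrite -!addeA; congr (_ + _); rewrite addeCA.
  exact: leeD.
have tailQ := nneseries_tail_cvg sumQ (fun k _ => outer_measure_ge0 om (Q k)).
have bound n : om A + om B <= om S + \sum_(n <= k <oo) om (Q k).
  have AS : om A <= om (S_ n) + \sum_(n <= k <oo) om (Q k).
    apply: (@le_trans _ _ (om (S_ n `|` \bigcup_(k in ~` `I_n) Q k))).
      apply: le_outer_measure => x [Sx /= hx].
      have [nh|hn] := ltP n.+1%:R^-1%R (h x); first by left.
      right.
      have [k /andP[k1 k2]] : exists k, (k.+2%:R^-1 < h x <= k.+1%:R^-1)%R.
        have [m] : exists m, (m.+1%:R^-1 < h x)%R.
          have [m _ /(_ m (leqnn m)) mh] := near_infty_natSinv_lt (PosNum hx).
          by exists m.
        elim: m => [|m IHm] mh; last first.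
          by have [/IHm //|hm] := ltP m.+1%:R^-1%R (h x); exists m; rewrite mh.
        have := lt_le_trans mh hn; rewrite ltf_pV2 ?posrE ?ltr0n // ltr_nat.
        by rewrite ltnS.
      exists k; last by split=> //=; rewrite k1.
      move=> /= kn; have := lt_le_trans k1 hn.
      by rewrite ltf_pV2 ?posrE ?ltr0n // ltr_nat ltnNge; lia.
    apply: le_trans (outer_measureU2 _ _ _) _.
    by rewrite leeD2l // outer_measure_sigma_subadditive_tail.
  apply: le_trans (leeD2r _ AS) _.
  by rewrite addeAC leeD2r.
apply/lee_addgt0Pr => e e0.
have /tailQ[N _ /(_ N (leqnn N)) /= Ne] : nbhs 0 [set y : \bar R | y < e%:E].
  by apply: open_nbhs_nbhs; split; [exact: open_ereal_lt_ereal|rewrite /= lte_fin].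
by apply: le_trans (bound N) _; rewrite leeD2l // ltW.
Qed.

(** A homeomorphism carries open covers to open covers; the reverse inequality is the same argument
    for [psi], which preserves [lam] as well. *)
Lemma outer_content_preimage (phi psi : X -> X) S : continuous phi -> continuous psi ->
  cancel phi psi -> cancel psi phi -> (forall A, lam (phi @^-1` A) = lam A) ->
  om (phi @^-1` S) = om S.
Proof.
move=> cphi cpsi phiK psiK lamphi.
have le_om (f : X -> X) A : continuous f -> (forall A, lam (f @^-1` A) = lam A) ->
    om (f @^-1` A) <= om A.
  move=> cf lamf; apply: le_open_cover => F oF AF.
  apply: (@le_trans _ _ (\sum_(n <oo) (lam (f @^-1` (F n)))%:E)).
    apply: open_cover_le => [n|x /AF[n _ Fn]]; last by exists n.
    by apply: open_comp => // x _; exact: cf.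
  by rewrite (eq_eseriesr (fun n _ => congr1 EFin (lamf (F n)))).
apply/eqP; rewrite eq_le le_om //=.
have psiphi A : psi @^-1` (phi @^-1` A) = A.
  by apply/seteqP; split=> x /=; rewrite psiK.
rewrite -[X in om X <= _](psiphi S) le_om // => A.
by rewrite -[LHS]lamphi; congr lam; apply/seteqP; split=> x /=; rewrite phiK.
Qed.

(** Cozero sets are Caratheodory measurable and generate the Borel sets. On open sets [lam] survives
    as an upper bound, which is what later confines the support. *)
Lemma probability_of_content : compact [set: X] ->
  (forall U : set X, open U ->
     <<s [set [set x | (0 < h x)%R] | h in [set h : X -> R | continuous h]] >> U) ->
  exists P : probability (borel_type X) R,
    (forall U, open U -> P U <= (lam U)%:E) /\
    (forall phi psi : X -> X, continuous phi -> continuous psi ->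
      cancel phi psi -> cancel psi phi -> (forall A, lam (phi @^-1` A) = lam A) ->
      forall A, P (phi @^-1` A) = P A).
Proof.
move=> cX openS.
have cara_sigma : sigma_algebra [set: X] om.-caratheodory.
  split; first exact: caratheodory_measurable_set0.
    by move=> A mA; rewrite setTD; exact: caratheodory_measurable_setC.
  by move=> F mF; exact: caratheodory_measurable_bigcup.
have bM (A : set (borel_type X)) : measurable A -> om.-caratheodory A.
  apply: smallest_sub => // U /openS.
  apply: smallest_sub => // _ [h ch <-]; exact: caratheodory_outer_content.
pose f : set (borel_type X) -> \bar R := om.
have f0 : f set0 = 0 by exact: outer_measure0.
have f_ge0 A : 0 <= f A by exact: outer_measure_ge0.
have f_sigma : semi_sigma_additive f.
  move=> F mF tF mUF.
  apply: (@caratheodory_measure_sigma_additive _ _ om F) => //.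
    by move=> n; exact: bM.
  exact: bM.
pose fM := isMeasure.Build _ _ _ f f0 f_ge0 f_sigma.
pose mu : {measure set (borel_type X) -> \bar R} := HB.pack f fM.
have muT : mu setT = 1 by exact: outer_contentT.
pose muP := Measure_isProbability.Build _ _ _ mu muT.
pose P : probability (borel_type X) R := HB.pack f fM muP.
exists P; split; first exact: outer_content_open.
by move=> phi psi *; exact: (@outer_content_preimage phi psi).
Qed.

End measure_of_content.

(** * Existence of an invariant measure *)

Section polynomial_filtration.
Variables (Gamma : groupType) (G : topologicalZmodType).
Local Notation X := (fun_space Gamma G).
Implicit Types (Q : X) (g c : Gamma).

(* [vanishing j] is the group of polynomial maps of degree less than [j]. *)
Fixpoint vanishing j (Q : X) : Prop :=
  if j is j'.+1 then forall g, vanishing j' (Delta g Q) else Q = fun=> 0.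

Lemma polynomial_vanishing (P : X) d : polynomial_of_degree_le d P -> vanishing d.+1 P.
Proof.
rewrite /polynomial_of_degree_le; move: d.+1 => n {d} Pn.
have {}Pn s : size s = n -> foldl (fun f g => Delta g f) P s = fun=> 0.
  by move=> sn; exact: (Pn (Tuple (introT eqP sn))).
elim: n P Pn => [|n IHn] P Pn /=; first exact: (Pn [::]).
by move=> g; apply: IHn => s sn; apply: (Pn (g :: s)); rewrite /= sn.
Qed.

Lemma translateM g h Q : translate (g * h)%g Q = translate g (translate h Q).
Proof. by apply/funext => x; rewrite /translate invgM mulgA. Qed.

Lemma translate1 Q : translate 1%g Q = Q.
Proof. by apply/funext => x; rewrite /translate invg1 mul1g. Qed.

Lemma translateK g : cancel (@translate Gamma G g) (translate g^-1%g).
Proof. by move=> Q; rewrite -translateM mulVg translate1. Qed.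

Lemma translateVK g : cancel (translate g^-1%g) (@translate Gamma G g).
Proof. by move=> Q; rewrite -translateM mulgV translate1. Qed.

Lemma vanishing_translate j g Q : vanishing j Q -> vanishing j (translate g Q).
Proof.
elim: j g Q => [|j IHj] g Q /=; first by move=> ->.
move=> vQ h; have -> : Delta h (translate g Q) = translate g (Delta (g^-1 * h * g)%g Q).
  apply/funext => x; rewrite /Delta /translate; congr (Q _ - _).
  by rewrite !mulgA mulgK.
exact: IHj.
Qed.

Lemma vanishing_sub j Q Q' : vanishing j Q -> vanishing j Q' ->
  vanishing j (fun x => Q x - Q' x).
Proof.
elim: j Q Q' => [|j IHj] Q Q' /=.
  by move=> -> ->; apply/funext => x; rewrite subrr.
move=> vQ vQ' g.
have -> : Delta g (fun x => Q x - Q' x) = (fun x => Delta g Q x - Delta g Q' x).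
  by apply/funext => x; rewrite /Delta opprB addrACA [- _ + _ in RHS]addrC -opprD opprB addrACA opprD.
exact: IHj.
Qed.

(** Translation by [g] is unipotent of depth [k]. These sets are the filtration given to
    [invariant_mean_nilpotent]: every element has depth [1], and elements of depth [n] fix all maps
    in [vanishing n]. *)
Definition lowers_degree k g : Prop :=
  forall j Q, vanishing (j + k) Q -> vanishing j (fun x => translate g Q x - Q x).

Lemma lowers_degree0 g : lowers_degree 0 g.
Proof.
move=> j Q; rewrite addn0 => vQ; apply: vanishing_sub => //.
exact: vanishing_translate.
Qed.

Lemma lowers_degree1 g : lowers_degree 1 g.
Proof. by move=> j Q; rewrite addn1 => /(_ g^-1%g). Qed.

Lemma lowers_degreeJ k g c : lowers_degree k c -> lowers_degree k (g * c * g^-1)%g.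
Proof.
move=> kc j Q vQ.
have -> : (fun x => translate (g * c * g^-1)%g Q x - Q x) =
   translate g (fun x => translate c (translate g^-1%g Q) x - translate g^-1%g Q x).
  apply/funext => x; rewrite !translateM /= [in RHS]/translate.
  by congr (_ - _); rewrite -[in LHS](translateVK g Q).
by apply/vanishing_translate/kc/vanishing_translate.
Qed.

(** With [L_g] for translation by [g], the difference operator of the group commutator is [(L_c - 1)
    (L_g - 1) - (L_g - 1) (L_c - 1)] applied after [L_c^-1 L_g^-1]; each product lowers the degree
    by [k] and by [1]. *)
Lemma lowers_degreeR k g c : lowers_degree k c ->
  lowers_degree k.+1 (c * g * c^-1 * g^-1)%g.
Proof.
move=> kc j Q vQ; pose Q' := translate (c^-1 * g^-1)%g Q.
have vQ' : vanishing (j + k.+1) Q' by exact: vanishing_translate.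
pose a := fun x => translate g Q' x - Q' x.
pose b := fun x => translate c Q' x - Q' x.
have -> : (fun x => translate (c * g * c^-1 * g^-1)%g Q x - Q x) =
   (fun x => (translate c a x - a x) - (translate g b x - b x)).
  have QE : Q = translate g (translate c Q').
    by rewrite -!translateM mulgA mulgK mulgV translate1.
  apply/funext => x; rewrite -mulgA translateM -/Q' translateM [in X in _ - X = _]QE.
  pose A := translate c (translate g Q') x; pose B := translate c Q' x.
  pose C := translate g Q' x; pose E := translate g (translate c Q') x.
  rewrite -/A -/E; transitivity ((A - B - (C - Q' x)) - (E - C - (B - Q' x))) => //.
  have -> : A - B - (C - Q' x) = (A - C) - (B - Q' x) by rewrite !opprB addrACA [RHS]addrACA [- B + _]addrC.
  by rewrite [- (E - C - _)]opprB [_ - (B - _) + _]subrKA opprB subrKA.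
apply: vanishing_sub.
  by apply: kc; apply: lowers_degree1; rewrite addn1 -addnS.
by apply: lowers_degree1; apply: kc; rewrite addn1 addSnnS.
Qed.

End polynomial_filtration.

(** * The measure of visits of the orbit *)

Section existence.
Variables (R : realType) (Gamma : groupType) (G : topologicalZmodType).
Variables (d : G -> G -> R) (en : nat -> Gamma).
Local Notation X := (fun_space Gamma G).
Hypotheses (d0 : forall x y, d x y = 0 <-> x = y)
  (dC : forall x y, d x y = d y x)
  (dT : forall x y z, d x z <= d x y + d y z)
  (dN : forall x (A : set G),
     nbhs x A <-> exists2 e : R, 0 < e & [set y | d x y < e] `<=` A)
  (cG : compact [set: G]) (en_surj : forall g, exists i, en i = g).

Lemma continuous_fun_space (T : topologicalType) (f : T -> X) :
  (forall g, continuous (fun t => f t g)) -> continuous f.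
Proof.
move=> cf t A /=; rewrite nbhsE => -[U [oU Ut] UA]; apply: filterS (UA) _.
have [N HN] := fun_space_ball d0 dC dT dN cG en_surj oU Ut.
have : nbhs t [set t' | forall i, (i <= N)%N -> d (f t' (en i)) (f t (en i)) < N.+1%:R^-1].
  apply: open_nbhs_nbhs; split; last by move=> i _; rewrite (distxx d0) invr_gt0.
  apply: (@setI_closed_forall_le _ open (fun i => (fun t' => d (f t' (en i)) (f t (en i))) @^-1`
    [set r | r < N.+1%:R^-1])) => [|i _]; first exact: openI.
  apply: open_comp => [t' _|]; last exact: open_lt.
  apply: (continuous_comp (f := fun t' => f t' (en i)) (g := fun y => d y _)).
    exact: cf.
  exact: (dist_continuous dC dT dN).
by apply: filterS => t' Ht'; apply: HN => i iN; rewrite dC; exact: Ht'.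
Qed.

Lemma translate_continuous g : continuous (@translate Gamma G g).
Proof. by apply: continuous_fun_space => h; exact: eval_continuous. Qed.

Lemma open_sigma_cozero (U : set X) : open U ->
  <<s [set [set x | 0 < h x] | h in [set h : X -> R | continuous h]] >> U.
Proof.
have [q q_dense] := dist_dense dC dN (0 : G) cG.
move=> /(open_bigcup_cylinders d0 dC dT dN cG en_surj q_dense)[C [-> HC]].
set S := <<s _ >>.
have [S0 SC SU] : sigma_algebra setT S by exact: smallest_sigma_algebra.
have SI A B : S A -> S B -> S (A `&` B).
  exact: (@measurableI _ (g_sigma_algebraType _)).
apply: SU => n; have [->//|[c ->]] := HC n.
apply: (@setI_closed_forall_le _ S
  (fun i => [set y : X | d (y (en i)) (q (nth 0%N c.2 i)) < (2 * c.1.+1%:R)^-1]) c.1 SI).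
move=> i _; apply: sub_gen_smallest.
exists (fun y => (2 * c.1.+1%:R)^-1 - d (y (en i)) (q (nth 0%N c.2 i))); last first.
  by apply/seteqP; split=> y /=; rewrite subr_gt0.
move=> y; apply: (@continuousB _ _ _ (cst _) (fun y : X => d (y (en i)) _)).
  exact: cst_continuous.
apply: (continuous_comp (f := fun y : X => y (en i)) (g := fun z => d z _)).
  exact: eval_continuous.
exact: (dist_continuous dC dT dN).
Qed.

Theorem invariant_probability (P : X) n : vanishing n P ->
  exists mu : probability (borel_type X) R, invariant_on_orbit_closure P mu.
Proof.
move=> vP.
have [M [mM MT]] := @invariant_mean_nilpotent R Gamma en (@lowers_degree Gamma G) n
  en_surj (@lowers_degree0 _ _) (fun k g c => @lowers_degreeJ _ _ k g c)
  (fun k g c => @lowers_degreeR _ _ k g c).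
(* The mean frequency of visits of the orbit of [P] to [A]: a finitely additive probability on all
   subsets. *)
pose lam (A : set X) : R := M (fun g => \1_A (translate g P)).
have b1 A : bfun (fun g => \1_A (translate g P) : R).
  by exists 1 => g; rewrite indicE; case: (_ \in _); rewrite ?normr1 ?normr0.
have [] := @probability_of_content R X lam _ _ _ _ _ _.
- rewrite /lam (_ : (fun _ => _) = fun=> 0); first exact: (mean_cst mM).
  by apply/funext => g; rewrite indic0.
- move=> A; apply: (mean_ge0 mM) => // g; by rewrite indicE.
- move=> A B AB; rewrite -(meanD mM) //; congr M; apply/funext => g.
  rewrite !indicE in_setU.
  case: (boolP (_ \in A)) => [/set_mem xA|]; case: (boolP (_ \in B)) => [/set_mem xB|] //=;
    rewrite ?addr0 ?add0r //.
  by have : (A `&` B) (translate g P) by []; rewrite AB.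
- rewrite /lam (_ : (fun _ => _) = fun=> 1); first exact: (mean1 mM).
  by apply/funext => g; rewrite indicT.
- exact: compact_fun_space.
- exact: open_sigma_cozero.
move=> mu [muU mu_inv]; exists mu; split=> [g A mA|x].
  apply: (mu_inv (translate g) (translate g^-1%g)).
  - exact: translate_continuous.
  - exact: translate_continuous.
  - exact: translateK.
  - exact: translateVK.
  (* [MT] applies because an element of depth [n] fixes every translate of [P]. *)
  move=> B; rewrite -[RHS](MT _ (b1 B) _ g); last first.
    move=> c y nc; rewrite translateM; congr (\1_B _).
    have := nc 0%N (translate y P) (vanishing_translate y vP).
    move=> /= /(congr1 (fun f => f _)) H; apply/funext => z.
    by apply/eqP; rewrite -subr_eq0; exact/eqP/H.
  congr M; apply/funext => h; rewrite translateM.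
  by rewrite !indicE; congr (nat_of_bool _)%:R.
move=> mux; apply: contrapT => nXx.
(* The orbit never visits this open set, so its content is zero, and its measure is no larger. *)
have oU : open (~` orbit_closure P) by rewrite openC; exact: closed_closure.
have := mux _ oU nXx; apply/negP; rewrite -leNgt.
apply: le_trans (muU _ oU) _; rewrite lee_fin.
rewrite /lam (_ : (fun _ => _) = fun=> 0); first by rewrite (mean_cst mM).
apply/funext => g; rewrite indicE memNset //= => H; apply: H.
by apply: subset_closure; exists g.
Qed.

End existence.

(** * The Haar functional *)

Lemma compact_bfun (R : realType) (T : topologicalType) (f : T -> R) :
  compact [set: T] -> continuous f -> bfun f.
Proof.
move=> /compact_near_coveringP cT cf.
have [x _|N _ HN] := cT nat \oo (fun n x => `|f x| <= n%:R) _; last first.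
  by exists N%:R => x; exact: (HN N (leqnn N) x I).
exists ([set y | `|f x - f y| < 1], [set n | `|f x| + 1 <= n%:R]).
  split; first by move/cvgrPdist_lt: (cf x); apply.
  exists (Num.bound (`|f x| + 1)) => // n /= hn.
  apply: (@le_trans _ _ (Num.bound (`|f x| + 1))%:R); last by rewrite ler_nat.
  by apply/ltW/archi_boundP; rewrite addr_ge0.
move=> [y n] /= [xy nx]; apply: le_trans nx.
by rewrite -lerBlDl; apply: le_trans (lerB_dist _ _) _; rewrite distrC ltW.
Qed.

Section haar.
Variables (R : realType) (G : topologicalZmodType) (d : G -> G -> R).
Hypotheses (d0 : forall x y, d x y = 0 <-> x = y)
  (dC : forall x y, d x y = d y x)
  (dT : forall x y z, d x z <= d x y + d y z)
  (dN : forall x (A : set G),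
     nbhs x A <-> exists2 e : R, 0 < e & [set y | d x y < e] `<=` A)
  (cG : compact [set: G]).

Definition joint (F : G -> G -> R) := continuous (fun p : G * G => F p.1 p.2).

(** What the spectral arguments use of Haar measure: a finitely additive mean, well behaved on
    continuous functions. [haar_bfun] stands in for compactness, so that the convolution algebra is
    developed from [I] alone. *)
Record haar (I : (G -> R) -> R) : Prop := {
  haar_mean : mean I;
  haar_bfun : forall f : G -> R, continuous f -> bfun f;
  haar_joint : forall F, joint F -> continuous (fun x => I (F x));
  haarT : forall (f : G -> R) g, continuous f -> I (fun x => f (x + g)) = I f;
  haarN : forall (f : G -> R), continuous f -> I (fun x => f (- x)) = I f;
  haarF : forall F, joint F -> I (fun x => I (F x)) = I (fun y => I (fun x => F x y));
  haar_gt0 : forall (f : G -> R) x, continuous f -> (forall y, 0 <= f y) -> 0 < f x -> 0 < I f }.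

Lemma continuous_bfun (f : G -> R) : continuous f -> bfun f.
Proof. exact: compact_bfun. Qed.

Lemma joint_l F x : joint F -> continuous (F x).
Proof.
move=> jF y; apply: (@continuous_comp _ _ _ (fun y => (x, y)) (fun p => F p.1 p.2)).
  by apply: cvg_pair; [exact: cvg_cst|exact: cvg_id].
exact: jF.
Qed.

Lemma joint_swap F : joint F -> joint (fun y x => F x y).
Proof.
move=> jF p; apply: (@continuous_comp _ _ _ (fun p => (p.2, p.1)) (fun p => F p.1 p.2)).
  by apply: cvg_pair; [exact: cvg_snd|exact: cvg_fst].
exact: jF.
Qed.

(** The tube lemma: compactness in [y] makes continuity in [x] uniform. *)
Lemma joint_near F x (e : R) : joint F -> 0 < e ->
  exists2 r, 0 < r & forall x', d x x' < r -> forall y, `|F x' y - F x y| < e.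
Proof.
move=> jF e0; suff : \forall x' \near x, [set: G] `<=` [set y | `|F x' y - F x y| < e].
  by move/dN => [r r0 H]; exists r => // x' /H H' y; exact: H'.
have /compact_near_coveringP cG' := cG.
apply: cG' => y _; have e2 : 0 < e / 2 by lra.
have /cvgrPdist_lt/(_ _ e2) [[U V] /= [Ux Vy] UV] := jF (x, y).
exists (V, U) => // -[y' x'] /= [Vy' Ux'].
have h1 := UV (x', y') (conj Ux' Vy'); have h2 := UV (x, y') (conj (nbhs_singleton Ux) Vy').
rewrite -(subrKA (F x y)); apply: le_lt_trans (ler_normD _ _) _.
by rewrite distrC in h1; move: h1 h2 => /=; lra.
Qed.

Section mean_on_continuous.
Variables (J : (G -> R) -> R).
Hypothesis mJ : mean J.

Lemma dist_mean_le f g e : continuous f -> continuous g ->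
  (forall x, `|f x - g x| <= e) -> `|J f - J g| <= e.
Proof.
move=> cf cg fg; rewrite -(meanB mJ); do ?exact: continuous_bfun.
exact: norm_mean_le.
Qed.

Lemma joint_mean_continuous F : joint F -> continuous (fun x => J (F x)).
Proof.
move=> jF; apply/(continuousPdist dN) => x e e0.
have e2 : 0 < e / 2 by lra.
have [r r0 H] := joint_near x jF e2; exists r => // y /H {}H.
rewrite distrC; apply: (@le_lt_trans _ _ (e / 2)); last by lra.
by apply: dist_mean_le => [||z]; [exact: joint_l|exact: joint_l|exact/ltW].
Qed.

(* Fubini: [F] is uniformly close to a combination of product functions, by a
   partition of unity in the first variable. *)
Lemma mean_fubini F : joint F -> J (fun x => J (F x)) = J (fun y => J (fun x => F x y)).
Proof.
move=> jF; apply/eqP; rewrite -subr_eq0 -normr_le0; apply/ler_addgt0Pl => e e0.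
rewrite addr0; have e2 : 0 < e / 2 by lra.
have /choice[r rP] : forall z, exists r : R, 0 < r /\
    forall x, d z x < r -> forall y, `|F x y - F z y| < e / 2.
  by move=> z; have [r ? ?] := joint_near z jF e2; exists r.
have [s sP] := dist_net dC dN cG (fun z => (rP z).1).
(* Tents around a finite net, with the modulus [r z] as radius: where [w z x] is positive, [F x] is
   within [e / 2] of [F z]. *)
pose w z x := Num.max 0 (r z - d x z).
have w_ge0 z x : 0 <= w z x by rewrite /w le_max lexx.
pose W x := \sum_(z <- s) w z x.
have W_gt0 x : 0 < W x.
  have [z zs xz] := sP x; rewrite /W (big_rem z zs) /=.
  rewrite ltr_wpDr ?sumr_ge0 //; by rewrite /w lt_max subr_gt0 xz orbT.
pose p z x := w z x / W x.
have p_ge0 z x : 0 <= p z x by rewrite divr_ge0 // ltW.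
have p1 x : \sum_(z <- s) p z x = 1.
  by rewrite -mulr_suml -/(W x) divff // gt_eqF // W_gt0.
have cw z : continuous (w z).
  move=> x; apply: (@continuous_max _ _ (cst 0) (fun x => r z - d x z)).
    exact: cst_continuous.
  apply: (@continuousB _ _ _ (cst _) (fun x => d x z)); first exact: cst_continuous.
  exact: (dist_continuous dC dT dN).
have cW : continuous W.
  rewrite /W; elim: s {sP W W_gt0 p p_ge0 p1} => [|z s IHs].
    by under eq_fun do rewrite big_nil; exact: cst_continuous.
  under eq_fun do rewrite big_cons.
  by move=> x; apply: continuousD; [exact: cw|exact: IHs].
have cp z : continuous (p z).
  move=> x; apply: continuousM; first exact: cw.
  by apply: continuousV; [rewrite gt_eqF|exact: cW].
have close x y : `|F x y - \sum_(z <- s) p z x * F z y| <= e / 2.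
  have -> : F x y - \sum_(z <- s) p z x * F z y = \sum_(z <- s) p z x * (F x y - F z y).
    by under [RHS]eq_bigr do rewrite mulrBr; rewrite sumrB -mulr_suml p1 mul1r.
  apply: le_trans (ler_norm_sum _ _ _) _.
  have -> : e / 2 = \sum_(z <- s) p z x * (e / 2) by rewrite -mulr_suml p1 mul1r.
  apply: ler_sum => z _.
  rewrite normrM ger0_norm //; have [xz|xz] := ltP (d z x) (r z).
    by rewrite ler_wpM2l //; apply/ltW/(rP z).2.
  by rewrite /p /w max_l ?mul0r // subr_le0 dC.
have Jsum (T : Type) (t : seq T) (f : T -> G -> R) (c : T -> R) :
    (forall z, continuous (f z)) ->
    continuous (fun x => \sum_(z <- t) c z * f z x) /\
    J (fun x => \sum_(z <- t) c z * f z x) = \sum_(z <- t) c z * J (f z).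
  move=> cf; elim: t => [|z t [ct Jt]].
    under eq_fun do rewrite big_nil; rewrite big_nil (mean_cst mJ).
    by split=> //; exact: cst_continuous.
  under eq_fun do rewrite big_cons; rewrite big_cons.
  have czf : continuous (fun x => c z * f z x).
    by move=> x; apply: continuousM; [exact: cst_continuous|exact: cf].
  split; first by move=> x; apply: (@continuousD _ _ _ (fun x => c z * f z x) (fun x => \sum_(z <- t) c z * f z x)); [exact: czf|exact: ct].
  rewrite (meanD mJ) ?(meanZ mJ) ?Jt //; do ?exact: continuous_bfun.
have jFs := joint_swap jF.
set S := \sum_(z <- s) J (p z) * J (F z).
have h1 : `|J (fun x => J (F x)) - S| <= e / 2.
  have [c1 E1] := Jsum _ s (fun z => p z) (fun z => J (F z)) cp.
  rewrite /S; under eq_bigr do rewrite mulrC; rewrite -E1.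
  apply: dist_mean_le => [|//|x]; first exact: joint_mean_continuous.
  have [c2 E2] := Jsum _ s F (fun z => p z x) (fun z => joint_l (x:=z) jF).
  under eq_bigr do rewrite mulrC; rewrite -E2.
  by apply: dist_mean_le => //; exact: joint_l.
have h2 : `|J (fun y => J (fun x => F x y)) - S| <= e / 2.
  have [c1 E1] := Jsum _ s F (fun z => J (p z)) (fun z => joint_l (x:=z) jF).
  rewrite /S -E1; apply: dist_mean_le => [|//|y]; first exact: joint_mean_continuous.
  have [c2 E2] := Jsum _ s p (fun z => F z y) cp.
  under eq_bigr do rewrite mulrC; rewrite -E2.
  apply: dist_mean_le => [||x //]; first exact: (joint_l (x:=y) jFs).
    exact: c2.
  by under eq_bigr do rewrite mulrC.
by rewrite -(subrKA S); apply: le_trans (ler_normD _ _) _; rewrite [X in _ + X]distrC; lra.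
Qed.

End mean_on_continuous.

Lemma joint_add (f : G -> R) : continuous f -> joint (fun g x => f (x + g)).
Proof.
move=> cf p; apply: (@continuous_comp _ _ _ (fun p : G * G => p.2 + p.1) f).
  apply: (@continuous_comp _ _ _ (fun p : G * G => (p.2, p.1)) (fun p : G * G => p.1 + p.2)).
    by apply: cvg_pair; [exact: cvg_snd|exact: cvg_fst].
  exact: add_continuous.
exact: cf.
Qed.

Lemma continuous_opp (f : G -> R) : continuous f -> continuous (fun x => f (- x)).
Proof.
move=> cf x; apply: (@continuous_comp _ _ _ -%R f); first exact: opp_continuous.
exact: cf.
Qed.

Lemma continuous_shift (f : G -> R) g : continuous f -> continuous (fun x => f (x + g)).
Proof. by move=> /joint_add/(joint_l (x := g)). Qed.

(** By compactness the sum of finitely many translates of [f] is at least [e] everywhere, and each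
    translate has mean [J f]. *)
Lemma invariant_mean_gt0 (J : (G -> R) -> R) (f : G -> R) x : mean J ->
  (forall (f : G -> R) g, continuous f -> J (fun x => f (x + g)) = J f) ->
  continuous f -> (forall y, 0 <= f y) -> 0 < f x -> 0 < J f.
Proof.
move=> mJ JT cf f0 fx; pose e := f x / 2; have e0 : 0 < e by rewrite /e; lra.
have /choice[r rP] : forall z, exists r : R, 0 < r /\
    forall y, d z y < r -> e < f (y + (x - z)).
  move=> z; have /(continuousPdist dN)/(_ z e e0)[r r0 H] := continuous_shift (g := x - z) cf.
  exists r; split=> // y /H; rewrite (_ : z + (x - z) = x); last by rewrite addrC subrK.
  move=> H'.
  by have := ler_norm (f x - f (y + (x - z))); move: H'; rewrite /e; lra.
have [s sP] := dist_net dC dN cG (fun z => (rP z).1).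
have [cs Js] : continuous (fun y => \sum_(z <- s) f (y + (x - z))) /\
    J (fun y => \sum_(z <- s) f (y + (x - z))) = (size s)%:R * J f.
  elim: s {sP} => [|z t [ct Jt]].
    under eq_fun do rewrite big_nil; rewrite (mean_cst mJ) mul0r.
    by split=> //; exact: cst_continuous.
  under eq_fun do rewrite big_cons.
  have cz := continuous_shift (g := x - z) cf.
  split.
    move=> y; apply: (@continuousD _ _ _ (fun y => f (y + (x - z)))
      (fun y => \sum_(z <- t) f (y + (x - z)))); [exact: cz|exact: ct].
  rewrite (meanD mJ) ?JT ?Jt //=; do ?exact: continuous_bfun.
  by rewrite -[in RHS]natr1 mulrDl mul1r addrC.
have : e <= (size s)%:R * J f.
  rewrite -Js -[e](mean_cst mJ); apply: (le_mean mJ); [exact: bfun_cst|exact: continuous_bfun|].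
  move=> y; have [z zs yz] := sP y; rewrite (big_rem z zs) /=.
  by rewrite ler_wpDr ?sumr_ge0 // ltW // (rP z).2 // dC.
have J0 : 0 <= J f by apply: (mean_ge0 mJ) => //; exact: continuous_bfun.
rewrite lt_def J0 andbT => le_e; apply/eqP => J_eq0.
by move: le_e; rewrite J_eq0 mulr0; lra.
Qed.

(** Translations by a dense sequence commute, so [invariant_markov] applies with equality for [e];
    uniform continuity extends the invariance to all of [G]. Averaging [J] with its reflection makes
    it even. *)
Theorem haar_exists : exists I, haar I.
Proof.
have [q q_dense] := dist_dense dC dN (0 : G) cG.
pose T n (x : G) := x + q n.
have eT n (x y : G) : x = y -> T n x = T n y by move=> ->.
have TC n m x : T n (T m x) = T m (T n x) by rewrite /T addrAC.
have [E [mE HE]] := @invariant_markov R G eq T eT TC.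
pose J f := E f 0; have mJ : mean J by exact: mE.
have Jq (f : G -> R) n : continuous f -> J (fun x => f (x + q n)) = J f.
  move=> cf; have [] := HE f (continuous_bfun cf); first by move=> x y ->.
  move=> _ ET ES; rewrite /J -[RHS](ET n).
  apply: (ES (T n)); split=> [x y ->//|m x]; exact: TC.
have JT (f : G -> R) g : continuous f -> J (fun x => f (x + g)) = J f.
  move=> cf; apply/eqP; rewrite -subr_eq0 -normr_le0; apply/ler_addgt0Pl => e e0.
  rewrite addr0; have [r r0 H] := joint_near g (joint_add cf) e0.
  have [n gn] := q_dense g r r0.
  rewrite -(Jq f n cf); apply: (dist_mean_le mJ) => [||x]; do ?exact: continuous_shift.
  by rewrite distrC; apply/ltW/H.
pose I f := (J f + J (fun x => f (- x))) / 2.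
have bopp (f : G -> R) : bfun f -> bfun (fun x => f (- x)).
  by move=> bf; exact: (bfun_comp -%R bf).
have mI : mean I.
  split=> [f g bf bg|c f bf|f bf f0|]; rewrite /I.
  - by rewrite !(meanD mJ) //; do ?exact: bopp; lra.
  - by rewrite !(meanZ mJ) //; do ?exact: bopp; lra.
  - by rewrite divr_ge0 // addr_ge0 // (mean_ge0 mJ) //; exact: bopp.
  - by rewrite !(mean1 mJ); lra.
have IT (f : G -> R) g : continuous f -> I (fun x => f (x + g)) = I f.
  move=> cf; rewrite /I JT //; congr ((_ + _) / _).
  rewrite -(JT (fun x => f (- x)) (- g)); last exact: continuous_opp.
  by congr J; apply/funext => x; rewrite opprD opprK.
exists I; split=> //.
- exact: continuous_bfun.
- by move=> F; exact: joint_mean_continuous.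
- move=> f cf; rewrite /I addrC; congr ((_ + _) / _).
  by congr J; apply/funext => x; rewrite opprK.
- by move=> F; exact: mean_fubini.
- by move=> f x; exact: invariant_mean_gt0.
Qed.

End haar.

(** * Convolution idempotents *)

Section convolution.
Variables (R : realType) (G : topologicalZmodType) (I : (G -> R) -> R).
Hypothesis hI : haar I.
Implicit Types f g h phi psi : G -> R.
Let mI := haar_mean hI.

Definition ip f g := I (fun x => f x * g x).
Definition conv f g : G -> R := fun x => I (fun y => f (x - y) * g y).
Definition shift (a : G) f : G -> R := fun x => f (x - a).
Definition even f := forall x, f (- x) = f x.

Lemma contM f g : continuous f -> continuous g -> continuous (fun x => f x * g x).
Proof. by move=> cf cg x; apply: continuousM; [exact: cf|exact: cg]. Qed.

Lemma contD f g : continuous f -> continuous g -> continuous (fun x => f x + g x).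
Proof. by move=> cf cg x; apply: continuousD; [exact: cf|exact: cg]. Qed.

Lemma contZ c f : continuous f -> continuous (fun x => c * f x).
Proof. by move=> cf; apply: contM => //; exact: cst_continuous. Qed.

Lemma joint_comp_sub f (u v : G * G -> G) : continuous f -> continuous u -> continuous v ->
  joint (fun x y => f (u (x, y) - v (x, y))).
Proof.
move=> cf cu cv p.
apply: (@continuous_comp _ _ _ (fun p => u (p.1, p.2) - v (p.1, p.2)) f); last exact: cf.
have -> : (fun p => u (p.1, p.2) - v (p.1, p.2)) = (fun p => u p - v p).
  by apply/funext => -[].
apply: (@continuous_comp _ _ _ (fun p => (u p, v p)) (fun p : G * G => p.1 - p.2)).
  by apply: cvg_pair; [exact: cu|exact: cv].
exact: sub_continuous.
Qed.

Lemma joint1 f : continuous f -> joint (fun x _ => f x).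
Proof.
move=> cf p; apply: (@continuous_comp _ _ _ fst f); last exact: cf.
exact: cvg_fst.
Qed.

Lemma joint2 f : continuous f -> joint (fun _ y => f y).
Proof.
move=> cf p; apply: (@continuous_comp _ _ _ snd f); last exact: cf.
exact: cvg_snd.
Qed.

Lemma joint_sub f : continuous f -> joint (fun x y => f (x - y)).
Proof.
move=> cf; apply: (@joint_comp_sub f fst snd) => // p; [exact: cvg_fst|exact: cvg_snd].
Qed.

Lemma jointM (F F' : G -> G -> R) : joint F -> joint F' -> joint (fun x y => F x y * F' x y).
Proof. by move=> jF jF' p; apply: continuousM; [exact: jF|exact: jF']. Qed.

Lemma joint_conv f g : continuous f -> continuous g -> joint (fun x y => f (x - y) * g y).
Proof. by move=> cf cg; apply: jointM; [exact: joint_sub|exact: joint2]. Qed.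

Lemma conv_continuous f g : continuous f -> continuous g -> continuous (conv f g).
Proof. by move=> cf cg; exact/(haar_joint hI)/joint_conv. Qed.

Lemma shift_continuous a f : continuous f -> continuous (shift a f).
Proof. by move=> cf; exact: continuous_shift. Qed.

Lemma haar_sub f x : continuous f -> I (fun y => f (x - y)) = I f.
Proof.
move=> cf; rewrite -(haarN hI cf) -[RHS](haarT hI (- x)); last exact: continuous_opp.
by congr I; apply/funext => y; rewrite opprD opprK addrC.
Qed.

Let bI f : continuous f -> bfun f := fun cf => haar_bfun hI cf.

Lemma convC f g : continuous f -> continuous g -> conv f g = conv g f.
Proof.
move=> cf cg; apply/funext => x; rewrite /conv -(haar_sub x); last first.
  exact: (joint_l (x := x) (joint_conv cf cg)).
by congr I; apply/funext => y; rewrite opprB addrC subrK mulrC.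
Qed.

Lemma conv0r f : conv f (fun=> 0) = fun=> 0.
Proof.
by apply/funext => x; rewrite /conv; under eq_fun do rewrite mulr0; rewrite (mean_cst mI).
Qed.

Lemma convDr f g h : continuous f -> continuous g -> continuous h ->
  conv f (fun x => g x + h x) = (fun x => conv f g x + conv f h x).
Proof.
move=> cf cg ch; apply/funext => x; rewrite /conv -(meanD mI).
- by congr I; apply/funext => y; rewrite mulrDr.
- exact/bI/(joint_l (x := x) (joint_conv cf cg)).
- exact/bI/(joint_l (x := x) (joint_conv cf ch)).
Qed.

Lemma convZr c f g : continuous f -> continuous g ->
  conv f (fun x => c * g x) = (fun x => c * conv f g x).
Proof.
move=> cf cg; apply/funext => x; rewrite /conv -(meanZ mI).
  by congr I; apply/funext => y; rewrite mulrCA.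
exact/bI/(joint_l (x := x) (joint_conv cf cg)).
Qed.

Lemma convA f g h : continuous f -> continuous g -> continuous h ->
  conv (conv f g) h = conv f (conv g h).
Proof.
move=> cf cg ch; apply/funext => x; rewrite /conv.
pose F z y := f (x - z) * (g (z - y) * h y).
have cfx : continuous (fun z => f (x - z)) by exact: (joint_l (x := x) (joint_sub cf)).
have jF : joint F.
  by apply: jointM; [exact: (joint1 cfx)|exact: joint_conv].
transitivity (I (fun z => I (F z))); last first.
  congr I; apply/funext => z; rewrite -(meanZ mI) //.
  exact/bI/(joint_l (x := z) (joint_conv cg ch)).
rewrite (haarF hI jF); congr I; apply/funext => y.
have cfg : continuous (fun z => f (x - y - z) * g z).
  exact: (joint_l (x := x - y) (joint_conv cf cg)).
rewrite mulrC -(meanZ mI); last exact: bI.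
rewrite -(haarT hI (- y)); last exact: contZ.
congr I; apply/funext => z; rewrite /F opprD opprK mulrC -mulrA.
by congr (f _ * _); rewrite [- z + _]addrC addrA subrK.
Qed.

Lemma ip_bfun f g : continuous f -> continuous g -> bfun (fun x => f x * g x).
Proof. by move=> cf cg; exact/bI/contM. Qed.

Lemma ipC f g : ip f g = ip g f.
Proof. by congr I; apply/funext => x; rewrite mulrC. Qed.

Lemma ipDl f g h : continuous f -> continuous g -> continuous h ->
  ip (fun x => f x + g x) h = ip f h + ip g h.
Proof.
move=> cf cg ch; rewrite /ip -(meanD mI); do ?exact: ip_bfun.
by congr I; apply/funext => x; rewrite mulrDl.
Qed.

Lemma ipZl c f g : continuous f -> continuous g -> ip (fun x => c * f x) g = c * ip f g.
Proof.
move=> cf cg; rewrite /ip -(meanZ mI); last exact: ip_bfun.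
by congr I; apply/funext => x; rewrite mulrA.
Qed.

Lemma ip0l f : ip (fun=> 0) f = 0.
Proof. by rewrite /ip; under eq_fun do rewrite mul0r; rewrite (mean_cst mI). Qed.

Lemma ip_ge0 f : continuous f -> 0 <= ip f f.
Proof.
move=> cf; apply: (mean_ge0 mI); first exact: ip_bfun.
by move=> x; rewrite -expr2 sqr_ge0.
Qed.

Lemma ip_eq0 f : continuous f -> ip f f = 0 -> f = fun=> 0.
Proof.
move=> cf f0; apply/funext => x; apply/eqP; apply: contraTT isT => fx.
have := @haar_gt0 _ _ _ hI (fun x => f x * f x) x (contM cf cf).
rewrite -/(ip f f) f0 ltxx => H; apply: H => [y|]; first by rewrite -expr2 sqr_ge0.
by rewrite -expr2 lt_def sqr_ge0 sqrf_eq0 fx.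
Qed.

Lemma ip_quadratic f g t : continuous f -> continuous g ->
  ip (fun x => f x + t * g x) (fun x => f x + t * g x) =
  ip f f + 2 * t * ip f g + t ^+ 2 * ip g g.
Proof.
move=> cf cg; have ctg := @contZ t _ cg; have cftg := contD cf ctg.
rewrite ipDl // ipZl // [ip f _]ipC [ip g (fun=> _)]ipC !ipDl // !ipZl // [ip g f]ipC.
by ring.
Qed.

Lemma cauchy_schwarz f g : continuous f -> continuous g ->
  ip f g ^+ 2 <= ip f f * ip g g.
Proof.
move=> cf cg; have [g0|g0] := eqVneq (ip g g) 0.
  by rewrite (ip_eq0 cg g0) ipC !ip0l mulr0 expr0n.
have gp : 0 < ip g g by rewrite lt_def g0 ip_ge0.
have := ip_ge0 (contD cf (contZ (c := - ip f g / ip g g) cg)).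
rewrite ip_quadratic //; set a := ip f f; set b := ip f g; set c := ip g g.
have -> : a + 2 * (- b / c) * b + (- b / c) ^+ 2 * c = (a * c - b ^+ 2) / c by field.
by rewrite pmulr_lge0 ?invr_gt0 // subr_ge0.
Qed.

Lemma ip_shift a f g : continuous f -> continuous g ->
  ip (shift a f) (shift a g) = ip f g.
Proof. by move=> cf cg; rewrite /ip -[RHS](haarT hI (- a)) //; exact: contM. Qed.

(** Values of a convolution become inner products, so that Cauchy-Schwarz gives the uniform bound
    [conv_le]. *)
Lemma conv_ip f g x : even f -> conv f g x = ip (shift x f) g.
Proof.
by move=> ef; congr I; apply/funext => y; rewrite -ef opprB.
Qed.

Lemma conv_le f g x : continuous f -> continuous g -> even f ->
  conv f g x ^+ 2 <= ip f f * ip g g.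
Proof.
move=> cf cg ef; rewrite conv_ip // -(ip_shift x cf cf).
by apply: cauchy_schwarz => //; exact: shift_continuous.
Qed.

Lemma conv_even f g : continuous f -> continuous g -> even f -> even g -> even (conv f g).
Proof.
move=> cf cg ef eg x; rewrite /conv -[RHS](haarN hI); last first.
  exact: (joint_l (x := x) (joint_conv cf cg)).
by congr I; apply/funext => y; rewrite eg -ef; congr (f _ * _); rewrite opprD opprK.
Qed.

Lemma shift_conv a f g : continuous f -> continuous g ->
  conv f (shift a g) = shift a (conv f g).
Proof.
move=> cf cg; apply/funext => x; rewrite /shift /conv -[RHS](haarT hI (- a)); last first.
  exact: (joint_l (x := x - a) (joint_conv cf cg)).
by congr I; apply/funext => y; rewrite opprB subrKA.
Qed.

(** Fubini, with evenness to exchange the arguments of the kernel: convolution by [phi] is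
    self-adjoint. *)
Lemma ip_conv phi f g : continuous phi -> continuous f -> continuous g -> even phi ->
  ip (conv phi f) g = ip f (conv phi g).
Proof.
move=> cp cf cg ep; rewrite /ip /conv.
pose F x y := phi (x - y) * f y * g x.
have jF : joint F by apply: jointM; [exact: joint_conv|exact: joint1].
transitivity (I (fun x => I (F x))).
  congr I; apply/funext => x; rewrite mulrC -(meanZ mI).
    by congr I; apply/funext => y; rewrite mulrC.
  exact/bI/(joint_l (x := x) (joint_conv cp cf)).
rewrite (haarF hI jF); congr I; apply/funext => y; rewrite -(meanZ mI); last first.
  exact/bI/(joint_l (x := y) (joint_conv cp cg)).
congr I; apply/funext => x; rewrite /F -ep opprB.
by ring.
Qed.

End convolution.

(** * Projections as limits of convolution powers *)

Section idempotents.
Variables (R : realType) (G : topologicalZmodType) (I : (G -> R) -> R).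
Hypothesis hI : haar I.
Implicit Types f g h phi psi : G -> R.
Local Notation ip := (ip I).
Local Notation conv := (conv I).
Let mI := haar_mean hI.
Let cC f g (cf : continuous f) (cg : continuous g) := conv_continuous hI cf cg.

Lemma conv_close f g g' B e x : continuous f -> continuous g -> continuous g' ->
  (forall y, `|f y| <= B) -> (forall y, `|g y - g' y| <= e) ->
  `|conv f g x - conv f g' x| <= B * e.
Proof.
move=> cf cg cg' fB ge; rewrite -(meanB mI); first last.
- exact/(haar_bfun hI)/(joint_l (x := x) (joint_conv cf cg')).
- exact/(haar_bfun hI)/(joint_l (x := x) (joint_conv cf cg)).
by apply: (norm_mean_le mI) => y; rewrite -mulrBr normrM ler_pM.
Qed.

(** The bound makes [u n x + b n] nonincreasing in [n] and bounded below, so the pointwise limit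
    exists by monotonicity; letting [m] grow makes it uniform. *)
Lemma uniform_limit (u : nat -> G -> R) (b : nat -> R) :
  (forall n, continuous (u n)) -> (forall n, 0 <= b n) ->
  (forall n m x, (n <= m)%N -> `|u n x - u m x| <= b n - b m) ->
  exists psi, continuous psi /\ exists2 v : nat -> R, v @ \oo --> 0 &
    forall n x, `|u n x - psi x| <= v n.
Proof.
move=> cu b0 ub; have bn : {homo b : n m / (n <= m)%N >-> n >= m}.
  by move=> n m nm; have := le_trans (normr_ge0 _) (ub n m 0 nm); rewrite subr_ge0.
have cb : cvgn b.
  by apply: nonincreasing_is_cvgn => //; exists 0 => _ [n _ <-].
have cub x : cvgn (fun n => u n x + b n).
  apply: nonincreasing_is_cvgn => [n m nm|].
    by have := ub n m x nm; rewrite ler_norml => /andP[]; lra.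
  exists (u 0%N x - b 0%N) => _ [n _ <-].
  have := ub 0%N n x (leq0n n); rewrite ler_norml => /andP[].
  by have := b0 n; lra.
pose psi x := limn (fun n => u n x + b n) - limn b.
have upsi x : u ^~ x @ \oo --> psi x.
  rewrite (_ : u ^~ x = (fun n => u n x + b n) \- b); first exact: cvgB.
  by apply/funext => n /=; rewrite addrK.
pose v n := b n - limn b.
have v0 : v @ \oo --> 0 by rewrite -(subrr (limn b)); apply: cvgB => //; exact: cvg_cst.
have uv n x : `|u n x - psi x| <= v n.
  have h1 : (fun m => `|u n x - u m x|) @ \oo --> `|u n x - psi x|.
    by apply: cvg_norm; apply: cvgB => //; exact: cvg_cst.
  have h2 : (fun m => b n - b m) @ \oo --> v n by apply: cvgB => //; exact: cvg_cst.
  rewrite -(cvg_lim _ h1) // -(cvg_lim _ h2) //.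
  apply: ler_lim.
  - by apply/cvg_ex; exists (`|u n x - psi x|).
  - by apply/cvg_ex; exists (v n).
  - by exists n => // m /= nm; exact: ub.
exists psi; split; last by exists v.
move=> x; apply/cvgrPdist_lt => e e0; have e3 : 0 < e / 3 by lra.
have [N _ /(_ N (leqnn N)) /= vN] : \forall n \near \oo, `|0 - v n| < e / 3.
  by move/cvgrPdist_lt: v0; apply.
move/cvgrPdist_lt: (cu N x) => /(_ _ e3); apply: filterS => y uxy.
have h1 := uv N x; have h2 := uv N y; rewrite sub0r normrN in vN.
have vN' := ler_norm (v N).
rewrite -(subrKA (u N x)) -[X in _ + X](subrKA (u N y)).
apply: le_lt_trans (ler_normD _ _) _; rewrite distrC.
by have := ler_normD (u N x - u N y) (u N y - psi y); lra.
Qed.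

Section contraction.
Variable kap : G -> R.
Hypotheses (ck : continuous kap) (ek : even kap)
  (kap_ge0 : forall f, continuous f -> 0 <= ip (conv kap f) f)
  (kap_le : forall f, continuous f -> ip (conv kap f) (conv kap f) <= ip f f)
  (kap_norm : forall t, t < 1 -> exists f, [/\ continuous f, 0 < ip f f &
    t * ip f f <= ip (conv kap f) (conv kap f)]).

Let A n f := iter n (conv kap) f.
(** The [n.+1]-fold convolution power, whence the shift of index in [conv_aa]. *)
Let a n := A n kap.

Let cA n f : continuous f -> continuous (A n f).
Proof. by move=> cf; elim: n => //= n IHn; exact: cC. Qed.

Let ca n : continuous (a n). Proof. exact: cA. Qed.

Let ea n : even (a n).
Proof. by elim: n => //= n IHn; apply: conv_even => //; exact: ca. Qed.

Let A_lin n f t g : continuous f -> continuous g ->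
  A n (fun x => f x + t * g x) = (fun x => A n f x + t * A n g x).
Proof.
move=> cf cg; elim: n => //= n ->.
rewrite convDr //; do ?exact: cA; last exact/contZ/cA.
by rewrite convZr //; exact: cA.
Qed.

Let A_shift n x f : continuous f -> A n (shift x f) = shift x (A n f).
Proof. by move=> cf; elim: n => //= n ->; rewrite shift_conv //; exact: cA. Qed.

Let A_le n f : continuous f -> ip (A n f) (A n f) <= ip f f.
Proof.
move=> cf; elim: n => //= n IHn; apply: le_trans IHn; exact/kap_le/cA.
Qed.

Let conv_a n f : continuous f -> conv (a n) f = A n.+1 f.
Proof. by move=> cf; elim: n => //= n <-; rewrite convA //; exact: ca. Qed.

Let conv_aa n m : conv (a n) (a m) = a (n + m).+1.
Proof. by rewrite conv_a // /a /A -iterD addSn. Qed.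

Let b n := ip (a n) (a n).

(** [a (n + n).+1 x] is the inner product of [a n] with its shift by [x]. As [A j] is a contraction,
    [ip f f - ip (A j f) (A j f)] is a nonnegative quadratic form; its values at the sum and the
    difference of the two vectors bound the change of their inner product. *)
Let a_close n m x : (n <= m)%N -> `|a (n + n).+1 x - a (m + m).+1 x| <= b n - b m.
Proof.
move=> nm; rewrite -(subnK nm); set j := (m - n)%N.
have aj : a (j + n) = A j (a n) by rewrite /a /A iterD.
rewrite -!conv_aa !conv_ip //; do ?exact: ea.
rewrite /b aj -A_shift //; set u := shift x (a n); set v := a n.
have cu : continuous u by exact: shift_continuous.
have cv : continuous v by exact: ca.
have Euu : ip u u = ip v v by exact: ip_shift.
have EAuu : ip (A j u) (A j u) = ip (A j v) (A j v).
  by rewrite A_shift //; apply: ip_shift => //; exact: cA.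
have Q t : 0 <= (ip u u + 2 * t * ip u v + t ^+ 2 * ip v v) -
    (ip (A j u) (A j u) + 2 * t * ip (A j u) (A j v) + t ^+ 2 * ip (A j v) (A j v)).
  rewrite -!ip_quadratic //; do ?exact: cA.
  rewrite -A_lin // subr_ge0; apply: A_le.
  by apply: contD => //; exact: contZ.
have := Q 1; have := Q (-1); rewrite Euu EAuu => h1 h2.
by rewrite ler_norml; apply/andP; split; lra.
Qed.

(** For an almost extremal [f] the squared norms [c k] of [A k f] are log-convex in [k], so their
    ratios stay at least [t]. As convolution by [a n] multiplies squared norms by at most [b n],
    this gives [t ^+ n.+1 <= b n] for every [t < 1]. *)
Let b_ge1 n : 1 <= b n.
Proof.
have bt t : 0 < t -> t < 1 -> t ^+ n.+1 <= b n.
  move=> t0 t1; have [f [cf f0 tf]] := kap_norm t1.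
  pose c k := ip (A k f) (A k f).
  have c_ge0 k : 0 <= c k by apply: ip_ge0 => //; exact: cA.
  have cc k : c k.+1 ^+ 2 <= c k * c k.+2.
    rewrite {1}/c /= -ip_conv //; do ?exact: cA; last exact/cC/cA.
    rewrite mulrC; apply: cauchy_schwarz => //; last exact: cA.
    exact/cC/cC/cA.
  have ct k : 0 < c k /\ t * c k <= c k.+1.
    elim: k => [|k [ck0 tk]]; first by [].
    have ck1 : 0 < c k.+1 by apply: lt_le_trans tk; rewrite mulr_gt0.
    split=> //; rewrite -(ler_pM2l ck0); apply: le_trans (cc k).
    by rewrite expr2 mulrA [c k * t]mulrC ler_pM2r.
  have tc k : t ^+ k * c 0%N <= c k.
    elim: k => [|k IHk]; first by rewrite mul1r.
    by apply: le_trans (ct k).2; rewrite exprS -mulrA ler_pM2l.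
  have : c n.+1 <= b n * c 0%N.
    rewrite /c -conv_a // -[leRHS](mean_cst mI); apply: (le_mean mI).
    - by apply: (ip_bfun hI); exact: cC.
    - exact: bfun_cst.
    - by move=> x; rewrite -expr2; exact: (conv_le hI).
  by move=> /(le_trans (tc n.+1)); rewrite ler_pM2r.
rewrite leNgt; apply/negP => b1.
have b0 : 0 <= b n by exact: ip_ge0.
pose s : R := (1 - b n) / (2 * n.+1%:R); pose t := 1 - s.
(* [s] is chosen so that Bernoulli's inequality makes [t ^+ n.+1] at least [1 - (1 - b n) / 2],
   which exceeds [b n]. *)
have n0 : 1 <= n.+1%:R :> R by rewrite ler1n.
have s0 : 0 < s by rewrite divr_gt0 ?mulr_gt0 //; lra.
have s1 : s < 1.
  rewrite ltr_pdivrMr ?mulr_gt0 // mul1r.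
  by move: n0; move: (n.+1%:R) => N; move: b0; move: (b n) => c; lra.
have t1 : t < 1 by rewrite /t; lra.
have t0 : 0 < t by rewrite /t; lra.
have bern k : 1 - k%:R * s <= t ^+ k.
  elim: k => [|k IHk]; first by rewrite mul0r subr0.
  rewrite exprS; apply: (@le_trans _ _ (t * (1 - k%:R * s))); last first.
    by rewrite ler_wpM2l //; exact: ltW.
  have : 0 <= k%:R * s * s by apply: mulr_ge0 (ltW s0); apply: mulr_ge0 (ltW s0); exact: ler0n.
  by rewrite -natr1 /t; move: (k%:R) => K; nra.
have := bern n.+1; move=> /le_trans/(_ (bt _ t0 t1)).
have -> : n.+1%:R * s = (1 - b n) / 2.
  by rewrite /s; field; rewrite gt_eqF //; lra.
lra.
Qed.

(* The even convolution powers of [kap] converge uniformly to the projection on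
   the fixed functions of [conv kap]. *)
Lemma fixed_idempotent : exists psi, [/\ continuous psi, even psi,
  conv psi psi = psi, 1 <= psi 0 & conv kap psi = psi].
Proof.
have b0 n : 0 <= b n by exact: le_trans (b_ge1 n).
have [psi [cpsi [v v0 uv]]] :=
  @uniform_limit (fun n => a (n + n).+1) b (fun n => @ca (n + n).+1) b0 a_close.
have upsi x : (fun n => a (n + n).+1 x) @ \oo --> psi x.
  apply/cvgrPdist_le => e e0; move/cvgrPdist_le: v0 => /(_ e e0); apply: filterS => n.
  by rewrite sub0r normrN distrC => h; apply: le_trans (uv n x) (le_trans (ler_norm _) h).
have conv_lim f x : continuous f ->
    (fun n => conv f (a (n + n).+1) x) @ \oo --> conv f psi x.
  move=> cf; have [B fB] := haar_bfun hI cf.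
  have Bv : (fun n => B * v n) @ \oo --> 0.
    by rewrite -(mulr0 B); apply: cvgM => //; exact: cvg_cst.
  apply/cvgrPdist_le => e e0; move/cvgrPdist_le: Bv => /(_ e e0); apply: filterS => n.
  rewrite sub0r normrN distrC => h; apply: le_trans (le_trans (ler_norm _) h).
  by apply: conv_close.
have a_odd n : conv (a (n + n).+1) psi = psi.
  apply/funext => x; have h := conv_lim _ x (@ca (n + n).+1).
  rewrite -(cvg_lim _ h) //; apply/cvg_lim => //.
  have := upsi x; rewrite -(cvg_shiftn n.+1) => h'.
  apply: cvg_trans h'; apply: near_eq_cvg; exists 0%N => // m _.
  by rewrite conv_aa; congr (a _.+1 x); lia.
have epsi : even psi.
  move=> x; rewrite -(cvg_lim _ (upsi x)) //; apply/esym/cvg_lim => //.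
  by have := upsi (- x); under eq_fun do rewrite (@ea _ x).
have psi1 : 1 <= psi 0.
  rewrite -(cvg_lim _ (upsi 0)) //; apply: limr_ge; first by apply/cvg_ex; exists (psi 0).
  apply: nearW => n; rewrite -conv_aa conv_ip; last exact: ea.
  rewrite (_ : shift 0 (a n) = a n); last by apply/funext => x; rewrite /shift subr0.
  exact: b_ge1.
have idem : conv psi psi = psi.
  apply/funext => x; have h := conv_lim _ x cpsi.
  rewrite -(cvg_lim _ h) //; under eq_fun do rewrite convC // a_odd.
  by apply: cvg_lim => //; exact: cvg_cst.
have kk : conv kap (conv kap psi) = psi.
  by have := a_odd 0%N; rewrite -[RHS]/psi conv_a.
(* The square of [conv kap] fixes [psi], so [w] satisfies [conv kap w = - w], and positivity of
   [conv kap] makes it vanish. *)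
pose w x := conv kap psi x + (-1) * psi x.
have ckp : continuous (conv kap psi) by exact: cC.
have cw : continuous w by apply: contD => //; exact: contZ.
have kw : conv kap w = fun x => (-1) * w x.
  rewrite /w convDr //; last exact: contZ.
  by rewrite kk convZr //; apply/funext => x; ring.
have w0 : w = fun=> 0.
  apply: (ip_eq0 hI cw); apply/eqP; rewrite eq_le ip_ge0 // andbT.
  by have := kap_ge0 cw; rewrite kw ipZl //; lra.
exists psi; split=> //; apply/funext => x.
by have := congr1 (fun f => f x) w0; rewrite /w; lra.
Qed.

End contraction.
End idempotents.

(** * Spectral projections and d'Alembert's functional equation *)

Section cosine_functions.
Variables (R : realType) (G : topologicalZmodType) (I : (G -> R) -> R).
Hypothesis hI : haar I.
Implicit Types f g h phi psi : G -> R.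
Local Notation ip := (ip I).
Local Notation conv := (conv I).
Let mI := haar_mean hI.
Let cC f g (cf : continuous f) (cg : continuous g) := conv_continuous hI cf cg.

Lemma convZl c f g : continuous f -> continuous g ->
  conv (fun x => c * f x) g = (fun x => c * conv f g x).
Proof.
move=> cf cg; rewrite convC ?convZr ?[conv f _]convC //; exact: contZ.
Qed.

Lemma convDl f g h : continuous f -> continuous g -> continuous h ->
  conv (fun x => f x + g x) h = (fun x => conv f h x + conv g h x).
Proof.
move=> cf cg ch; rewrite convC ?convDr ?[conv h _]convC //; last exact: contD.
Qed.

Lemma ipZr c f g : continuous f -> continuous g -> ip f (fun x => c * g x) = c * ip f g.
Proof. by move=> cf cg; rewrite ipC ipZl // ipC. Qed.

Lemma ip_conv_le f g : continuous f -> continuous g -> even f ->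
  ip (conv f g) (conv f g) <= ip f f * ip g g.
Proof.
move=> cf cg ef; rewrite -[leRHS](mean_cst mI); apply: (le_mean mI).
- by apply: (ip_bfun hI); exact: cC.
- exact: bfun_cst.
- by move=> x; rewrite -expr2; exact: (conv_le hI).
Qed.

Lemma ip_gt0 f x : continuous f -> f x != 0 -> 0 < ip f f.
Proof.
move=> cf fx; rewrite lt_def (ip_ge0 hI) // andbT; apply/eqP => /(ip_eq0 hI cf) f0.
by rewrite f0 eqxx in fx.
Qed.

Lemma conv0 f : even f -> conv f f 0 = ip f f.
Proof.
move=> ef; rewrite conv_ip //; congr I; apply/funext => x.
by rewrite /shift subr0.
Qed.

(* The top spectral projection of [conv phi ^ 2]. *)
Lemma even_idempotent phi x0 : continuous phi -> even phi -> phi x0 != 0 ->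
  exists psi mu, [/\ continuous psi, even psi, conv psi psi = psi, 1 <= psi 0 & 0 < mu] /\
    conv phi (conv phi psi) = fun x => mu * psi x.
Proof.
move=> cp ep px; have p0 := ip_gt0 cp px.
(* The supremum [mu] is the squared norm of convolution by [phi]; the kernel used below is
   [conv phi phi] because its operator is positive. *)
pose S := [set r | exists f, [/\ continuous f, 0 < ip f f &
  r = ip (conv phi f) (conv phi f) / ip f f]].
have Sub : has_sup S.
  split; first by exists (ip (conv phi phi) (conv phi phi) / ip phi phi), phi.
  by exists (ip phi phi) => _ [f [cf f0 ->]]; rewrite ler_pdivrMr // ip_conv_le.
pose mu := sup S.
have mu_ge f : continuous f -> ip (conv phi f) (conv phi f) <= mu * ip f f.
  move=> cf; have [f0|f0] := eqVneq (ip f f) 0.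
    have -> : conv phi f = fun=> 0.
      apply/funext => x; have : conv phi f x ^+ 2 <= 0.
        by rewrite -[leRHS](mulr0 (ip phi phi)) -f0; exact: (conv_le hI).
      by rewrite real_exprn_even_le0 ?num_real //= => /eqP.
    by rewrite f0 mulr0 ip0l.
  have fp : 0 < ip f f by rewrite lt_def f0 (ip_ge0 hI).
  by rewrite -ler_pdivrMr //; apply: (ub_le_sup Sub.2); exists f.
have mu0 : 0 < mu.
  have cpp := cC cp cp.
  have : 0 < ip (conv phi phi) (conv phi phi).
    by apply: (@ip_gt0 _ 0) => //; rewrite conv0 // gt_eqF.
  by move=> /lt_le_trans/(_ (mu_ge _ cp)); rewrite pmulr_lgt0.
pose kap x := mu^-1 * conv phi phi x.
have cpp := cC cp cp.
have ck : continuous kap by exact: contZ.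
have kapE f : continuous f -> conv kap f = fun x => mu^-1 * conv phi (conv phi f) x.
  by move=> cf; rewrite /kap convZl // convA.
have [psi [cpsi epsi ipsi psi1 kpsi]] : exists psi, [/\ continuous psi, even psi,
    conv psi psi = psi, 1 <= psi 0 & conv kap psi = psi].
  apply: (@fixed_idempotent _ _ _ hI kap) => //.
  - by move=> x; rewrite /kap conv_even.
  - move=> f cf; have cpf := cC cp cf.
    rewrite kapE // ipZl //; last exact: cC.
    by rewrite ip_conv // mulr_ge0 ?(ip_ge0 hI) // invr_ge0 ltW.
  - move=> f cf; have cpf := cC cp cf; have cppf := cC cp cpf.
    rewrite kapE // ipZl ?ipZr //; last exact: contZ.
    rewrite mulrA -expr2 exprVn mulrC ler_pdivrMr ?exprn_gt0 //.
    apply: le_trans (mu_ge _ cpf) _; rewrite expr2 mulrA [ip f f * _]mulrC.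
    by rewrite [X in X <= _]mulrC ler_pM2r //; exact: mu_ge.
  - move=> t t1; have [t0|t0] := leP t 0.
      exists phi; split=> //; apply: (@le_trans _ _ 0).
        by rewrite mulr_le0_ge0 // ltW.
      by apply: (ip_ge0 hI); exact: cC.
    (* For [f] with squared-norm ratio above [rho], self-adjointness and Cauchy-Schwarz give at
       least [rho ^+ 2] for two convolutions by [phi], and [((1 + t) / 2) ^+ 2] is at least [t]. *)
    pose rho := mu * ((1 + t) / 2).
    have rho_mu : rho < mu by rewrite gtr_pMr //; lra.
    have rho0 : 0 < rho by rewrite mulr_gt0 //; lra.
    have [_ [f [cf f0 ->]]] := sup_adherent (eps := mu - rho) ltac:(by rewrite subr_gt0) Sub.
    rewrite -/mu opprB addrC subrK ltr_pdivlMr // => rhof.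
    exists f; split=> //; have cpf := cC cp cf; have cppf := cC cp cpf.
    rewrite kapE // ipZl ?ipZr //; last exact: contZ.
    have := cauchy_schwarz hI cppf cf; rewrite ip_conv //.
    set N2 := ip (conv phi (conv phi f)) _; set N1 := ip (conv phi f) _ => h.
    rewrite mulrA -expr2 exprVn [leRHS]mulrC ler_pdivlMr ?exprn_gt0 //.
    rewrite -(ler_pM2r f0); apply: le_trans h.
    apply: (@le_trans _ _ ((rho * ip f f) ^+ 2)); last first.
      have rf : 0 < rho * ip f f by exact: mulr_gt0.
      by rewrite lerXn2r ?nnegrE ?(ltW rf) ?(ltW rhof) // ltW // (lt_trans rf).
    rewrite /rho; have : t <= ((1 + t) / 2) ^+ 2 by nra.
    move=> ht; have -> : t * ip f f * mu ^+ 2 * ip f f = t * (mu * ip f f) ^+ 2 by ring.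
    have -> : (mu * ((1 + t) / 2) * ip f f) ^+ 2 = ((1 + t) / 2) ^+ 2 * (mu * ip f f) ^+ 2 by ring.
    by rewrite ler_wpM2r // sqr_ge0.
exists psi, mu; split=> //; apply/funext => x.
have := congr1 (fun f => f x) kpsi; rewrite kapE // => <-.
by rewrite mulrA mulfV ?mul1r // gt_eqF.
Qed.

Definition idempotent psi := [/\ continuous psi, even psi & conv psi psi = psi].

(** [psi 0] is the trace of the projection [conv psi] and equals [ip psi psi]. As [psi y ^+ 2] is at
    most [psi 0 ^+ 2], integration gives [psi 0 <= psi 0 ^+ 2]. *)
Lemma idempotent_ge1 psi x : idempotent psi -> psi x != 0 -> 1 <= psi 0.
Proof.
move=> [cpsi epsi ipsi] px; have p0 := ip_gt0 cpsi px.
have N0 : ip psi psi = psi 0 by rewrite -conv0 // ipsi.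
rewrite N0 in p0; have : ip psi psi <= psi 0 * psi 0.
  rewrite -[leRHS](mean_cst mI); apply: (le_mean mI).
  - exact: (ip_bfun hI).
  - exact: bfun_cst.
  - by move=> y; have := conv_le hI y cpsi cpsi epsi; rewrite ipsi N0 expr2.
by rewrite N0 -{1}[psi 0]mul1r ler_pM2r.
Qed.

Lemma idempotent_sub psi0 psi : idempotent psi0 -> idempotent psi ->
  conv psi0 psi = psi -> idempotent (fun x => psi0 x + (-1) * psi x).
Proof.
move=> [c0 e0 i0] [c1 e1 i1] i01; have c2 := contZ (c := -1) c1.
split; first exact: contD; first by move=> x; rewrite e0 e1.
rewrite convDl ?convDr ?convZl ?convZr ?convDr ?convZr //; last exact: contD.
rewrite i0 i1 i01 [conv psi _]convC // i01; apply/funext => x; ring.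
Qed.

(* If some [g] violates the conclusion for [psi0], a spectral projection of
   [2 psi0 + shift g psi0 + shift (- g) psi0] is an idempotent properly below
   [psi0], and the value at [0] drops by at least [1]. *)
Lemma cosine_idempotent psi0 : idempotent psi0 -> 1 <= psi0 0 ->
  exists psi, [/\ idempotent psi, 1 <= psi 0, conv psi0 psi = psi &
    forall a : G, exists c : R, forall x, psi (x - a) + psi (x + a) = c * psi x].
Proof.
have [n] : exists n : nat, psi0 0 < n%:R.
  exists (Num.bound `|psi0 0|).
  exact: le_lt_trans (ler_norm _) (archi_boundP (normr_ge0 _)).
elim: n psi0 => [|n IHn] psi0 psin idem0 psi1; first by lra.
have [c0 e0 i0] := idem0.
have [all_c|] := pselect (forall a : G, exists c : R, forall x,
  psi0 (x - a) + psi0 (x + a) = c * psi0 x); first by exists psi0.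
move=> /existsNP[g nc].
(* On the range of [psi0] this kernel acts as the sum of [2] and the two shifts, a positive
   operator: its form at [u] is the squared norm of [u + shift g u]. It is nonzero, as otherwise
   [c = -2] would serve for [g]. *)
pose phi x := (2 * psi0 x + shift g psi0 x) + shift (- g) psi0 x.
have cs a f : continuous f -> continuous (shift a f).
  by move=> cf; exact: shift_continuous.
have cphi : continuous phi.
  by apply: contD; [apply: contD; [exact: contZ|exact: cs]|exact: cs].
have convphi f : continuous f -> conv phi f =
    fun x => (2 * conv psi0 f x + shift g (conv psi0 f) x) + shift (- g) (conv psi0 f) x.
  move=> cf; have cz := contZ (c := 2) c0.
  have cg := cs g _ c0; have cg' := cs (- g) _ c0.
  rewrite /phi (convDl (contD cz cg) cg' cf) (convDl cz cg cf) convZl //.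
  by rewrite ![conv (shift _ _) _]convC // !shift_conv // [conv f psi0]convC.
have ephi : even phi.
  move=> x; rewrite /phi /shift e0 -[psi0 (- x - g)]e0 -[psi0 (- x - - g)]e0.
  by rewrite !opprD !opprK addrAC.
have [x phix] : exists x, phi x != 0.
  apply: contrapT => /forallNP phi0; apply: nc; exists (-2) => x.
  have /negP := phi0 x; rewrite negbK => /eqP.
  by rewrite /phi /shift opprK; lra.
have [psi [mu [[cpsi epsi ipsi psi_ge1 mu0] phipsi]]] := even_idempotent cphi ephi phix.
have psi0phi : conv psi0 phi = phi.
  rewrite convC // convphi // i0; apply/funext => y; rewrite /phi; ring.
have psi0psi : conv psi0 psi = psi.
  have h : conv psi0 (fun x => mu * psi x) = fun x => mu * psi x.
    by rewrite -phipsi -convA ?psi0phi //; exact: cC.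
  apply/funext => y; have := congr1 (fun f => f y) h; rewrite convZr //.
  by move/mulfI; apply; rewrite gt_eqF.
have idem : idempotent psi by [].
(* If [psi = psi0], then [conv phi phi = mu * psi0]; positivity forces [phi = Num.sqrt mu * psi0],
   and [c = Num.sqrt mu - 2] would serve for [g]. *)
have [y psiy] : exists y, psi0 y + (-1) * psi y != 0.
  apply: contrapT => /forallNP eq0; apply: nc.
  have psiE : psi = psi0.
    apply/funext => y; have /negP := eq0 y; rewrite negbK => /eqP; lra.
  rewrite {}psiE in phipsi; have phiphi : conv phi phi = fun x => mu * psi0 x.
    by rewrite -phipsi; congr conv; rewrite convC.
  pose s := Num.sqrt mu; have s0 : 0 < s by rewrite sqrtr_gt0.
  have ss : s * s = mu by rewrite -expr2 sqr_sqrtr // ltW.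
  pose u x := phi x + (- s) * psi0 x.
  have cz : continuous (fun x => - s * psi0 x) by exact: contZ.
  have cu : continuous u by exact: contD.
  have psi0u : conv psi0 u = u by rewrite /u convDr // psi0phi convZr // i0.
  have phiu : conv phi u = fun x => (- s) * u x.
    rewrite /u convDr // phiphi convZr // [conv phi _]convC // psi0phi.
    by apply/funext => z; rewrite -ss; ring.
  have cgu := cs g _ cu; have cgu' := cs (- g) _ cu.
  have : 0 <= ip (conv phi u) u.
    have -> : ip (conv phi u) u = ip (fun x => u x + 1 * shift g u x)
                                     (fun x => u x + 1 * shift g u x).
      have c2u := contZ (c := 2) cu.
      rewrite ip_quadratic // ip_shift // convphi // psi0u.
      rewrite (ipDl hI (contD c2u cgu) cgu' cu) (ipDl hI c2u cgu cu) ipZl //.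
      have -> : ip (shift (- g) u) u = ip u (shift g u).
        rewrite -(ip_shift hI g cgu' cu); congr (ip _ _).
        by apply/funext => z; rewrite /shift opprK subrK.
      by rewrite [ip (shift g u) u]ipC; ring.
    by apply: (ip_ge0 hI); apply: contD => //; exact: contZ.
  rewrite phiu ipZl // => Nu.
  have u0 : u = fun=> 0.
    apply: (ip_eq0 hI cu); apply/eqP; rewrite eq_le (ip_ge0 hI) // andbT.
    by rewrite -(ler_pM2l s0) mulr0; lra.
  exists (s - 2) => z; have := congr1 (fun f => f z) u0.
  by rewrite /u /phi /shift opprK; lra.
have := idempotent_ge1 (idempotent_sub idem0 idem psi0psi) psiy => drop.
have [|psi' [i' p' pp' c']] := IHn psi _ idem psi_ge1.
  by move: psin; rewrite -natr1; lra.
exists psi'; split=> //; rewrite -pp' -convA ?psi0psi //; by case: i'.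
Qed.

End cosine_functions.

(** * Characters and trigonometric polynomials *)

Section characters.
Variables (R : realType) (G : topologicalZmodType) (I : (G -> R) -> R).
Hypothesis hI : haar I.
Implicit Types f h phi psi t p : G -> R.
Local Notation ip := (ip I).
Local Notation conv := (conv I).
Local Notation idempotent := (idempotent I).
Let mI := haar_mean hI.
Let cC f g (cf : continuous f) (cg : continuous g) := conv_continuous hI cf cg.

Record character (chi : G -> R[i]) : Prop := {
  characterD : forall x y, chi (x + y) = chi x * chi y;
  character_norm : forall x, `|chi x| = 1;
  character_Re : continuous (fun x => complex.Re (chi x));
  character_Im : continuous (fun x => complex.Im (chi x)) }.

Lemma norm1_complex (a b : R) : a ^+ 2 + b ^+ 2 = 1 -> `|(a +i* b)%C| = 1.
Proof. by move=> ab; rewrite normc_def /= ab sqrtr1. Qed.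

(* For [s x = (kap (x - a) - kap (x + a)) / (2 sigma)] with
   [sigma ^ 2 = 1 - kap a ^ 2], the function [kap + i s] is multiplicative. *)
Lemma cosine_character (kap : G -> R) : continuous kap -> kap 0 = 1 ->
  (forall x, `|kap x| <= 1) ->
  (forall x y, kap (x + y) + kap (x - y) = 2 * kap x * kap y) ->
  exists2 chi, character chi & forall x, complex.Re (chi x) = kap x.
Proof.
move=> ck k0 k1 kk.
have kN x : kap (- x) = kap x by have := kk 0 x; rewrite add0r sub0r k0; lra.
suff [s [cs sN ss sD]] : exists s : G -> R, [/\ continuous s, forall x, s (- x) = - s x,
    forall x y, s x * s y = (kap (x - y) - kap (x + y)) / 2 &
    forall x y, 2 * (s x * kap y) = s (x + y) + s (x - y)].
  exists (fun x => (kap x +i* s x)%C) => //; split=> //= [x y|x].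
    have E1 : kap (x + y) = kap x * kap y - s x * s y.
      by rewrite ss; have := kk x y; lra.
    have E2 : s (x + y) = kap x * s y + s x * kap y.
      have := sD x y; have := sD y x.
      by rewrite [y + x]addrC -[y - x]opprB sN; lra.
    by rewrite E1 E2.
  apply: norm1_complex; rewrite !expr2 ss subrr k0.
  by have := kk x x; rewrite subrr k0; lra.
(* If [kap] only takes the values [1] and [-1], every [sigma] is zero; but then [kap] is itself
   multiplicative and [s = 0] works. *)
have [k2|] := pselect (forall x, kap x ^+ 2 = 1).
  exists (fun=> 0); split=> [||x y|x y]; do ?[by move=> ?; rewrite oppr0].
  - exact: cst_continuous.
  - have := k2 (x + y); have := k2 (x - y); have := kk x y.
    have := k2 x; have := k2 y; rewrite mul0r.
    set a := kap (x + y); set b := kap (x - y); set c := kap x; set e := kap y.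
    move=> e2 c2 abce b2 a2.
    have ab4 : (a + b) ^+ 2 = 4 by rewrite abce !exprMn c2 e2; ring.
    have /eqP : (a - b) ^+ 2 = 0.
      have -> : (a - b) ^+ 2 = 2 * a ^+ 2 + 2 * b ^+ 2 - (a + b) ^+ 2 by ring.
      by rewrite ab4 a2 b2; ring.
    by rewrite sqrf_eq0 => /eqP; lra.
  - by rewrite mul0r mulr0 addr0.
move=> /existsNP[a /eqP ka]; pose sig := Num.sqrt (1 - kap a ^+ 2).
have ka1 : kap a ^+ 2 < 1.
  rewrite lt_neqAle ka /= -[leRHS](expr1n _ 2) -real_normK ?num_real //.
  by rewrite lerXn2r ?nnegrE.
have sig2 : sig ^+ 2 = 1 - kap a ^+ 2 by rewrite sqr_sqrtr //; lra.
have sig0 : 0 < sig by rewrite sqrtr_gt0; lra.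
pose s x := (2 * sig)^-1 * (kap (x - a) + (-1) * kap (x + a)).
have sE x : 2 * sig * s x = kap (x - a) - kap (x + a).
  by rewrite /s mulrA mulfV ?mul1r ?mulN1r // mulf_neq0 // gt_eqF.
exists s; split=> [|x|x y|x y].
- apply: contZ; apply: contD; first exact: (continuous_shift (g := - a)).
  by apply: contZ; exact: continuous_shift.
- rewrite /s -(kN (- x - a)) -(kN (- x + a)) !opprD !opprK; lra.
(* [P] turns products of values of [kap] into sums; what remains follows from
   [kap (a + a) = 2 * kap a ^+ 2 - 1]. *)
- apply: (@mulfI _ (4 * sig ^+ 2)); first by rewrite mulf_neq0 // gt_eqF // exprn_gt0.
  have -> : 4 * sig ^+ 2 * (s x * s y) = (2 * sig * s x) * (2 * sig * s y) by ring.
  rewrite !sE sig2.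
  have P u v : kap u * kap v = (kap (u + v) + kap (u - v)) / 2.
    by have := kk u v; lra.
  have -> : (kap (x - a) - kap (x + a)) * (kap (y - a) - kap (y + a)) =
    kap (x - a) * kap (y - a) - kap (x - a) * kap (y + a) -
    kap (x + a) * kap (y - a) + kap (x + a) * kap (y + a) by ring.
  rewrite !P.
  have -> : x - a + (y - a) = (x + y) - (a + a) by rewrite opprD addrACA.
  have -> : x - a - (y - a) = x - y by rewrite opprB subrKA.
  have -> : x - a + (y + a) = x + y by rewrite [y + a]addrC addrA subrK.
  have -> : x - a - (y + a) = (x - y) - (a + a) by rewrite !opprD addrACA.
  have -> : x + a + (y - a) = x + y by rewrite addrACA subrr addr0.
  have -> : x + a - (y - a) = (x - y) + (a + a) by rewrite opprB [a - y]addrC addrACA.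
  have -> : x + a + (y + a) = (x + y) + (a + a) by rewrite addrACA.
  have -> : x + a - (y + a) = x - y by rewrite opprD addrACA subrr addr0.
  have := kk (x + y) (a + a); have := kk (x - y) (a + a).
  have := kk a a; rewrite subrr k0 expr2.
  set A := kap (a + a); set B := kap a => hA.
  have -> : A = 2 * B * B - 1 by lra.
  move: (kap (x + y)) (kap (x - y)) (kap (x + y + (a + a))) (kap (x + y - (a + a)))
    (kap (x - y + (a + a))) (kap (x - y - (a + a))) => z w z1 z2 w1 w2 h1 h2.
  by nra.
- apply: (@mulfI _ (2 * sig)); first by rewrite mulf_neq0 // gt_eqF.
  have -> : 2 * sig * (2 * (s x * kap y)) = 2 * (2 * sig * s x) * kap y by ring.
  rewrite mulrDr !sE.
  have h1 := kk (x - a) y; have h2 := kk (x + a) y.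
  have -> : x + y - a = x - a + y by rewrite addrAC.
  have -> : x + y + a = x + a + y by rewrite addrAC.
  have -> : x - y - a = x - a - y by rewrite addrAC.
  have -> : x - y + a = x + a - y by rewrite addrAC.
  by nra.
Qed.

Inductive trig : (G -> R) -> Prop :=
| trig0 : trig (fun=> 0)
| trigS a b chi t : character chi -> trig t ->
    trig (fun x => a * complex.Re (chi x) + b * complex.Im (chi x) + t x).

Lemma trig_continuous t : trig t -> continuous t.
Proof.
elim=> [|a b chi {}t [_ _ cR cI] _ ct]; first exact: cst_continuous.
by apply: contD => //; apply: contD; exact: contZ.
Qed.

Lemma trigD t t' : trig t -> trig t' -> trig (fun x => t x + t' x).
Proof.
elim=> [|a b chi {}t chichi _ IHt] tt'.
  by rewrite (_ : (fun _ => _) = t') //; apply/funext => x; rewrite add0r.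
rewrite (_ : (fun _ => _) = (fun x => a * complex.Re (chi x) + b * complex.Im (chi x) +
   (t x + t' x))); first by apply: trigS => //; exact: IHt.
by apply/funext => x; rewrite addrA.
Qed.

Lemma trigZ c t : trig t -> trig (fun x => c * t x).
Proof.
elim=> [|a b chi {}t chichi _ IHt].
  by rewrite (_ : (fun _ => _) = fun=> 0); [exact: trig0|apply/funext => x; rewrite mulr0].
rewrite (_ : (fun _ => _) = (fun x => (c * a) * complex.Re (chi x) +
   (c * b) * complex.Im (chi x) + c * t x)); first exact: trigS.
by apply/funext => x; rewrite !mulrDr !mulrA.
Qed.

Lemma characterN chi x : character chi -> chi (- x) = (chi x)^*.
Proof.
move=> cchi; have chi0 : chi 0 = 1.
  have := characterD cchi 0 0; rewrite addr0 => /esym/eqP.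
  rewrite -[X in _ == X]mulr1 -subr_eq0 -mulrBr mulf_eq0 -normr_eq0 (character_norm cchi).
  by rewrite oner_eq0 subr_eq0 => /eqP.
have := characterD cchi x (- x); rewrite subrr chi0 => /esym h.
have cx : chi x != 0 by rewrite -normr_eq0 (character_norm cchi) oner_eq0.
rewrite -[RHS]mul1r -[X in X * _]h mulrAC -normCK (character_norm cchi) expr1n mul1r.
by [].
Qed.

(** Characters are eigenfunctions of convolution; [A] and [B] are the integrals of [f] against the
    real and imaginary parts of [chi]. *)
Lemma trig_conv f t : continuous f -> trig t -> trig (conv f t).
Proof.
move=> cf; elim=> [|a b chi {}t cchi tt IHt].
  by rewrite (conv0r hI); exact: trig0.
have [_ _ cR cI] := cchi; have ct := trig_continuous tt.
pose A := I (fun y => f y * complex.Re (chi y)).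
pose B := I (fun y => f y * complex.Im (chi y)).
rewrite (_ : conv f _ = (fun x => (a * A - b * B) * complex.Re (chi x) +
   (a * B + b * A) * complex.Im (chi x) + conv f t x)); first exact: trigS.
have caR := contZ (c := a) cR; have cbI := contZ (c := b) cI.
rewrite (convDr hI cf (contD caR cbI) ct) (convDr hI cf caR cbI).
rewrite !(convZr hI) //; apply/funext => x; congr (_ + _).
have E y : chi (x - y) = chi x * (chi y)^* by rewrite (characterD cchi) characterN.
have bR : bfun (fun y => f y * complex.Re (chi y)) by exact: (ip_bfun hI).
have bI : bfun (fun y => f y * complex.Im (chi y)) by exact: (ip_bfun hI).
have ER : conv f (fun y => complex.Re (chi y)) x =
    complex.Re (chi x) * A + complex.Im (chi x) * B.
  rewrite convC // -!(meanZ mI) // -(meanD mI); do ?exact: bfunZ.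
  congr I; apply/funext => y; rewrite E.
  by case: (chi x) => c s; case: (chi y) => c' s' /=; ring.
have EI : conv f (fun y => complex.Im (chi y)) x =
    complex.Im (chi x) * A + (- complex.Re (chi x)) * B.
  rewrite convC // -!(meanZ mI) // -(meanD mI); do ?exact: bfunZ.
  congr I; apply/funext => y; rewrite E.
  by case: (chi x) => c s; case: (chi y) => c' s' /=; ring.
by rewrite ER EI; ring.
Qed.

(** A cosine idempotent [psi] is taken below the spectral projection [psi0] of [phi]. There the
    square of [conv phi] acts as [mu > 0], so [conv phi psi] cannot vanish, and [psi] is a multiple
    of the real part of a character. *)
Lemma trig_idempotent_nonnull phi x : continuous phi -> even phi -> phi x != 0 ->
  exists psi, [/\ idempotent psi, trig psi & exists y, conv phi psi y != 0].
Proof.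
move=> cp ep px.
have [psi0 [mu [[c0 e0 i0 p0 mu0] phipsi0]]] := even_idempotent hI cp ep px.
have [psi [idem psi1 p0psi cosine]] := @cosine_idempotent _ _ _ hI psi0 (And3 c0 e0 i0) p0.
have [cpsi epsi ipsi] := idem.
have psi0n0 : psi 0 != 0 by rewrite gt_eqF //; lra.
exists psi; split=> //.
  pose kap x := (psi 0)^-1 * psi x.
  have [|||chi cchi Rchi] := @cosine_character kap (contZ cpsi).
  - by rewrite /kap mulVf.
  - move=> y; rewrite /kap normrM normfV ler_pdivrMl ?normr_gt0 // mulr1.
    rewrite -ler_sqr ?nnegrE // !real_normK ?num_real //.
    have N0 : ip psi psi = psi 0 by rewrite -(conv0 I epsi) ipsi.
    by have := conv_le hI y cpsi cpsi epsi; rewrite ipsi N0 expr2.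
  (* The relation at [0] determines [c], which turns it into d'Alembert's equation for [kap]. *)
  - move=> y a; have [c H] := cosine a.
    have := H 0; rewrite sub0r add0r epsi => H0.
    have := H y; rewrite /kap -(mulrDr (psi 0)^-1) [psi (y + a) + _]addrC => ->.
    have -> : c = 2 * psi a / psi 0 by rewrite mulr_natl mulr2n H0 mulfK.
    by field.
  rewrite (_ : psi = (fun x => psi 0 * complex.Re (chi x) + 0 * complex.Im (chi x) + 0)).
    by apply: trigS => //; exact: trig0.
  by apply/funext => y; rewrite Rchi mul0r !addr0 /kap mulrA mulfV ?mul1r.
apply: contrapT => /forallNP H.
have phipsi : conv phi psi = fun=> 0.
  by apply/funext => y; have /negP := H y; rewrite negbK => /eqP.
have : conv phi (conv phi psi) = fun x => mu * psi x.
  rewrite -{1}p0psi -(convA hI cp c0 cpsi) -(convA hI cp (cC cp c0) cpsi) phipsi0.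
  by rewrite (convZl hI mu c0 cpsi) p0psi.
rewrite phipsi (conv0r hI) => /(congr1 (fun f => f 0))/esym/eqP.
by rewrite mulf_eq0 (negbTE psi0n0) orbF gt_eqF.
Qed.

End characters.

(** * Completeness of the trigonometric idempotents *)

Section density.
Variables (R : realType) (G : topologicalZmodType) (I : (G -> R) -> R).
Hypothesis hI : haar I.
Implicit Types f h phi psi t p q : G -> R.
Local Notation ip := (ip I).
Local Notation conv := (conv I).
Local Notation idempotent := (idempotent I).
Let cC f g (cf : continuous f) (cg : continuous g) := conv_continuous hI cf cg.

Definition residue p h x := h x + (-1) * conv p h x.

Lemma residue_continuous p h : continuous p -> continuous h -> continuous (residue p h).
Proof. by move=> cp ch; apply: contD => //; exact/contZ/cC. Qed.

Lemma residue_even p h : continuous p -> continuous h -> even p -> even h ->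
  even (residue p h).
Proof. by move=> cp ch ep eh x; rewrite /residue eh conv_even. Qed.

Lemma conv_residue p h : idempotent p -> continuous h -> conv p (residue p h) = fun=> 0.
Proof.
move=> [cp ep ip'] ch; have cph := cC cp ch.
rewrite /residue (convDr hI cp ch (contZ cph)) (convZr hI (-1) cp cph).
by rewrite -(convA hI) // ip'; apply/funext => x; ring.
Qed.

Lemma ip_residue p h : idempotent p -> continuous h ->
  ip (residue p h) (residue p h) = ip h h - ip (conv p h) (conv p h).
Proof.
move=> idp ch; have [cp ep pp] := idp; have cph := cC cp ch.
have cr := residue_continuous cp ch.
rewrite {1}/residue (ipDl hI ch (contZ cph) cr) (ipZl hI _ cph cr).
rewrite (ip_conv hI cp ch cr ep) conv_residue // (ipC _ h (fun=> 0)) (ip0l hI).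
rewrite mulr0 addr0 ipC /residue (ipDl hI ch (contZ cph) ch) (ipZl hI _ cph ch).
by rewrite -{1}pp (convA hI) // (ip_conv hI cp cph ch ep); ring.
Qed.

(** [p + q - conv p q], the projection onto the sum of the ranges when [p] and [q] are
    idempotent. *)
Definition join p q x := p x + residue p q x.

Lemma residueC p q h : continuous p -> continuous q -> continuous h ->
  conv (residue p q) h = residue p (conv q h).
Proof.
move=> cp cq ch; have cpq := cC cp cq.
by rewrite /residue (convDl hI cq (contZ cpq) ch) (convZl hI _ cpq ch) (convA hI).
Qed.

Lemma residue_swap p q h : continuous p -> continuous q -> continuous h ->
  residue p (residue q h) = residue q (residue p h).
Proof.
move=> cp cq ch; have cph := cC cp ch; have cqh := cC cq ch.
rewrite /residue (convDr hI cp ch (contZ cqh)) (convZr hI _ cp cqh).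
rewrite (convDr hI cq ch (contZ cph)) (convZr hI _ cq cph).
rewrite -!(convA hI) // (convC hI cq cp); apply/funext => x; ring.
Qed.

Lemma residue_join p q h : continuous p -> continuous q -> continuous h ->
  residue (join p q) h = residue q (residue p h).
Proof.
move=> cp cq ch; have cr := residue_continuous cp cq; have cph := cC cp ch.
apply/funext => x; rewrite {1}/residue /join (convDl hI cp cr ch) residueC //.
rewrite [in RHS]/residue (_ : conv q (residue p h) = residue p (conv q h)).
  by rewrite /residue; ring.
rewrite /residue (convDr hI cq ch (contZ cph)) (convZr hI _ cq cph).
by apply/funext => y; rewrite -(convA hI) // (convC hI cq cp) (convA hI).
Qed.

Lemma idempotent_join p q : idempotent p -> idempotent q -> idempotent (join p q).
Proof.
move=> idp idq; have [cp ep pp] := idp; have [cq eq qq] := idq.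
have cr := residue_continuous cp cq; have cpq := cC cp cq.
have cj : continuous (join p q) by exact: contD.
split=> //; first by move=> x; rewrite /join ep residue_even.
have -> : conv (join p q) (join p q) = fun x => join p q x + (-1) * residue (join p q) (join p q) x.
  by apply/funext => x; rewrite /residue; ring.
rewrite residue_join // (_ : residue p (join p q) = residue p q).
  rewrite (_ : residue q _ = fun=> 0); last first.
    apply/funext => x; rewrite /residue -/(residue p q) (convC hI cq cr) residueC // qq.
    by rewrite /residue; ring.
  by apply/funext => x; rewrite mulr0 addr0.
apply/funext => x; rewrite {1}/residue (convDr hI cp cp cr) pp conv_residue //.
by rewrite /join; ring.
Qed.

Lemma trig_join p q : continuous p -> trig p -> trig q -> trig (join p q).
Proof.
move=> cp tp tq; apply: trigD => //; apply: trigD => //; apply: trigZ.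
exact: (trig_conv hI).
Qed.

Lemma conv_residue_residue p h : idempotent p -> continuous h ->
  conv (residue p h) (residue p h) = residue p (conv h h).
Proof.
move=> idp ch; have [cp ep pp] := idp; have cr := residue_continuous cp ch.
rewrite residueC // (convC hI ch cr) residueC //.
have chh := cC ch ch; apply/funext => x.
by rewrite {1}/residue conv_residue //; ring.
Qed.

(* Joining a minimizing sequence makes the squares [conv (w n) (w n)] of the
   residues converge uniformly to some [phi] with [phi 0 > 0] that is killed by
   every trigonometric idempotent. *)
Lemma residue_small h e : continuous h -> even h -> 0 < e ->
  exists p, [/\ idempotent p, trig p & ip (residue p h) (residue p h) < e].
Proof.
move=> ch eh e0.
pose N p := ip (residue p h) (residue p h).
pose V := [set r | exists p, [/\ idempotent p, trig p & r = N p]].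
have id0 : idempotent (fun=> 0).
  by split=> //; [exact: cst_continuous|exact: (conv0r hI)].
have V_inf : has_inf V.
  split; first by exists (N (fun=> 0)), (fun=> 0); split=> //; exact: trig0.
  exists 0 => _ [p [[cp _ _] _ ->]]; apply: (ip_ge0 hI).
  exact: residue_continuous.
pose s := inf V.
have s_le p : idempotent p -> trig p -> s <= N p.
  by move=> ? ?; apply: (ge_inf V_inf.2); exists p.
have s_ge0 : 0 <= s.
  apply: lb_le_inf; first exact: V_inf.1.
  move=> _ [p [[cp _ _] _ ->]]; apply: (ip_ge0 hI); exact: residue_continuous.
have [s_lt|s_ge] := ltP s e.
  have [|_ [p [idp tp ->]]] := inf_adherent (eps := e - s) _ V_inf; first by rewrite subr_gt0.
  by rewrite -/s addrC subrK => Np; exists p.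
exfalso.
have /choice[p pP] : forall n : nat, exists p,
    [/\ idempotent p, trig p & N p < s + n.+1%:R^-1].
  move=> n; have n0 : 0 < n.+1%:R^-1 :> R by rewrite invr_gt0.
  by have [_ [p [idp tp ->]]] := inf_adherent n0 V_inf; exists p.
pose P := fix P n := if n is n'.+1 then join (P n') (p n') else fun=> 0.
have idP n : idempotent (P n).
  by elim: n => //= n IHn; apply: idempotent_join => //; have [] := pP n.
have tP n : trig (P n).
  elim: n => [|n IHn] /=; first exact: trig0.
  by have [? ? _] := pP n; apply: trig_join => //; have [] := idP n.
have cP n : continuous (P n) by have [] := idP n.
pose w n := residue (P n) h.
have cw n : continuous (w n) by exact: residue_continuous.
have ew n : even (w n) by apply: residue_even => //; have [] := idP n.
pose b n := ip (w n) (w n).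
have b0 n : 0 <= b n by exact: (ip_ge0 hI).
have step n : w n.+1 = residue (p n) (w n).
  by rewrite /w /= residue_join //; have [[]] := pP n.
have bS n : b n.+1 = b n - ip (conv (p n) (w n)) (conv (p n) (w n)).
  by rewrite /b step ip_residue //; have [] := pP n.
have bs n : b n.+1 < s + n.+1%:R^-1.
  have [idp tp Np] := pP n; apply: le_lt_trans Np.
  have [cp ep pp] := idp.
  rewrite /b step /w residue_swap // (ip_residue (idP n)); last exact: residue_continuous.
  by rewrite gerBl (ip_ge0 hI) //; apply: cC => //; exact: residue_continuous.
have conv_ww n : conv (w n) (w n) = residue (P n) (conv h h).
  exact: conv_residue_residue.
have close n m x : (n <= m)%N -> `|conv (w n) (w n) x - conv (w m) (w m) x| <= b n - b m.
  move=> /subnK <-; elim: (m - n)%N => [|k IHk]; first by rewrite !subrr normr0.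
  rewrite addSn; set j := (k + n)%N in IHk *.
  rewrite -(subrKA (conv (w j) (w j) x)); apply: le_trans (ler_normD _ _) _.
  have [idp tp Np] := pP j; have [cp ep pp] := idp.
  have cpw := cC cp (cw j).
  (* The two squares differ by the square of the removed component [conv (p j) (w j)], whose squared
     norm is [b j - b j.+1]. *)
  have -> : conv (w j) (w j) x - conv (w j.+1) (w j.+1) x =
      conv (conv (p j) (w j)) (conv (p j) (w j)) x.
    rewrite step conv_residue_residue // /residue.
    rewrite (convA hI cp (cw j) cpw) -(convA hI (cw j) cp (cw j)) (convC hI (cw j) cp).
    by rewrite (convA hI cp (cw j) (cw j)) -(convA hI cp cp (cC (cw j) (cw j))) pp; ring.
  have : `|conv (conv (p j) (w j)) (conv (p j) (w j)) x| <= b j - b j.+1.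
    rewrite bS opprB addrC subrK.
    have e' : even (conv (p j) (w j)) by exact: (conv_even hI).
    have N0 := ip_ge0 hI cpw.
    rewrite -ler_sqr ?nnegrE // real_normK ?num_real // expr2.
    by have := conv_le hI x cpw cpw e'; rewrite expr2.
  by move: IHk; lra.
have cww n : continuous (conv (w n) (w n)) by exact: cC.
have [phi [cphi [v v0 vphi]]] := uniform_limit cww b0 close.
have ephi : even phi.
  have to_phi x : (fun n => conv (w n) (w n) x) @ \oo --> phi x.
    apply/cvgrPdist_le => r r0; move/cvgrPdist_le: v0 => /(_ r r0); apply: filterS => n.
    rewrite sub0r normrN distrC => h'; apply: le_trans (vphi n x) (le_trans (ler_norm _) h').
  move=> x; rewrite -(cvg_lim _ (to_phi x)) //; apply/esym/cvg_lim => //.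
  have := to_phi (- x); under eq_fun do rewrite (conv_even hI (cw _) (cw _) (ew _) (ew _)).
  by [].
have phi0 : s <= phi 0.
  apply/ler_addgt0Pl => r r0.
  move/cvgrPdist_le: v0 => /(_ r r0)[n _ /(_ n (leqnn n))]; rewrite sub0r normrN => vn.
  have := vphi n 0; rewrite (conv0 I (ew n)) ler_norml => /andP[_].
  have : s <= b n by exact: s_le (idP n) (tP n).
  have := ler_norm (v n); rewrite -/(b n); lra.
have phi_n0 : phi 0 != 0.
  by rewrite gt_eqF // (lt_le_trans e0) // (le_trans s_ge).
have [psi [idpsi tpsi [y /negP]]] := trig_idempotent_nonnull hI cphi ephi phi_n0.
apply; have [cpsi epsi psipsi] := idpsi.
rewrite -normr_le0; apply/ler_addgt0Pl => r r0; rewrite addr0.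
have [B psiB] := haar_bfun hI cpsi.
have v1 : (fun n => v n.+1) @ \oo --> 0 by rewrite (cvg_shiftS v).
have cvgB : (fun n => B * `|v n.+1| + n.+1%:R^-1) @ \oo --> (0 : R).
  rewrite -[X in _ --> X]addr0; apply: cvgD; last exact: cvg_harmonic.
  by rewrite -(mulr0 B) -(@normr0 _ R); apply: cvgM; [exact: cvg_cst|exact: cvg_norm].
move/cvgrPdist_le: cvgB => /(_ r r0)[n _ Hn].
have {Hn} := Hn n (leqnn n); rewrite sub0r normrN => /(le_trans (ler_norm _)) Hn.
apply: le_trans Hn.
rewrite (convC hI cphi cpsi) -(subrK (conv psi (conv (w n.+1) (w n.+1)) y) (conv psi phi y)).
apply: le_trans (ler_normD _ _) _; apply: lerD.
  apply: (@conv_close _ _ _ hI) => // z; rewrite distrC.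
  exact: le_trans (vphi _ _) (ler_norm _).
have cpw := cC cpsi (cw n.+1).
have -> : conv psi (conv (w n.+1) (w n.+1)) = conv (conv psi (w n.+1)) (conv psi (w n.+1)).
  rewrite (convA hI cpsi (cw _) cpw) -(convA hI (cw _) cpsi (cw _)) (convC hI (cw _) cpsi).
  by rewrite (convA hI cpsi (cw _) (cw _)) -(convA hI cpsi cpsi (cC (cw _) (cw _))) psipsi.
have e' : even (conv psi (w n.+1)) by exact: (conv_even hI).
have N0 := ip_ge0 hI cpw.
have : `|conv (conv psi (w n.+1)) (conv psi (w n.+1)) y| <= ip (conv psi (w n.+1)) (conv psi (w n.+1)).
  rewrite -ler_sqr ?nnegrE // real_normK ?num_real // expr2.
  by have := conv_le hI y cpw cpw e'; rewrite expr2.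
move=> /le_trans; apply.
(* Joining [psi] to [P n.+1] cannot bring the residue below the infimum, so the component of
   [w n.+1] along [psi] has squared norm at most [b n.+1 - s]. *)
have : s <= b n.+1 - ip (conv psi (w n.+1)) (conv psi (w n.+1)).
  rewrite -(ip_residue idpsi (cw n.+1)) /w -residue_join //.
  exact: s_le (idempotent_join (idP n.+1) idpsi) (trig_join (cP _) (tP _) tpsi).
have := bs n; move: (n.+1%:R^-1) (b n.+1) (ip _ _) => x1 x2 x3; lra.
Qed.

End density.

(** * Uniform density of trigonometric polynomials *)

Section trig_density.
Variables (R : realType) (G : topologicalZmodType) (I : (G -> R) -> R).
Hypothesis hI : haar I.
Variable d : G -> G -> R.
Hypotheses (d0 : forall x y, d x y = 0 <-> x = y)
  (dC : forall x y, d x y = d y x)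
  (dT : forall x y z, d x z <= d x y + d y z)
  (dN : forall x (A : set G),
     nbhs x A <-> exists2 e : R, 0 < e & [set y | d x y < e] `<=` A)
  (cG : compact [set: G]).
Implicit Types f h t : G -> R.
Local Notation conv := (conv I).
Let mI := haar_mean hI.

Lemma conv_mass f h x B : continuous f -> continuous h -> (forall y, 0 <= h y) ->
  I h = 1 -> (forall y, `|f y| <= B) -> `|conv f h x| <= B.
Proof.
move=> cf ch h0 h1 fB.
have jc := joint_l (x := x) (joint_conv cf ch).
have bB : bfun (fun y => B * h y) by exact/(haar_bfun hI)/contZ.
have bf : bfun (fun y => f (x - y) * h y) by exact: (haar_bfun hI).
have IB : I (fun y => B * h y) = B by rewrite (meanZ mI) ?h1 ?mulr1 //; exact: (haar_bfun hI).
have bNB : bfun (fun y => - B * h y) by exact/(haar_bfun hI)/contZ.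
have INB : I (fun y => - B * h y) = - B.
  by rewrite (meanZ mI) ?h1 ?mulr1 //; exact: (haar_bfun hI).
rewrite ler_norml; apply/andP; split.
  rewrite -INB; apply: (le_mean mI) => // y; apply: ler_wpM2r => //.
  by have := fB (x - y); rewrite ler_norml => /andP[].
rewrite -[leRHS]IB; apply: (le_mean mI) => // y; apply: ler_wpM2r => //.
by have := fB (x - y); rewrite ler_norml => /andP[].
Qed.

Lemma approximate_identity f e : continuous f -> 0 < e ->
  exists h, [/\ continuous h, even h, forall x, 0 <= h x, I h = 1 &
    forall x, `|f x - conv f h x| <= e].
Proof.
move=> cf e0.
have [r r0 fr] := joint_near dN cG 0 (joint_add cf) e0.
have cfN : continuous (fun x => f (- x)) by exact: continuous_opp.
have [r' r'0 fr'] := joint_near dN cG 0 (joint_add cfN) e0.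
(* After the bump is symmetrized, either [y] or [- y] is near [0] on its support; the two moduli
   serve the two cases. *)
pose s := Num.min r r'; have s0 : 0 < s by rewrite lt_min r0 r'0.
pose h0 y := Num.max 0 (s - d y 0).
have ch0 : continuous h0.
  move=> x; apply: (@continuous_max _ _ (cst 0) (fun x => s - d x 0)).
    exact: cst_continuous.
  apply: (@continuousB _ _ _ (cst _) (fun x => d x 0)); first exact: cst_continuous.
  exact: (dist_continuous dC dT dN).
have h0_ge0 y : 0 <= h0 y by rewrite /h0 le_max lexx.
pose h1 y := h0 y + h0 (- y).
have ch1 : continuous h1 by apply: contD => //; exact: continuous_opp.
have h1_ge0 y : 0 <= h1 y by rewrite addr_ge0.
have Ih1 : 0 < I h1.
  apply: (haar_gt0 hI (x := 0)) => //.
  by rewrite /h1 oppr0 /h0 (distxx d0) subr0 addr_gt0 // lt_max s0 orbT.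
exists (fun y => (I h1)^-1 * h1 y); split.
- exact: contZ.
- by move=> x; rewrite /h1 opprK addrC.
- by move=> x; rewrite mulr_ge0 // invr_ge0 ltW.
- by rewrite (meanZ mI) ?mulVf ?gt_eqF //; exact: (haar_bfun hI).
move=> x; have ch := contZ (c := (I h1)^-1) ch1; set h := fun y => _ in ch *.
have h_ge0 y : 0 <= h y by rewrite mulr_ge0 // invr_ge0 ltW.
have Ih : I h = 1 by rewrite (meanZ mI) ?mulVf ?gt_eqF //; exact: (haar_bfun hI).
have supp y : h y != 0 -> `|f x - f (x - y)| <= e.
  rewrite /h mulf_eq0 negb_or => /andP[_].
  rewrite /h1 paddr_eq0 // negb_and => /orP[].
    rewrite /h0; have [dy|dy] := ltP (d y 0) s; last first.
      by rewrite max_l ?eqxx // subr_le0.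
    move=> _; have /fr'/(_ (- x)) : d 0 y < r'.
      by rewrite dC; apply: lt_le_trans dy _; rewrite ge_min lexx orbT.
    by rewrite addr0 opprD !opprK distrC => /ltW.
  rewrite /h0; have [dy|dy] := ltP (d (- y) 0) s; last first.
    by rewrite max_l ?eqxx // subr_le0.
  move=> _; have /fr/(_ x) : d 0 (- y) < r.
    by rewrite dC; apply: lt_le_trans dy _; rewrite ge_min lexx.
  by rewrite addr0 distrC => /ltW.
have cfx : continuous (fun y => f (x - y)) by exact: (joint_l (x := x) (joint_sub cf)).
have bh : bfun h by exact: (haar_bfun hI).
have -> : f x - conv f h x = I (fun y => (f x - f (x - y)) * h y).
  rewrite -[f x]mulr1 -[in LHS]Ih -(meanZ mI) // -(meanB mI).
  - by congr I; apply/funext => y; rewrite mulr1 mulrBl.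
  - exact: bfunZ.
  - exact/(haar_bfun hI)/(joint_l (x := x) (joint_conv cf ch)).
have key y : - e * h y <= (f x - f (x - y)) * h y <= e * h y.
  have [->|hy] := eqVneq (h y) 0; first by rewrite !mulr0 lexx.
  by have := supp y hy; rewrite ler_norml => /andP[? ?]; rewrite !ler_wpM2r.
have cI : continuous (fun y => (f x - f (x - y)) * h y).
  apply: contM => //.
  rewrite (_ : (fun _ => _) = (fun y => f x + (-1) * f (x - y))).
    by apply: contD; [exact: cst_continuous|exact: contZ].
  by apply/funext => y; rewrite mulN1r.
have bI := haar_bfun hI cI.
rewrite ler_norml; apply/andP; split.
  rewrite -[- e]mulr1 -Ih -(meanZ mI) //; apply: (le_mean mI) => //; first exact: bfunZ.
  by move=> y; case/andP: (key y).
rewrite -[leRHS]mulr1 -[in leRHS]Ih -(meanZ mI) //; apply: (le_mean mI) => //.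
  exact: bfunZ.
by move=> y; case/andP: (key y).
Qed.

(** Three errors: from [f] to [conv f h], to [conv f (conv h h)], and to its projection by [p]. The
    second factor [h] makes the last error a convolution with the square of [residue I p h], which
    its [ip] norm bounds uniformly. *)
Theorem trig_dense f e : continuous f -> 0 < e ->
  exists2 t, trig t & forall x, `|f x - t x| <= e.
Proof.
move=> cf e0; have e3 : 0 < e / 3 by lra.
have [h [ch eh h0 h1 fh]] := approximate_identity cf e3.
have [B fB] := haar_bfun hI cf.
pose B' := `|B| + 1; have B'0 : 0 < B' by rewrite ltr_wpDl.
have fB' x : `|f x| <= B'.
  by apply: le_trans (fB x) _; rewrite /B'; have := ler_norm B; lra.
have eB : 0 < e / 3 / B' by rewrite divr_gt0.
have [p [idp tp hp]] := residue_small hI ch eh eB.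
have [cp ep pp] := idp.
have cfh := conv_continuous hI cf ch; have chh := conv_continuous hI ch ch.
have cphh := conv_continuous hI cp chh.
exists (conv f (conv p (conv h h))).
  apply: (trig_conv hI) => //; rewrite (convC hI cp chh).
  exact: (trig_conv hI).
move=> x.
have s1 := fh x.
have s2 : `|conv f h x - conv f (conv h h) x| <= e / 3.
  rewrite -(convA hI cf ch ch).
  have -> : conv f h x - conv (conv f h) h x =
      conv (fun y => f y + (-1) * conv f h y) h x.
    rewrite (convDl hI cf (contZ cfh) ch) (convZl hI _ cfh ch).
    by rewrite mulN1r.
  apply: conv_mass => // [|y]; first by apply: contD => //; exact: contZ.
  by rewrite mulN1r.
have s3 : `|conv f (conv h h) x - conv f (conv p (conv h h)) x| <= e / 3.
  have -> : e / 3 = B' * (e / 3 / B') by field; rewrite gt_eqF.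
  apply: (conv_close hI) => // y.
  have cr := residue_continuous hI cp ch.
  have er := residue_even hI cp ch ep eh.
  have -> : conv h h y - conv p (conv h h) y = conv (residue I p h) (residue I p h) y.
    by rewrite conv_residue_residue // /residue mulN1r.
  have N0 := ip_ge0 hI cr.
  apply: le_trans (ltW hp).
  rewrite -ler_sqr ?nnegrE // real_normK ?num_real //.
  by have := conv_le hI y cr cr er; rewrite expr2.
rewrite -(subrKA (conv f h x)) -[X in _ + X](subrKA (conv f (conv h h) x)).
apply: le_trans (ler_normD _ _) _.
have := ler_normD (conv f h x - conv f (conv h h) x)
  (conv f (conv h h) x - conv f (conv p (conv h h)) x).
by lra.
Qed.

End trig_density.

(** * Uniqueness of the invariant measure *)

Section integral_of_continuous.
Variables (R : realType) (X : ptopologicalType) (mu : probability (borel_type X) R).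
Hypothesis cX : compact [set: X].
Implicit Types f g : X -> R.

Definition mean_of f : R := \int[mu]_(x in [set: borel_type X]) f x.

Lemma continuous_measurable_borel f : continuous f ->
  measurable_fun [set: borel_type X] (f : borel_type X -> R).
Proof.
move=> cf; apply: (measurability _ (measurable_realfun.RGenOInfty.measurableE R)) => _ [_ [r ->] <-].
rewrite setTI; apply: sub_gen_smallest.
by apply: open_comp => [x _|]; [exact: cf|exact: interval_open].
Qed.

Lemma continuous_integrable f : continuous f ->
  mu.-integrable [set: borel_type X] (EFin \o f).
Proof.
move=> cf; apply: measurable_bounded_integrable => //.
- by rewrite [X in (X < _)%E]probability_setT ltry.
- exact: continuous_measurable_borel.
- have [B fB] := compact_bfun cX cf; exists B; split; first exact: num_real.
  by move=> M BM x _; apply: le_trans (fB x) (ltW BM).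
Qed.

Lemma mean_ofD f g : continuous f -> continuous g ->
  mean_of (fun x => f x + g x) = mean_of f + mean_of g.
Proof. by move=> cf cg; apply: RintegralD => //; exact: continuous_integrable. Qed.

Lemma mean_ofZ c f : continuous f -> mean_of (fun x => c * f x) = c * mean_of f.
Proof. by move=> cf; apply: RintegralZl => //; exact: continuous_integrable. Qed.

Lemma mean_of_cst c : mean_of (fun=> c) = c.
Proof.
rewrite /mean_of Rintegral_cst // [X in fine X]probability_setT /= mulr1.
by [].
Qed.

Lemma le_mean_of f g : continuous f -> continuous g -> (forall x, f x <= g x) ->
  mean_of f <= mean_of g.
Proof. by move=> cf cg fg; apply: le_Rintegral => //; exact: continuous_integrable. Qed.

Lemma mean_of_close f g e : continuous f -> continuous g ->
  (forall x, `|f x - g x| <= e) -> `|mean_of f - mean_of g| <= e.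
Proof.
move=> cf cg fg.
have cge (c : R) : continuous (fun x => g x + c).
  by move=> x; apply: continuousD; [exact: cg|exact: cst_continuous].
have E c : mean_of (fun x => g x + c) = mean_of g + c.
  by rewrite mean_ofD ?mean_of_cst //; exact: cst_continuous.
rewrite ler_distl -!E; apply/andP; split; apply: le_mean_of => // x;
  by have := fg x; rewrite ler_distl => /andP[].
Qed.

Lemma mean_of_invariant (phi : X -> X) f : continuous phi -> continuous f ->
  (forall A : set (borel_type X), measurable A ->
    pushforward mu (phi : borel_type X -> borel_type X) A = mu A) ->
  mean_of (f \o phi) = mean_of f.
Proof.
move=> cphi cf phimu.
have mphi : measurable_fun [set: borel_type X] (phi : borel_type X -> borel_type X).
  apply: (@measurability _ _ (borel_type X) (borel_type X) _ _ (@open X)) => // _ [U oU <-].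
  by rewrite setTI; apply: sub_gen_smallest; apply: open_comp => // x _; exact: cphi.
rewrite /mean_of /Rintegral; congr fine.
have cfphi : continuous (f \o phi).
  by move=> x; apply: continuous_comp; [exact: cphi|exact: cf].
transitivity (\int[pushforward mu (phi : borel_type X -> borel_type X)]_(y in [set: borel_type X]) (EFin \o f) y)%E.
  rewrite integral_pushforward // ?preimage_setT //.
  - by apply/measurable_EFinP; exact: continuous_measurable_borel.
  - exact: continuous_integrable.
by apply: eq_measure_integral => A mA _; exact: phimu.
Qed.

Lemma mean_of_eq (K : set X) f g : closed K -> mu (~` K) = 0%E ->
  continuous f -> continuous g -> (forall x, K x -> f x = g x) ->
  mean_of f = mean_of g.
Proof.
move=> clK K0 cf cg fg; rewrite /mean_of /Rintegral; congr fine.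
apply: ae_eq_integral => //.
- by apply/measurable_EFinP; exact: continuous_measurable_borel.
- by apply/measurable_EFinP; exact: continuous_measurable_borel.
exists (~` K); split => //; first by apply: sub_gen_smallest; rewrite openC.
move=> x /= H Kx; apply: H => _; congr EFin; exact: fg.
Qed.

Lemma mean_of_limit (h : nat -> X -> R) (A : set (borel_type X)) : measurable A ->
  (forall n, continuous (h n)) -> (forall n x, 0 <= h n x <= 1) ->
  (forall x, h ^~ x @ \oo --> (\1_A x : R)) ->
  (fun n => mean_of (h n)) @ \oo --> fine (mu A).
Proof.
move=> mA ch h01 hA.
have mh n : measurable_fun [set: borel_type X] (EFin \o h n : borel_type X -> \bar R).
  by apply/measurable_EFinP; exact: continuous_measurable_borel.
have m1 : measurable_fun [set: borel_type X] (fun x => (\1_A x)%:E : \bar R).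
  by apply/measurable_EFinP; exact: measurable_indic.
have cvA : {ae mu, forall x, [set: borel_type X] x -> (EFin \o h n) x @[n --> \oo] --> (\1_A x)%:E}.
  by apply: aeW => x _; apply: cvg_EFin; [exact: nearW|exact: hA].
have i1 : mu.-integrable [set: borel_type X] (EFin \o cst (1%R : R)).
  by apply: continuous_integrable; exact: cst_continuous.
have le1 : {ae mu, forall x n, [set: borel_type X] x -> (`|(EFin \o h n) x| <= (EFin \o cst (1%R : R)) x)%E}.
  apply: aeW => x n _ /=; rewrite lee_fin ger0_norm; by have /andP[] := h01 n x.
have [_ _] := dominated_convergence measurableT mh m1 cvA i1 le1.
rewrite integral_indic // setIT => H.
apply: fine_cvg; rewrite fineK ?fin_num_measure //.
Qed.

End integral_of_continuous.

Section complex_valued.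
Variable R : realType.
Local Notation C := R[i].

Lemma complex_ReM (a b : C) :
  complex.Re (a * b) = complex.Re a * complex.Re b - complex.Im a * complex.Im b.
Proof. by case: a b => ? ? []. Qed.

Lemma complex_ImM (a b : C) :
  complex.Im (a * b) = complex.Re a * complex.Im b + complex.Im a * complex.Re b.
Proof. by case: a b => ? ? []. Qed.

Lemma complex_ReD (a b : C) : complex.Re (a + b) = complex.Re a + complex.Re b.
Proof. by case: a b => ? ? []. Qed.

Lemma complex_ImD (a b : C) : complex.Im (a + b) = complex.Im a + complex.Im b.
Proof. by case: a b => ? ? []. Qed.

Lemma complex_Re_conj (a : C) : complex.Re a^* = complex.Re a.
Proof. by case: a. Qed.

Lemma complex_Im_conj (a : C) : complex.Im a^* = - complex.Im a.
Proof. by case: a. Qed.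

Variable X : topologicalType.
Implicit Types F : X -> C.

Definition re_im_continuous F : Prop :=
  continuous (fun x => complex.Re (F x)) /\ continuous (fun x => complex.Im (F x)).

Lemma re_im_continuous_cst c : re_im_continuous (fun=> c).
Proof. by split; exact: cst_continuous. Qed.

Lemma re_im_continuousD F F' : re_im_continuous F -> re_im_continuous F' ->
  re_im_continuous (fun x => F x + F' x).
Proof.
move=> [cr ci] [cr' ci']; split.
  rewrite (_ : (fun _ => _) = fun x => complex.Re (F x) + complex.Re (F' x)).
    by move=> x; apply: continuousD; [exact: cr|exact: cr'].
  by apply/funext => x; rewrite complex_ReD.
rewrite (_ : (fun _ => _) = fun x => complex.Im (F x) + complex.Im (F' x)).
  by move=> x; apply: continuousD; [exact: ci|exact: ci'].
by apply/funext => x; rewrite complex_ImD.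
Qed.

Lemma re_im_continuousM F F' : re_im_continuous F -> re_im_continuous F' ->
  re_im_continuous (fun x => F x * F' x).
Proof.
move=> [cr ci] [cr' ci']; split.
  rewrite (_ : (fun _ => _) = fun x => complex.Re (F x) * complex.Re (F' x)
      - complex.Im (F x) * complex.Im (F' x)).
    move=> x; apply: (@continuousB _ _ _ (fun x => complex.Re (F x) * complex.Re (F' x))
      (fun x => complex.Im (F x) * complex.Im (F' x))); apply: continuousM;
      by [exact: cr|exact: cr'|exact: ci|exact: ci'].
  by apply/funext => x; rewrite complex_ReM.
rewrite (_ : (fun _ => _) = fun x => complex.Re (F x) * complex.Im (F' x)
      + complex.Im (F x) * complex.Re (F' x)).
  move=> x; apply: (@continuousD _ _ _ (fun x => complex.Re (F x) * complex.Im (F' x))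
    (fun x => complex.Im (F x) * complex.Re (F' x))); apply: continuousM;
    by [exact: cr|exact: cr'|exact: ci|exact: ci'].
by apply/funext => x; rewrite complex_ImM.
Qed.

Lemma re_im_continuous_conj F : re_im_continuous F -> re_im_continuous (fun x => (F x)^*).
Proof.
move=> [cr ci]; split.
  by rewrite (_ : (fun _ => _) = fun x => complex.Re (F x)) //; apply/funext => x; rewrite complex_Re_conj.
rewrite (_ : (fun _ => _) = fun x => - complex.Im (F x)).
  by move=> x; apply: continuousN; exact: ci.
by apply/funext => x; rewrite complex_Im_conj.
Qed.

End complex_valued.

Lemma re_im_continuous_comp (R : realType) (Y X : topologicalType) (phi : Y -> X)
  (F : X -> R[i]) :
  continuous phi -> re_im_continuous F -> re_im_continuous (F \o phi).
Proof.
move=> cphi [cr ci]; split=> y.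
  by apply: (continuous_comp (f := phi) (g := fun x => complex.Re (F x)));
    [exact: cphi|exact: cr].
by apply: (continuous_comp (f := phi) (g := fun x => complex.Im (F x)));
  [exact: cphi|exact: ci].
Qed.

(** * Characters of the group of maps along an orbit *)

Section map_characters.
Variables (R : realType) (Gamma : groupType) (G : topologicalZmodType).
Local Notation X := (fun_space Gamma G).
Local Notation C := R[i].
Implicit Types (chi : X -> C) (Q : X).

(** A homomorphism to the nonzero complex numbers, in quotient form to match difference
    operators. *)
Definition multiplicative_map chi : Prop :=
  (forall Q, chi Q != 0) /\
  forall Q Q', chi (fun x => Q x - Q' x) = chi Q / chi Q'.

Lemma multiplicative_map_zero chi : multiplicative_map chi -> chi (fun=> 0) = 1.
Proof.
move=> [chi0 chiB]; rewrite -(divff (chi0 (fun=> 0))) -chiB.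
by congr chi; apply/funext => x; rewrite subr0.
Qed.

Definition shift_quotient chi h Q : C := chi (fun x => translate h Q x - Q x).

Lemma multiplicative_shift_quotient chi h :
  multiplicative_map chi -> multiplicative_map (shift_quotient chi h).
Proof.
move=> [chi0 chiB]; split=> [Q|Q Q']; first exact: chi0.
rewrite /shift_quotient -chiB; congr chi; apply/funext => x; rewrite /translate.
by rewrite !opprD !opprK addrACA.
Qed.

(* Each difference quotient trades one degree of [Q] for one more degree on
   which [chi] is trivial. *)
Lemma phase_poly_orbit chi k j Q : multiplicative_map chi ->
  (forall Q', vanishing j Q' -> chi Q' = 1) -> vanishing (j + k) Q ->
  phase_poly k (fun g => chi (translate g Q)).
Proof.
elim: k chi j => [|k IHk] chi j hchi chi1 vQ.
  move=> g h; rewrite addn0 in vQ.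
  by rewrite !chi1 //; exact: vanishing_translate.
move=> h; rewrite (_ : phase_diff h _ = fun g => shift_quotient chi h (translate g Q)).
  apply: (IHk _ j.+1); rewrite ?addSnnS //.
    exact: multiplicative_shift_quotient.
  by move=> Q' vQ'; apply: chi1; apply: lowers_degree1; rewrite addn1.
by apply/funext => g; rewrite /phase_diff translateM /shift_quotient hchi.2.
Qed.

Lemma phase_poly_orbit_vanishing chi n Q : multiplicative_map chi -> vanishing n Q ->
  phase_poly n (fun g => chi (translate g Q)).
Proof.
move=> hchi; apply: (@phase_poly_orbit _ _ 0) => // Q' ->.
exact: multiplicative_map_zero.
Qed.

Record map_character chi : Prop := {
  map_character_mul : multiplicative_map chi;
  map_character_norm : forall Q, `|chi Q| = 1;
  map_character_cont : re_im_continuous chi }.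

Lemma map_character1 : map_character (fun=> 1).
Proof.
split=> [|Q|]; last exact: re_im_continuous_cst.
  by split=> [Q|Q Q']; rewrite ?oner_neq0 ?divr1.
exact: normr1.
Qed.

Lemma map_characterM chi chi' : map_character chi -> map_character chi' ->
  map_character (fun Q => chi Q * chi' Q).
Proof.
move=> [[n0 B] N c] [[n0' B'] N' c']; split=> [|Q|].
- by split=> [Q|Q Q']; rewrite ?mulf_neq0 // B B' invfM mulrACA.
- by rewrite normrM N N' mulr1.
- exact: re_im_continuousM.
Qed.

Lemma map_character_conj chi : map_character chi -> map_character (fun Q => (chi Q)^*).
Proof.
move=> [[n0 B] N c]; split=> [|Q|].
- by split=> [Q|Q Q']; rewrite ?fmorph_eq0 // B fmorph_div.
- by rewrite norm_conjC N.
- exact: re_im_continuous_conj.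
Qed.

Lemma map_character_eval (chi : G -> C) g : character chi ->
  map_character (fun Q => chi (Q g)).
Proof.
move=> hchi; have n0 x : chi x != 0 by rewrite -normr_gt0 character_norm.
split=> [|Q|]; last first.
- have ce := @eval_continuous Gamma G g.
  split=> Q; first by apply: (continuous_comp (f := fun Q : X => Q g)
      (g := fun x => complex.Re (chi x))); [exact: ce|exact: (character_Re hchi)].
  by apply: (continuous_comp (f := fun Q : X => Q g)
      (g := fun x => complex.Im (chi x))); [exact: ce|exact: (character_Im hchi)].
- exact: character_norm.
split=> [Q|Q Q'] //; apply: (mulIf (n0 (Q' g))); rewrite mulfVK //.
by rewrite -(characterD hchi) subrK.
Qed.

End map_characters.

Lemma eq_on_closure (R : realType) (X : topologicalType) (A : set X) (f f' : X -> R) :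
  continuous f -> continuous f' -> (forall x, A x -> f x = f' x) ->
  forall x, closure A x -> f x = f' x.
Proof.
move=> cf cf' ff' x; rewrite closureE => /(_ [set y | f y = f' y]); apply; split=> //.
rewrite (_ : mkset _ = (fun y => f y - f' y) @^-1` [set 0]).
  apply: closed_comp => [y _|]; last exact: closed_eq.
  by apply: (@continuousB _ _ _ f f'); [exact: cf|exact: cf'].
by apply/seteqP; split=> y /= H; apply/eqP; move/eqP: H; rewrite subr_eq0.
Qed.

Section complex_mean.
Variables (R : realType) (X : ptopologicalType) (mu : probability (borel_type X) R).
Hypothesis cX : compact [set: X].
Implicit Types F : X -> R[i].

Definition complex_mean F : R[i] :=
  (mean_of mu (fun x => complex.Re (F x)) +i* mean_of mu (fun x => complex.Im (F x)))%C.

Lemma complex_meanD F F' : re_im_continuous F -> re_im_continuous F' ->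
  complex_mean (fun x => F x + F' x) = complex_mean F + complex_mean F'.
Proof.
move=> [cr ci] [cr' ci']; rewrite /complex_mean.
have -> : (fun x => complex.Re (F x + F' x)) = fun x => complex.Re (F x) + complex.Re (F' x).
  by apply/funext => x; rewrite complex_ReD.
have -> : (fun x => complex.Im (F x + F' x)) = fun x => complex.Im (F x) + complex.Im (F' x).
  by apply/funext => x; rewrite complex_ImD.
by rewrite !(mean_ofD _ cX).
Qed.

Lemma complex_meanZ c F : re_im_continuous F ->
  complex_mean (fun x => c * F x) = c * complex_mean F.
Proof.
move=> [cr ci]; rewrite /complex_mean.
pose a := complex.Re c; pose b := complex.Im c.
have cZ (t : R) (f : X -> R) : continuous f -> continuous (fun x => t * f x).
  by move=> cf x; apply: continuousM; [exact: cst_continuous|exact: cf].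
have -> : (fun x => complex.Re (c * F x)) =
    fun x => a * complex.Re (F x) + (- b) * complex.Im (F x).
  by apply/funext => x; rewrite mulNr complex_ReM.
have -> : (fun x => complex.Im (c * F x)) =
    fun x => a * complex.Im (F x) + b * complex.Re (F x).
  by apply/funext => x; rewrite complex_ImM.
rewrite !(mean_ofD _ cX) ?(mean_ofZ _ cX) //; try exact: cZ.
by apply/eqP; rewrite eq_complex complex_ReM complex_ImM /= mulNr !eqxx.
Qed.

Lemma complex_mean_conj F : re_im_continuous F ->
  complex_mean (fun x => (F x)^*) = (complex_mean F)^*.
Proof.
move=> [cr ci]; rewrite /complex_mean.
have -> : (fun x => complex.Re (F x)^*) = fun x => complex.Re (F x).
  by apply/funext => x; rewrite complex_Re_conj.
have -> : (fun x => complex.Im (F x)^*) = fun x => (-1) * complex.Im (F x).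
  by apply/funext => x; rewrite complex_Im_conj mulN1r.
by rewrite (mean_ofZ _ cX) // mulN1r.
Qed.

Lemma complex_mean1 : complex_mean (fun=> 1) = 1.
Proof. by rewrite /complex_mean !(mean_of_cst mu). Qed.

Lemma complex_mean_invariant (phi : X -> X) F : continuous phi -> re_im_continuous F ->
  (forall A : set (borel_type X), measurable A ->
    pushforward mu (phi : borel_type X -> borel_type X) A = mu A) ->
  complex_mean (F \o phi) = complex_mean F.
Proof.
move=> cphi [cr ci] phimu; rewrite /complex_mean.
by rewrite -(mean_of_invariant cX cphi cr phimu) -(mean_of_invariant cX cphi ci phimu).
Qed.

Lemma complex_mean_eq (A : set X) F F' : mu (~` closure A) = 0%E ->
  re_im_continuous F -> re_im_continuous F' -> (forall x, A x -> F x = F' x) ->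
  complex_mean F = complex_mean F'.
Proof.
move=> A0 [cr ci] [cr' ci'] FF'; rewrite /complex_mean.
have clA := @closed_closure _ A.
have E f f' : continuous f -> continuous f' -> (forall x, A x -> f x = f' x) ->
    mean_of mu f = mean_of mu f'.
  by move=> cf cf' ff'; apply: (mean_of_eq clA A0) => //; exact: eq_on_closure.
by rewrite (E _ _ cr cr') ?(E _ _ ci ci') // => x /FF' ->.
Qed.

Lemma complex_mean_ge0 (A : set X) F : mu (~` closure A) = 0%E ->
  re_im_continuous F -> (forall x, A x -> 0 <= F x) -> 0 <= complex_mean F.
Proof.
move=> A0 [cr ci] F0.
have cp : continuous (fun x => `|complex.Re (F x)|).
  by move=> x; apply: continuous_comp; [exact: cr|exact: norm_continuous].
have E x : A x -> complex.Im (F x) = 0 /\ complex.Re (F x) = `|complex.Re (F x)|.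
  move=> /F0; rewrite lecE /= => /andP[/eqP -> r0].
  by rewrite ger0_norm.
have clA := @closed_closure _ A.
rewrite lecE /complex_mean /=.
have -> : mean_of mu (fun x => complex.Im (F x)) = mean_of mu (fun=> 0).
  apply: (mean_of_eq clA A0) => //; first exact: cst_continuous.
  by apply: eq_on_closure => // [|x /E[]//]; exact: cst_continuous.
rewrite (mean_of_cst mu) eqxx /=.
have -> : mean_of mu (fun x => complex.Re (F x)) = mean_of mu (fun x => `|complex.Re (F x)|).
  by apply: (mean_of_eq clA A0) => //; apply: eq_on_closure => // x /E[].
rewrite -(mean_of_cst mu 0); apply: (le_mean_of mu cX) => //; exact: cst_continuous.
Qed.

End complex_mean.

(** * The state that a measure induces on functions of the orbit *)

Section orbit_state.
Variables (R : realType) (Gamma : groupType) (G : topologicalZmodType).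
Local Notation X := (fun_space Gamma G).
Local Notation C := R[i].
Variables (P : X) (mu : probability (borel_type X) R).
Hypotheses (cX : compact [set: X])
  (c_translate : forall g, continuous (@translate Gamma G g))
  (mu_inv : invariant_measure mu) (mu_orbit : mu (~` orbit_closure P) = 0%E).

Definition orbit_functions : set (Gamma -> C) :=
  [set f | exists F : X -> C, re_im_continuous F /\ forall g, f g = F (translate g P)].

(** The integral of an arbitrarily chosen continuous extension; [orbit_stateE] shows that the choice
    is immaterial. *)
Definition orbit_state (f : Gamma -> C) : C :=
  if pselect (orbit_functions f) is left H then complex_mean mu (projT1 (cid H)) else 0.

(** Two continuous extensions agree on the orbit, hence on its closure, which has full measure. *)
Lemma orbit_stateE F : re_im_continuous F ->
  orbit_state (fun g => F (translate g P)) = complex_mean mu F.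
Proof.
move=> cF; rewrite /orbit_state; case: pselect => [H|[]]; last by exists F.
case: cid => F' /= [cF' FF'].
apply: (complex_mean_eq mu_orbit) => // _ [g _ <-].
by rewrite -FF'.
Qed.

Lemma orbit_invariant_state : invariant_state orbit_functions orbit_state.
Proof.
split.
- by move=> c; exists (fun=> c); split => //; exact: re_im_continuous_cst.
- move=> f f' [F [cF fF]] [F' [cF' fF']]; exists (fun x => F x + F' x).
  by split=> [|g]; [exact: re_im_continuousD|rewrite fF fF'].
- move=> f f' [F [cF fF]] [F' [cF' fF']]; exists (fun x => F x * F' x).
  by split=> [|g]; [exact: re_im_continuousM|rewrite fF fF'].
- move=> f [F [cF fF]]; exists (fun x => (F x)^*).
  by split=> [|g]; [exact: re_im_continuous_conj|rewrite fF].
- move=> g f [F [cF fF]]; exists (F \o translate g).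
  split=> [|h]; last by rewrite fF translateM.
  exact: re_im_continuous_comp (@c_translate g) cF.
- move=> f f' [F [cF /funext ->]] [F' [cF' /funext ->]].
  rewrite (orbit_stateE (F := fun x => F x + F' x)) ?orbit_stateE //; first exact: complex_meanD.
  exact: re_im_continuousD.
- move=> c f [F [cF /funext ->]].
  rewrite (orbit_stateE (F := fun x => c * F x)) ?orbit_stateE //; first exact: complex_meanZ.
  by apply: re_im_continuousM => //; exact: re_im_continuous_cst.
- rewrite (orbit_stateE (F := fun=> 1)) ?complex_mean1 //; exact: re_im_continuous_cst.
- move=> f [F [cF /funext ->]].
  rewrite (orbit_stateE (F := fun x => (F x)^*)) ?orbit_stateE //; first exact: complex_mean_conj.
  exact: re_im_continuous_conj.
- move=> f [F [cF /funext ->]] f0; rewrite orbit_stateE //.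
  by apply: (complex_mean_ge0 cX mu_orbit) => // _ [g _ <-].
move=> g f [F [cF /funext ->]]; rewrite orbit_stateE //.
rewrite -(complex_mean_invariant cX (@c_translate g) cF (mu_inv g)).
rewrite -orbit_stateE; first by congr orbit_state; apply/funext => h; rewrite translateM.
exact: re_im_continuous_comp (@c_translate g) cF.
Qed.

End orbit_state.

(** * From characters to products of coordinate functions *)

Section moments.
Variables (R : realType) (Gamma : groupType) (G : topologicalZmodType).
Local Notation X := (fun_space Gamma G).
Local Notation C := R[i].
Variables mu nu : probability (borel_type X) R.
Hypotheses (cG : compact [set: G])
  (trig_approx : forall (f : G -> R) e, continuous f -> 0 < e ->
     exists2 t, trig t & forall x, `|f x - t x| <= e)
  (agree : forall chi : X -> C, map_character chi -> complex_mean mu chi = complex_mean nu chi).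
Let cX : compact [set: X] := compact_fun_space cG.
Implicit Types (chi F : X -> C) (l : seq (Gamma * (G -> R))).

Definition moment l (x : X) : R := \prod_(p <- l) p.2 (x p.1).

Definition continuous_factors l : Prop :=
  foldr (fun p Q => continuous p.2 /\ Q) True l.

Lemma eval_comp_continuous (f : G -> R) g : continuous f -> continuous (fun x : X => f (x g)).
Proof.
move=> cf x; apply: (continuous_comp (f := fun x : X => x g)); last exact: cf.
exact: eval_continuous.
Qed.

Lemma moment_continuous l : continuous_factors l -> continuous (moment l).
Proof.
elim: l => [_|[g f] l IHl /= [cf cl]].
  rewrite (_ : moment _ = fun=> 1); first exact: cst_continuous.
  by apply/funext => x; rewrite /moment big_nil.
rewrite (_ : moment _ = fun x => f (x g) * moment l x).
  by move=> x; apply: continuousM; [exact: eval_comp_continuous|exact: IHl].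
by apply/funext => x; rewrite /moment big_cons.
Qed.

Lemma re_im_continuous_real (f : X -> R) : continuous f ->
  re_im_continuous (fun x => (f x)%:C%C).
Proof. by move=> cf; split => //; exact: cst_continuous. Qed.

Let agrees F := complex_mean mu F = complex_mean nu F.

Lemma agrees_comb a b F F' : re_im_continuous F -> re_im_continuous F' ->
  agrees F -> agrees F' -> agrees (fun x => a * F x + b * F' x).
Proof.
move=> cF cF' FE F'E; have cZ c F1 : re_im_continuous F1 -> re_im_continuous (fun x => c * F1 x).
  by move=> cF1; apply: re_im_continuousM => //; exact: re_im_continuous_cst.
by rewrite /agrees !(complex_meanD _ cX) ?(complex_meanZ _ cX) ?FE ?F'E //; exact: cZ.
Qed.

Lemma agrees_trig chi (r : X -> R) g t : map_character chi -> continuous r ->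
  (forall chi', map_character chi' -> agrees (fun x => chi' x * (r x)%:C%C)) ->
  trig t -> agrees (fun x => chi x * (t (x g) * r x)%:C%C).
Proof.
move=> hchi cr Hr; elim=> [|a b c t' hc tt' IH].
  rewrite (_ : (fun _ => _) = fun x => 0 * chi x + 0 * chi x); last first.
    by apply/funext => x; rewrite !mul0r addr0 mulr0.
  have cchi := map_character_cont hchi; have E := agree hchi.
  exact: agrees_comb.
have hcg := map_character_eval g hc.
have h1 := map_characterM hchi hcg.
have h2 := map_characterM hchi (map_character_conj hcg).
have cR f : map_character f -> re_im_continuous (fun x => f x * (r x)%:C%C).
  by move=> hf; apply: re_im_continuousM (map_character_cont hf) _; exact: re_im_continuous_real.
(* Chosen so that [a * Re z + b * Im z = al * z + al^* * z^*], which writes a real trigonometric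
   term through two characters. *)
pose al : C := ((a / 2) +i* (- (b / 2)))%C.
rewrite (_ : (fun _ => _) = fun x => 1 * (al * (chi x * c (x g) * (r x)%:C%C) +
    al^* * (chi x * (c (x g))^* * (r x)%:C%C)) + 1 * (chi x * (t' (x g) * r x)%:C%C)).
  apply: agrees_comb => //.
  - by apply: re_im_continuousD; apply: re_im_continuousM;
      [exact: re_im_continuous_cst|exact: cR|exact: re_im_continuous_cst|exact: cR].
  - apply: re_im_continuousM (map_character_cont hchi) _; apply: re_im_continuous_real.
    move=> x; apply: continuousM; last exact: cr.
    by apply: eval_comp_continuous; exact: trig_continuous.
  by apply: agrees_comb; [exact: cR|exact: cR|exact: Hr|exact: Hr].
apply/funext => x; case: (chi x) (c (x g)) => u v [p q].
rewrite !mul1r; apply/eqP; rewrite eq_complex /=; apply/andP; split; apply/eqP; by field.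
Qed.

(** The character is carried through the induction: each factor is approximated by a trigonometric
    polynomial in its coordinate, whose characters are absorbed into [chi]. *)
Lemma agrees_moment l chi : continuous_factors l -> map_character chi ->
  agrees (fun x => chi x * (moment l x)%:C%C).
Proof.
elim: l chi => [|[g f] l IHl] chi.
  move=> _ hchi; rewrite (_ : (fun _ => _) = chi); first exact: agree.
  by apply/funext => x; rewrite /moment big_nil mulr1.
move=> /= [cf cl] hchi; have cm := moment_continuous cl.
rewrite (_ : (fun _ => _) = fun x => chi x * (f (x g) * moment l x)%:C%C); last first.
  by apply/funext => x; rewrite /moment big_cons.
have [B mB] := compact_bfun cX cm.
pose B' := `|B| + 1; have B'0 : 0 < B' by rewrite ltr_wpDl.
have mB' x : `|moment l x| <= B' by apply: le_trans (mB x) _; rewrite /B'; have := ler_norm B; lra.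
have [cre cim] := map_character_cont hchi.
have reim1 x : `|complex.Re (chi x)| <= 1 /\ `|complex.Im (chi x)| <= 1.
  have := map_character_norm hchi x; rewrite normc_def => -[/(congr1 (fun r => r ^+ 2))].
  rewrite sqr_sqrtr ?addr_ge0 ?sqr_ge0 // expr1n => N.
  by split; rewrite -ler_sqr ?nnegrE // expr1n real_normK ?num_real // -N ?lerDl ?lerDr sqr_ge0.
have key (h : X -> R) : continuous h -> (forall x, `|h x| <= 1) ->
    (forall t, trig t -> mean_of mu (fun x => h x * (t (x g) * moment l x)) =
       mean_of nu (fun x => h x * (t (x g) * moment l x))) ->
    mean_of mu (fun x => h x * (f (x g) * moment l x)) =
      mean_of nu (fun x => h x * (f (x g) * moment l x)).
  move=> ch h1 Ht; apply/eqP; rewrite -subr_eq0 -normr_le0; apply/ler_addgt0Pl => e e0.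
  have eB : 0 < e / 2 / B' by rewrite !divr_gt0.
  have [t tt ft] := trig_approx cf eB.
  have cF (k : G -> R) : continuous k -> continuous (fun x => h x * (k (x g) * moment l x)).
    move=> ck x; apply: (@continuousM _ _ h (fun y => k (y g) * moment l y)); first exact: ch.
    by apply: (@continuousM _ _ (fun y : X => k (y g)) (moment l)); [exact: eval_comp_continuous|exact: cm].
  have close x : `|h x * (f (x g) * moment l x) - h x * (t (x g) * moment l x)| <= e / 2.
    rewrite -mulrBr -mulrBl !normrM -[e / 2]mul1r; apply: ler_pM => //.
    by rewrite -[e / 2](@divfK _ B') ?gt_eqF //; apply: ler_pM.
  have ct := trig_continuous tt.
  have A1 := mean_of_close mu cX (cF _ cf) (cF _ ct) close.
  have A2 := mean_of_close nu cX (cF _ cf) (cF _ ct) close.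
  rewrite (Ht t tt) in A1; move: A1 A2.
  move: (mean_of mu _) (mean_of nu _) (mean_of nu _) => p q s.
  by rewrite addr0 !ler_norml => /andP[? ?] /andP[? ?]; apply/andP; split; lra.
have T t : trig t -> agrees (fun x => chi x * (t (x g) * moment l x)%:C%C).
  by move=> tt; apply: agrees_trig => // chi'; exact: IHl.
have reE (k : G -> R) : (fun x => complex.Re (chi x * (k (x g) * moment l x)%:C%C)) =
    fun x => complex.Re (chi x) * (k (x g) * moment l x).
  by apply/funext => x; rewrite complex_ReM /= mulr0 subr0.
have imE (k : G -> R) : (fun x => complex.Im (chi x * (k (x g) * moment l x)%:C%C)) =
    fun x => complex.Im (chi x) * (k (x g) * moment l x).
  by apply/funext => x; rewrite complex_ImM /= mulr0 add0r.
rewrite /agrees /complex_mean reE imE; congr (_ +i* _)%C; apply: key => //.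
- by move=> x; have [] := reim1 x.
- by move=> t /T; rewrite /agrees /complex_mean reE => -[].
- by move=> x; have [] := reim1 x.
- by move=> t /T; rewrite /agrees /complex_mean imE => -[].
Qed.

Lemma mean_of_moment l : continuous_factors l -> mean_of mu (moment l) = mean_of nu (moment l).
Proof.
move=> cl; have [] := agrees_moment cl (map_character1 R Gamma G).
have -> : (fun x => complex.Re (1 * (moment l x)%:C%C)) = moment l.
  by apply/funext => x; rewrite mul1r.
by [].
Qed.

End moments.

Section ramp.
Variable R : realType.

(** Continuous approximation of the indicator of [0 < t]; composed with radius minus distance it
    approximates an open ball. *)
Definition ramp (k : nat) (t : R) : R := Num.min 1 (k%:R * Num.max 0 t).

Lemma ramp_continuous k : continuous (ramp k).
Proof.
have cm : continuous (fun t : R => k%:R * Num.max 0 t).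
  move=> t; apply: (@continuousM _ _ (cst k%:R)); first exact: cst_continuous.
  apply: (@max_fun_continuous _ _ R (cst 0) id); first exact: cst_continuous.
  by move=> ?; exact: cvg_id.
by apply: (@min_fun_continuous _ _ R (cst 1)); first exact: cst_continuous.
Qed.

Lemma ramp_itv k t : 0 <= ramp k t <= 1.
Proof. by rewrite /ramp le_min ler01 ge_min lexx mulr_ge0 // le_max lexx. Qed.

Lemma ramp_limit t : ramp ^~ t @ \oo --> ((0 < t)%R%:R : R).
Proof.
have [t0|t0] := ltP 0 t; last first.
  rewrite (_ : ramp ^~ t = fun=> 0); first exact: cvg_cst.
  by apply/funext => k; rewrite /ramp (max_idPl t0) mulr0 (min_idPr _).
apply: cvg_near_cst; near=> k; rewrite /ramp (max_idPr (ltW t0)); apply/min_idPl.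
rewrite -ler_pdivrMr // div1r; near: k; exact: nbhs_infty_ger.
Unshelve. all: end_near. Qed.

End ramp.

(** * From coordinate functions to Borel sets *)

Section uniqueness.
Variables (R : realType) (Gamma : groupType) (G : topologicalZmodType).
Variables (d : G -> G -> R) (en : nat -> Gamma).
Local Notation X := (fun_space Gamma G).
Local Notation C := R[i].
Hypotheses (d0 : forall x y, d x y = 0 <-> x = y)
  (dC : forall x y, d x y = d y x)
  (dT : forall x y z, d x z <= d x y + d y z)
  (dN : forall x (A : set G),
     nbhs x A <-> exists2 e : R, 0 < e & [set y | d x y < e] `<=` A)
  (cG : compact [set: G]) (en_surj : forall g, exists i, en i = g).
Implicit Types (mu nu : probability (borel_type X) R) (s : seq (Gamma * (G * R))).

Lemma open_measurable_borel (U : set X) : open U -> measurable (U : set (borel_type X)).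
Proof. exact: sub_gen_smallest. Qed.

(** Each point off [K] has a null open neighbourhood; the countable base covers all these points by
    countably many null cylinders. *)
Lemma support_null mu (K : set X) : closed K -> measure_support mu `<=` K -> mu (~` K) = 0%E.
Proof.
move=> clK suppK; have oK : open (~` K) by rewrite openC.
have [q q_dense] := dist_dense dC dN (0 : G) cG.
pose B := basic_cylinder d en q.
have mB c : measurable (B c : set (borel_type X)).
  by apply: open_measurable_borel; exact: open_basic_cylinder.
pose D n : set (borel_type X) := if unpickle n is Some c then
  (if mu (B c) == 0%E then B c else set0) else set0.
apply/(negligibleP mu (open_measurable_borel oK)).
have nD : mu.-negligible (\bigcup_n D n).
  apply: negligible_bigcup => n; rewrite /D; case: unpickle => [c|]; last exact: negligible_set0.
  by case: eqP => [Bc|_]; [exact/(negligibleP mu (mB c))|exact: negligible_set0].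
apply: negligibleS nD => x Kx; have /existsNP[U /not_implyP[oU /not_implyP[Ux /negP]]] : ~ measure_support mu x.
  by move=> /suppK.
rewrite -leNgt => U0; have [c cx cU] := basic_cylinderP d0 dC dT dN cG en_surj q_dense oU Ux.
exists (pickle c) => //; rewrite /D pickleK; case: eqP => // -[]; apply/eqP.
rewrite eq_le measure_ge0 andbT; apply: le_trans U0.
by apply: le_measure; rewrite ?inE //; exact: open_measurable_borel.
Qed.

(** Unlike in [basic_cylinder], coordinates, centres and radii are free, so that concatenating lists
    gives intersections: a pi-system. *)
Fixpoint open_cylinder s : set X :=
  if s is p :: s' then [set x | d (x p.1) p.2.1 < p.2.2] `&` open_cylinder s' else setT.

Lemma open_cylinder_cat s s' : open_cylinder (s ++ s') = open_cylinder s `&` open_cylinder s'.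
Proof. by elim: s => [|p s IHs] /=; rewrite ?setTI // IHs setIA. Qed.

Lemma open_open_cylinder s : open (open_cylinder s).
Proof.
elim: s => [|p s IHs] /=; first exact: openT.
apply: openI => //.
apply: (@open_comp _ _ (fun x : X => d (x p.1) p.2.1) [set r | r < p.2.2]); last exact: open_lt.
move=> x _; apply: (continuous_comp (f := fun x : X => x p.1) (g := fun z => d z _)).
  exact: eval_continuous.
exact: (dist_continuous dC dT dN).
Qed.

Definition ramp_factors k s : seq (Gamma * (G -> R)) :=
  [seq (p.1, fun y => ramp k (p.2.2 - d y p.2.1)) | p <- s].

Lemma ramp_factors_continuous k s : continuous_factors (ramp_factors k s).
Proof.
elim: s => [|p s IHs] //=; split=> // y.
apply: (continuous_comp (f := fun y => p.2.2 - d y p.2.1) (g := ramp k)).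
  apply: (@continuousB _ _ _ (cst p.2.2) (fun y : G => d y p.2.1)).
    exact: cst_continuous.
  exact: (dist_continuous dC dT dN).
exact: ramp_continuous.
Qed.

Lemma ramp_factors_itv k s x : 0 <= moment (ramp_factors k s) x <= 1.
Proof.
elim: s => [|p s IHs]; first by rewrite /moment big_nil ler01 lexx.
move: IHs; rewrite /moment big_cons => /andP[? ?].
have /andP[? ?] := ramp_itv k (p.2.2 - d (x p.1) p.2.1).
by apply/andP; split; [exact: mulr_ge0|exact: mulr_ile1].
Qed.

Lemma ramp_factors_limit s x :
  (fun k => moment (ramp_factors k s) x) @ \oo --> (\1_(open_cylinder s) x : R).
Proof.
elim: s => [|p s IHs].
  rewrite (_ : (fun _ => _) = fun=> 1); last by apply/funext => k; rewrite /moment big_nil.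
  by rewrite indicT; exact: cvg_cst.
rewrite (_ : (fun _ => _) = fun k => ramp k (p.2.2 - d (x p.1) p.2.1) * moment (ramp_factors k s) x).
  rewrite /= indicI; apply: cvgM => //.
  have := @ramp_limit R (p.2.2 - d (x p.1) p.2.1).
  rewrite subr_gt0 indicE (_ : (x \in _) = (d (x p.1) p.2.1 < p.2.2)) //.
  by apply/idP/idP; [move/set_mem|move=> ?; apply/mem_set].
by apply/funext => k; rewrite /moment big_cons.
Qed.

(** Products of ramps converge to indicators of cylinders, so dominated convergence carries equality
    of moments to a pi-system that generates the Borel sets. *)
Lemma measure_eq_of_characters mu nu : (exists I : (G -> R) -> R, haar I) ->
  (forall chi : X -> C, map_character chi -> complex_mean mu chi = complex_mean nu chi) ->
  forall A : set (borel_type X), measurable A -> nu A = mu A.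
Proof.
move=> [I hI] agree A mA.
have cX : compact [set: X] by exact: compact_fun_space.
have cylE s : mu (open_cylinder s) = nu (open_cylinder s).
  have ms := open_measurable_borel (open_open_cylinder s).
  have L (m : probability (borel_type X) R) :
      (fun k => mean_of m (moment (ramp_factors k s))) @ \oo --> fine (m (open_cylinder s)).
    apply: mean_of_limit => //.
    - by move=> k; apply: moment_continuous; exact: ramp_factors_continuous.
    - by move=> k x; exact: ramp_factors_itv.
    - by move=> x; exact: ramp_factors_limit.
  have E : fine (mu (open_cylinder s)) = fine (nu (open_cylinder s)).
    rewrite -(cvg_lim _ (L mu)) // -(cvg_lim _ (L nu)) //; congr (limn _).
    apply/funext => k; apply: (mean_of_moment cG _ agree).
      move=> f e cf e0; exact: (trig_dense hI d0 dC dT dN cG cf e0).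
    exact: ramp_factors_continuous.
  by rewrite -[LHS]fineK ?fin_num_measure // E fineK // fin_num_measure.
pose cyl : set (set (borel_type X)) := range open_cylinder.
apply/esym; apply: (@g_sigma_algebra_measure_unique _ R (borel_type X) cyl _ (fun=> setT)).
- by move=> _ [s _ <-]; apply: open_measurable_borel; exact: open_open_cylinder.
- by move=> _; exists [::].
- by rewrite bigcup_const //; exists 0%N.
- by move=> _ _ [s _ <-] [s' _ <-]; exists (s ++ s') => //; rewrite open_cylinder_cat.
- by move=> _ [s _ <-]; exact: cylE.
- by move=> _; rewrite [X in (X < _)%E]probability_setT ltry.
move: A mA; apply: smallest_sub; first exact: smallest_sigma_algebra.
have [q q_dense] := dist_dense dC dN (0 : G) cG.
move=> U oU; have [D [-> HD]] := open_bigcup_cylinders d0 dC dT dN cG en_surj q_dense oU.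
have [S0 SC SU] : sigma_algebra setT <<s cyl >> by exact: smallest_sigma_algebra.
apply: SU => n; have [->//|[c ->]] := HD n; apply: sub_gen_smallest.
exists [seq (en i, (q (nth 0%N c.2 i), (2 * c.1.+1%:R)^-1)) | i <- iota 0 c.1.+1] => //.
have E (l : seq nat) x :
    open_cylinder [seq (en i, (q (nth 0%N c.2 i), (2 * c.1.+1%:R)^-1)) | i <- l] x <->
    forall i, i \in l -> d (x (en i)) (q (nth 0%N c.2 i)) < (2 * c.1.+1%:R)^-1.
  elim: l => [|i l IHl] //=; split=> [[xi /IHl xl] j|xl].
    by rewrite inE => /predU1P[->//|/xl].
  split; first by apply: xl; rewrite mem_head.
  by apply/IHl => j jl; apply: xl; rewrite inE jl orbT.
apply/seteqP; split=> x.
  by move=> /E xs i ic; apply: xs; rewrite mem_iota.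
by move=> xs; apply/E => i; rewrite mem_iota; exact: xs.
Qed.

Theorem invariant_probability_unique (Gamma_fg : finitely_generated Gamma) (P : X) n mu nu :
  vanishing n P -> invariant_on_orbit_closure P mu -> invariant_on_orbit_closure P nu ->
  forall A : set (borel_type X), measurable A -> nu A = mu A.
Proof.
move=> vP [imu smu] [inu snu].
have cX : compact [set: X] by exact: compact_fun_space.
have ct g : continuous (@translate Gamma G g) by exact: (translate_continuous d0 dC dT dN cG en_surj).
apply: measure_eq_of_characters; first exact: haar_exists dC dT dN cG.
move=> chi hchi; have cchi := map_character_cont hchi.
(* [c] depends only on [chi] and [P], so both measures integrate [chi] to it. *)
have [c Hc] := phase_poly_state Gamma_fg (fun g => map_character_norm hchi (translate g P))
  (phase_poly_orbit_vanishing (map_character_mul hchi) vP).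
have E (m : probability (borel_type X) R) : invariant_measure m ->
    measure_support m `<=` orbit_closure P -> complex_mean m chi = c.
  move=> im sm; have m0 : m (~` orbit_closure P) = 0%E.
    by apply: support_null => //; exact: closed_closure.
  rewrite -(orbit_stateE m0 cchi).
  apply: (Hc _ _ (orbit_invariant_state cX ct im m0)).
  by exists chi.
by rewrite (E mu) // (E nu).
Qed.

End uniqueness.

(** Words in the generators and their inverses, the boolean giving the sign, are countable through
    [pickle]. *)
Lemma finitely_generated_enum (Gamma : groupType) : finitely_generated Gamma ->
  exists en : nat -> Gamma, forall g, exists i, en i = g.
Proof.
move=> /finitely_generated_ind[S HS].
pose word (w : seq (nat * bool)) : Gamma := foldr (fun p x =>
  ((if p.2 then nth 1 S p.1 else (nth 1 S p.1)^-1) * x)%g) 1%g w.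
pose inv (w : seq (nat * bool)) := rev [seq (p.1, ~~ p.2) | p <- w].
have wordD w w' : word (w ++ w') = (word w * word w')%g.
  by elim: w => [|p w IHw] /=; rewrite ?mul1g // IHw mulgA.
have wordV w : word (inv w) = (word w)^-1%g.
  elim: w => [|p w IHw] /=; first by rewrite invg1.
  rewrite /inv map_cons rev_cons -cats1 wordD IHw invgM /= mulg1.
  by case: p.2 => //=; rewrite invgK.
exists (fun n => if unpickle n is Some w then word w else 1%g).
suff H : forall g, exists w, word w = g.
  by move=> g; have [w <-] := H g; exists (pickle w); rewrite pickleK.
apply: (HS (fun g => exists w, word w = g)) => [|x y [w <-] [w' <-]|s sS]; first by exists [::].
  by exists (w ++ inv w'); rewrite wordD wordV.
by exists [:: (index s S, true)]; rewrite /= mulg1 nth_index.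
Qed.

Theorem theorem1p3 (R : realType) (Gamma : groupType) (G : topologicalZmodType)
    (P : Gamma -> G)
    (Gamma_fg : finitely_generated Gamma)
    (G_compact : compact [set: G])
    (G_metrizable : metrizable R G)
    (P_poly : polynomial_map P) :
  uniquely_ergodic R P.
Proof.
have [d [d0 dC dT dN]] := G_metrizable.
have [en en_surj] := finitely_generated_enum Gamma_fg.
have [n /polynomial_vanishing vP] := P_poly.
have [mu Pmu] := invariant_probability d0 dC dT dN G_compact en_surj vP.
exists mu; split=> // nu Pnu.
exact: (invariant_probability_unique d0 dC dT dN G_compact en_surj Gamma_fg vP).
Qed.
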